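(* Assume: (i) $R\in\mathrm P(\Omega)$ is a stationary Markov process with invariant law $m=R_t\in\mathrm P(\mathcal X)$ for all $t\in[0,1]$; (ii) $\gamma$ is an admissible Young function for $g_1$ (as defined in the context) and $\gamma^*$ is its convex conjugate; (iii) $V:[0,1]\times\mathcal X\to\mathbb R$ is measurable, bounded below, and $\{\gamma^*(V_t);t\in[0,1]\}$ is uniformly integrable in $L^1(m)$; (iv) $g_1$ is a nonnegative function on $\mathcal X$ in $L^\gamma(m)$. Then the function $g:(t,x)\in[0,1]\times\mathcal X\mapsto g_t(x)\in[0,\infty)$, defined for all $t\in[0,1]$, $m$-almost everywhere, by $$g_t(X_t):=E_R\Big[\exp\Big(-\int_{[t,1]}V_s(X_s)\,ds\Big)g_1(X_1)\,\Big|\,X_{[0,t]}\Big],\quad R\text{-a.s.},$$ is a nonnegative function in $L^\gamma([0,1]\times\mathcal X,dt\,m(dx))$ which is in $\operatorname{dom}L^R$ and in $\operatorname{dom}\mathcal L^R$. Moreover, it satisfies $$L^Rg(t,x)=\mathcal L^Rg(t,x)=V_t(x)g_t(x),\quad dt\,m(dx)\text{-a.e.},$$ and $\int_{[0,1]\times\mathcal X}|V_t(x)|g_t(x)\,dt\,m(dx)<\infty$.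
   Context: $\mathcal X$ is a Polish space with its Borel $\sigma$-field; $\Omega=D([0,1],\mathcal X)$ is the set of right continuous, left limited paths, with canonical process $X$, $\sigma$-field $\sigma(X_t;t\in[0,1])$ and canonical filtration $(\sigma(X_{[0,t]}))_t$, $X_{[s,t]}=(X_r)_{s\le r\le t}$. $\mathrm P(\cdot)$ denotes sets of probability measures; $R_t$ is the law of $X_t$ under $R$. $R$ is Markov if for all $t$, $X_{[0,t]}$ and $X_{[t,1]}$ are independent under $R(\cdot\mid X_t)$. Young functions: $\gamma:\mathbb R\to[0,\infty]$ is a Young function if it is convex, even, lower semicontinuous and $\gamma(0)=0$; $\gamma^*(b)=\sup_{a\ge0}\{a|b|-\gamma(a)\}$; $L^\gamma(\mu)=\{u$ measurable: $\int\gamma(a_o|u|)\,d\mu<\infty$ for some $a_o>0\}$; $L\log L(m)=\{u$ measurable: $\int|u|\log_+|u|\,dm<\infty\}$. $\gamma\in\Delta_2$ means there are $C,A>0$ with $\gamma(2a)\le C\gamma(a)$ for $a\ge A$. Admissible for $g_1$: $\int_{\mathcal X}g_1\log_+g_1\,dm<\infty$, $\int_{\mathcal X}\gamma(g_1)\,dm<\infty$, $L^p(m)\subset L^\gamma(m)\subset L\log L(m)$ for some $1<p<\infty$, and $\gamma\in\Delta_2$. Local martingale: $M$ is a local $R$-martingale if there are $[0,1]\cup\{\infty\}$-valued stopping times $\tau_k\to\infty$ $R$-a.s. such that each $M^{\tau_k}$ is a uniformly integrable $R$-martingale. Extended generator: a measurable $u$ on $[0,1]\times\mathcal X$ is in $\operatorname{dom}\mathcal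 L^R$ if there is a measurable $v$ with $\int_{[0,1]}|v(t,X_t)|\,dt<\infty$ $R$-a.e. such that $u(t,X_t)-u(0,X_0)-\int_{[0,t]}v(s,X_s)\,ds$ is a local $R$-martingale; $\mathcal L^Ru:=v$. Stochastic derivative: for a stopping time $\tau$ put $\overline X^\tau_t=(t\wedge\tau,X_{t\wedge\tau})$; $\tau$ is an $R$-integration time of $u$ if $\{u(\overline X^\tau_t);t\in[0,1]\}$ is uniformly $R$-integrable. A measurable $u$ on $[0,1]\times\mathcal X$ admits a stochastic derivative at time $t$ if for $R_t$-almost all $x$ there is an $R$-integration time $\sigma^x\ge t$ of $u$ such that for any $R$-integration time $\tau>\sigma^x$ of $u$ (inequalities $R$-a.e.) the limit $L^Ru(t,x):=\lim_{h\downarrow0}E_R(\frac1h[u(\overline X^\tau_{t+h})-u(t,x)]\mid X_t=x)$ exists and does not depend on $\tau$. If this holds for $dt\,R_t(dx)$-almost all $(t,x)$, $u\in\operatorname{dom}L^R$. *)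

(* Defs.v *)
From HB Require Import structures.
From mathcomp Require Import all_boot all_order all_algebra.
From mathcomp Require Import all_classical all_reals all_analysis.
From mathcomp Require Import measurable_realfun.

Set Implicit Arguments.
Unset Strict Implicit.
Unset Printing Implicit Defensive.

Import Order.TTheory GRing.Theory Num.Theory.
Import numFieldNormedType.Exports.

Local Open Scope classical_set_scope.
Local Open Scope ring_scope.

(* Together with the completeness of [X], this says that [X] is a separable
   complete metric space; every Polish space is of this form, and below [X]
   occurs only through its topology. *)
Definition polish (R : realType) (X : completePseudoMetricType R) : Prop :=
  hausdorff_space X /\ exists2 D : set X, countable D & dense D.

Definition borelType (X : ptopologicalType) := g_sigma_algebraType (@open X).

HB.instance Definition _ (X : ptopologicalType) := Measurable.on (borelType X).

(* A path on [0, 1] is encoded by its extension to the real line which is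
   constant on ]-oo, 0] and on [1, +oo[; this is a bijection with
   D([0, 1], X), and the two limit conditions are trivial outside [0, 1]. *)
Record cadlag (R : realType) (X : ptopologicalType) := Cadlag {
  cadlag_fun :> R -> X ;
  cadlag_right : forall t : R,
    cadlag_fun s @[s --> t^'+] --> cadlag_fun t ;
  cadlag_left : forall t : R,
    exists l : X, cadlag_fun s @[s --> t^'-] --> l ;
  cadlag_le0 : forall t : R, t <= 0 -> cadlag_fun t = cadlag_fun 0 ;
  cadlag_ge1 : forall t : R, 1 <= t -> cadlag_fun t = cadlag_fun 1 }.

Section path_space.
Variables (R : realType) (X : ptopologicalType).

HB.instance Definition _ := gen_eqMixin (cadlag R X).
HB.instance Definition _ := gen_choiceMixin (cadlag R X).

Program Definition cst_cadlag : cadlag R X := @Cadlag R X (cst point) _ _ _ _.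
Next Obligation. by move=> t; exact: cvg_cst. Qed.
Next Obligation. by move=> t; exists point; exact: cvg_cst. Qed.
Next Obligation. by []. Qed.
Next Obligation. by []. Qed.

HB.instance Definition _ := isPointed.Build (cadlag R X) cst_cadlag.

Definition path_at (t : R) (w : cadlag R X) : borelType X := w t.

(* sigma(X_t) *)
Definition sigma_at (t : R) : set (set (cadlag R X)) :=
  preimage_set_system setT (path_at t) measurable.

(* sigma(X_[s, t]) *)
Definition sigma_between (s t : R) : set (set (cadlag R X)) :=
  <<s \bigcup_(r in `[s, t]) sigma_at r >>.

Definition path_gen : set (set (cadlag R X)) :=
  \bigcup_(r in `[(0:R), 1]) sigma_at r.

HB.instance Definition _ :=
  Measurable.copy (cadlag R X) (g_sigma_algebraType path_gen).

End path_space.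

Definition young_function (R : realType) (gamma : R -> \bar R) : Prop :=
  [/\ forall a, (0 <= gamma a)%E,
      forall a b t : R, 0 <= t <= 1 ->
        (gamma (t * a + (1 - t) * b)%R
           <= t%:E * gamma a + (1 - t)%:E * gamma b)%E,
      forall a, gamma (- a) = gamma a,
      lower_semicontinuous gamma
    & gamma 0 = 0%E].

Definition young_conj (R : realType) (gamma : R -> \bar R) (b : R) : \bar R :=
  ereal_sup [set ((a * `|b|)%:E - gamma a)%E | a in [set a : R | 0 <= a]].

Definition delta2 (R : realType) (gamma : R -> \bar R) : Prop :=
  exists C A : R, [/\ 0 < C, 0 < A &
    forall a, A <= a -> (gamma (2 * a)%R <= C%:E * gamma a)%E].

Definition log_plus (R : realType) (a : R) : R := Num.max 0 (ln a).

Section function_spaces.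
Context d (T : measurableType d) (R : realType).
Variable mu : {measure set T -> \bar R}.

Definition orlicz (D : set T) (gamma : R -> \bar R) : set (T -> R) :=
  [set u : T -> R | measurable_fun D u /\
    exists2 a : R, 0 < a & (\int[mu]_(x in D) gamma (a * `|u x|)%R < +oo)%E].

Definition LlogL : set (T -> R) :=
  [set u : T -> R | measurable_fun setT u /\
    (\int[mu]_x (`|u x| * log_plus `|u x|)%:E < +oo)%E].

Definition uniformly_integrable (J : Type) (I : set J) (f : J -> T -> \bar R) :=
  (forall i, I i -> measurable_fun setT (f i)) /\
  forall e : R, 0 < e -> exists K : R, forall i, I i ->
    (\int[mu]_(x in [set x | K%:E < `|f i x|]) `|f i x| <= e%:E)%E.

Definition admissible (g1 : T -> R) (gamma : R -> \bar R) : Prop :=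
  [/\ young_function gamma,
      (\int[mu]_x (g1 x * log_plus (g1 x))%:E < +oo)%E,
      (\int[mu]_x gamma (g1 x) < +oo)%E,
      exists2 p : R, 1 < p &
        [set u | u \in Lfun mu p%:E] `<=` orlicz setT gamma /\
        orlicz setT gamma `<=` LlogL
    & delta2 gamma].

(* [Z] is a version of the conditional expectation of [Y] given the
   sigma-field [G]. *)
Definition is_cond_exp (G : set (set T)) (Y Z : T -> R) : Prop :=
  [/\ mu.-integrable setT (EFin \o Y),
      mu.-integrable setT (EFin \o Z),
      forall B : set R, measurable B -> G (Z @^-1` B)
    & forall A, G A ->
        (\int[mu]_(w in A) (Z w)%:E = \int[mu]_(w in A) (Y w)%:E)%E].

End function_spaces.

Section path_measure.
Variables (R : realType) (X : completePseudoMetricType R).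
Variable P : probability (cadlag R X) R.
Implicit Types (u v l : R -> X -> R) (tau sigma : cadlag R X -> \bar R).
Implicit Types (M : R -> cadlag R X -> R) (t h : R) (w : cadlag R X).

Definition I01X : set (measurableTypeR R * borelType X) := `[0, 1] `*` setT.

(* A function on [0, 1] x X is given in curried form, and its values for times
   outside [0, 1] are irrelevant. *)
Definition time_space (u : R -> X -> R) :
  measurableTypeR R * borelType X -> R := fun z => u z.1 z.2.

Definition measurable01 u : Prop := measurable_fun I01X (time_space u).

Definition is_stationary (m : set (borelType X) -> \bar R) : Prop :=
  forall t, 0 <= t <= 1 ->
  forall B : set (borelType X), measurable B -> P (path_at t @^-1` B) = m B.

Definition is_markov : Prop :=
  forall t, 0 <= t <= 1 ->
  forall A B, sigma_between 0 t A -> sigma_between t 1 B ->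
  exists a b c : cadlag R X -> R,
    [/\ is_cond_exp P (sigma_at t) \1_A a,
        is_cond_exp P (sigma_at t) \1_B b,
        is_cond_exp P (sigma_at t) \1_(A `&` B) c
      & {ae P, forall w, c w = a w * b w}].

(* [phi] is a version of the function x |-> E_P(Y | X_t = x). *)
Definition cond_exp_at t (Y : cadlag R X -> R) (phi : borelType X -> R) :=
  measurable_fun setT phi /\
  is_cond_exp P (sigma_at t) Y (fun w => phi (path_at t w)).

(* The measure dt P_t(dx) on [0, 1] x X. *)
Definition occupation (A : set (measurableTypeR R * borelType X)) : \bar R :=
  (\int[lebesgue_measure]_(t in `[0%R, 1%R])
    P [set w | A (t, path_at t w)])%E.

Definition stopping_time tau : Prop :=
  (forall w, (0 <= tau w <= 1)%E \/ tau w = +oo%E) /\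
  forall t, 0 <= t <= 1 -> sigma_between 0 t [set w | (tau w <= t%:E)%E].

Definition stop tau t w : R := fine (Order.min t%:E (tau w)).

Definition martingale M : Prop :=
  forall s t, 0 <= s -> s <= t -> t <= 1 ->
  is_cond_exp P (sigma_between 0 s) (M t) (M s).

Definition ui_martingale M : Prop :=
  martingale M /\
  uniformly_integrable P [set` `[(0:R), 1]] (fun t w => (M t w)%:E).

Definition local_martingale M : Prop :=
  exists tau : nat -> cadlag R X -> \bar R,
    [/\ forall k, stopping_time (tau k),
        {ae P, forall w, tau k w @[k --> \oo] --> +oo%E}
      & forall k, ui_martingale (fun t w => M (stop (tau k) t w) w)].

(* u belongs to the domain of the extended generator of P, which maps it
   to v. *)
Definition is_extended_generator u v : Prop :=
  [/\ measurable01 u,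
      measurable01 v,
      {ae P, forall w,
        (\int[lebesgue_measure]_(s in `[0%R, 1%R]) `|v s (w s)|%:E < +oo)%E}
    & local_martingale (fun t w => u t (w t) - u 0 (w 0)
        - \int[lebesgue_measure]_(s in `[0, t]) v s (w s))].

Definition integration_time u tau : Prop :=
  stopping_time tau /\
  uniformly_integrable P [set` `[(0:R), 1]]
    (fun t w => (u (stop tau t w) (w (stop tau t w)))%:E).

Definition increment_rate u tau t h w : R :=
  h^-1 * (u (stop tau (t + h) w) (w (stop tau (t + h) w)) - u t (w t)).

(* u belongs to the domain of the stochastic derivative of P, whose value
   is l.  For given t, tau and h, the function x |-> E_P( . | X_t = x) is only
   defined up to a P_t-null set: [E t tau h] is a choice of version of it.  A
   regular conditional law given X_t, fixed once for all h, is not suitable: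
   the exceptional null sets depend on h, and the pointwise limit h -> 0+ might
   then fail to exist because of them.  The existence of some tau beyond sigma
   is required so that the limit is that of at least one actual family. *)
Definition is_stochastic_derivative u l : Prop :=
  measurable01 u /\
  exists E : R -> (cadlag R X -> \bar R) -> R -> borelType X -> R,
  (forall t tau h, 0 <= t -> 0 < h -> t + h <= 1 ->
     integration_time u tau -> {ae P, forall w, (t%:E <= tau w)%E} ->
     cond_exp_at t (increment_rate u tau t h) (E t tau h)) /\
  {ae occupation, forall z : measurableTypeR R * borelType X,
    exists sigma,
      [/\ integration_time u sigma,
          {ae P, forall w, (z.1%:E <= sigma w)%E},
          exists2 tau, integration_time u tau
            & {ae P, forall w, (sigma w < tau w)%E}
        & forall tau, integration_time u tau ->
            {ae P, forall w, (sigma w < tau w)%E} ->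
            E z.1 tau h z.2 @[h --> 0^'+] --> l z.1 z.2]}.

(* exp (- \int_[t, 1] V_s(X_s) ds) g1(X_1), where the integral may be +oo. *)
Definition feynman_kac_functional (V : R -> X -> R) (g1 : X -> R) t w : R :=
  fine (expeR (- \int[lebesgue_measure]_(s in `[t, 1%R]) (V s (w s))%:E)%E)
  * g1 (w 1).

(* For every t, the function g t is determined P_t-almost everywhere. *)
Definition feynman_kac (V : R -> X -> R) (g1 : X -> R) (g : R -> X -> R) :=
  measurable01 g /\
  forall t, 0 <= t <= 1 ->
    is_cond_exp P (sigma_between 0 t) (feynman_kac_functional V g1 t)
      (fun w => g t (w t)).

End path_measure.

(* Main.v *)
(* Put [F t = exp (- \int_[t, 1] V_s(X_s) ds) g1(X_1)], so that [g t (X_t)] is the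
   conditional expectation of [F t] given [X_[0, t]].  Along almost every path
   [F t - F s = \int_[s, t] V_r(X_r) F r dr], and since [V_r(X_r)] is known at time
   [r], the conditional expectations of [g t (X_t) - g s (X_s)] and of
   [\int_[s, t] (V g)(r, X_r) dr] given [X_[0, s]] agree: the process of the
   extended generator is a true, uniformly integrable martingale.  Integrability
   of [V g] comes from Young's inequality, a bound for [gamma (a g)] being given
   by a conditional Jensen inequality.

   For the stochastic derivative take [sigma = 1]: then [tau = +oo], and it
   remains to prove that [h^-1 E(\int_[t, t + h] f(r, X_r) dr | X_t = x)] tends to
   [f(t, x)] for almost every [(t, x)], for [f >= 0] with bounded integrals
   against [m].  For bounded [f] this is Lebesgue's differentiation theorem along
   the paths, followed by conditional bounded convergence.  The general case
   follows by truncation from a weak type maximal inequality, which is Hopf's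
   maximal ergodic lemma on the grids [t + delta * N], proved by Garsia's argument
   and integrated over [t]. *)

Require Import Defs.
From HB Require Import structures.
From mathcomp Require Import all_boot all_order all_algebra.
From mathcomp Require Import all_classical all_reals all_analysis.
From mathcomp Require Import measurable_realfun.
From mathcomp Require Import ring lra.

Set Implicit Arguments.
Unset Strict Implicit.
Unset Printing Implicit Defensive.

Import Order.TTheory GRing.Theory Num.Theory.
Import numFieldNormedType.Exports.

Local Open Scope classical_set_scope.
Local Open Scope ring_scope.

Import HBSimple HBNNSimple.

(** * Conditional expectations *)

(** The obstacle is that [E( . | X_t = x)] exists only up to null sets depending on [t] and on the
    window length [h], while a limit in [h] is wanted for almost every [(t, x)]. Hence for each rate
    [f] a single function [q t r x] is fixed, measurable in all variables and a version of
    [E(f(r, X_r) | X_t = x)] for all [t] and [r]; its integral over [r] serves all [h] at once and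
    is nondecreasing in [h]. Such a [q] comes from a countable algebra that generates the Borel sets
    of the Polish space. Monotonicity in [h] reduces the limit to the windows [1 / (k + 1)], and any
    finite number of these fit on one grid, of step [1 / K!]. Stationarity bears on one-dimensional
    laws and [f] depends on time, so no fixed transformation is at hand for an ergodic theorem.
    Garsia's inequality therefore compares the maximum at time [t] with the one at time [t + delta],
    and the two cancel only after integration over [t], by translation invariance of Lebesgue
    measure; this is why rates are extended by [0] outside [[0, 1]]. *)

Section sub_sigma_algebra.
Context d (T : measurableType d) (R : realType) (mu : {measure set T -> \bar R}).
Variable G : set (set T).
Hypothesis sG : sigma_algebra setT G.
Hypothesis GM : G `<=` measurable.
Local Open Scope ereal_scope.

Lemma sub_measurable_fun d' (U : measurableType d') (W : T -> U) :
  (forall B, measurable B -> G (W @^-1` B)) -> measurable_fun setT W.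
Proof. by move=> GW _ B mB; rewrite setTI; exact/GM/GW. Qed.

(** Transfers [G]-measurability, stated by preimages, to measurability on the type generated by [G];
    the closure properties of measurable functions then apply to sub-sigma-algebras. *)
Lemma g_sigma_measurable_fun d' (U : measurableType d') (W : T -> U) :
  (forall B, measurable B -> G (W @^-1` B)) <->
  measurable_fun setT (W : g_sigma_algebraType G -> U).
Proof.
split=> [GW _ B mB|mW B mB].
  by rewrite setTI; apply: sub_sigma_algebra; exact: GW.
have := mW measurableT B mB; rewrite setTI.
by rewrite /measurable /= (sigma_algebra_id sG).
Qed.

(** [W] is the increasing limit of [G]-simple functions, for which both sides are finite
    combinations of integrals over sets of [G]; monotone convergence concludes. Nothing is assumed
    integrable and values may be infinite. *)
Lemma ge0_integralM_agree (Y Z W : T -> \bar R) :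
  measurable_fun setT Y -> measurable_fun setT Z ->
  (forall x, 0 <= Y x) -> (forall x, 0 <= Z x) ->
  (forall A, G A -> \int[mu]_(x in A) Y x = \int[mu]_(x in A) Z x) ->
  (forall x, 0 <= W x) -> (forall B, measurable B -> G (W @^-1` B)) ->
  \int[mu]_x (W x * Y x) = \int[mu]_x (W x * Z x).
Proof.
move=> mY mZ Y0 Z0 YZ W0 GW.
have mW := (g_sigma_measurable_fun W).1 GW.
pose h := nnsfun_approx (@measurableT _ (g_sigma_algebraType G)) mW.
pose hf n : g_sigma_algebraType G -> R := h n.
have Gh n (B : set R) : measurable B -> G (hf n @^-1` B).
  by have := (g_sigma_measurable_fun (hf n)).2; apply; exact: measurable_funP.
have h0 n x : 0 <= (hf n x)%:E by rewrite lee_fin; exact: (@fun_ge0 _ _ (h n)).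
have hE n x : hf n x = (\sum_(y \in range (hf n)) (y * \1_(hf n @^-1` [set y]) x))%R.
  exact: (fimfunE (h n)).
have mh n : measurable_fun setT (hf n : T -> R).
  by apply: sub_measurable_fun => B; exact: Gh.
have key (U : T -> \bar R) : measurable_fun setT U -> (forall x, 0 <= U x) ->
    \int[mu]_x (W x * U x) = limn (fun n => \int[mu]_x ((hf n x)%:E * U x)).
  move=> mU U0; rewrite -monotone_convergence//.
  - apply: eq_integral => x _; apply/esym/cvg_lim => //.
    have cvh : (hf n x)%:E @[n --> \oo] --> W x.
      exact: (@cvg_nnsfun_approx _ (g_sigma_algebraType G) _ _ measurableT W mW).
    (* Multiplication is not continuous at [0 * +oo]: the cases [U x = 0] and [U x = +oo] are
       treated apart, and in the latter [W x = 0] forces all approximants to vanish. *)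
    have [Ux0|Ux0] := eqVneq (U x) 0.
      by rewrite Ux0 mule0; under eq_fun do rewrite mule0; exact: cvg_cst.
    have Upos : 0 < U x by rewrite lt_neqAle eq_sym Ux0 U0.
    have := leey (U x); rewrite le_eqVlt => /predU1P[Uoo|Ufin].
      rewrite Uoo; have [Wx0|Wx0] := eqVneq (W x) 0.
        have hx0 n : (hf n x)%:E = 0.
          apply/eqP; rewrite eq_le h0 andbT -Wx0.
          rewrite /hf /h (@nnsfun_approxE _ (g_sigma_algebraType G)).
          exact: (@le_approx _ (g_sigma_algebraType G) _ setT W).
        by under eq_fun do rewrite hx0 mul0e; rewrite Wx0 mul0e; exact: cvg_cst.
      have Wpos : 0 < W x by rewrite lt_neqAle eq_sym Wx0 W0.
      rewrite gt0_muley//; apply: cvg_near_cst.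
      have : \forall n \near \oo, 0 < (hf n x)%:E by exact: (cvh [set y | 0 < y] (open_nbhs_nbhs (conj (@open_ereal_gt_ereal _ 0) Wpos))).
      by apply: filterS => n hn; rewrite gt0_muley.
    by apply: cvgeZr => //; rewrite ge0_fin_numE.
  - by move=> n; apply: emeasurable_funM => //; exact/measurable_EFinP.
  - by move=> n x _; rewrite mule_ge0.
  - move=> x _ m n mn; rewrite lee_wpmul2r// lee_fin.
    by have /(_ m n mn)/lefP := @nd_nnsfun_approx _ (g_sigma_algebraType G) _ _ measurableT W mW; exact.
rewrite !key//; congr (limn _); apply/funext => n.
have key2 (U : T -> \bar R) : measurable_fun setT U -> (forall x, 0 <= U x) ->
    \int[mu]_x ((hf n x)%:E * U x) =
    \sum_(y \in range (hf n)) (y%:E * \int[mu]_(x in hf n @^-1` [set y]) U x).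
  move=> mU U0.
  have fr : finite_set (range (hf n)) by exact: (fimfunP (h n)).
  have hi (r : R) x : (0 <= r * \1_(hf n @^-1` [set r]) x)%R.
    rewrite indicE; case: (boolP (x \in _)) => [|_]; last by rewrite mulr0.
    by rewrite inE mulr1 => /= <-; rewrite -lee_fin.
  transitivity (\int[mu]_x (\sum_(y \in range (hf n))
      ((y * \1_(hf n @^-1` [set y]) x)%:E * U x))).
    apply: eq_integral => x _.
    by rewrite hE -fsumEFin// ge0_mule_fsuml// => r; rewrite lee_fin.
  rewrite ge0_integral_fsum//=; last 2 first.
  - move=> r; apply: emeasurable_funM => //; apply/measurable_EFinP.
    apply: measurable_funM => //; apply: measurable_indic.
    by apply/GM/Gh; exact: measurable_set1.
  - by move=> r x _; rewrite mule_ge0// lee_fin.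
  apply: eq_fsbigr => r /[!inE] -[x _ <-].
  under eq_integral do rewrite EFinM -muleA.
  rewrite ge0_integralZl//; last first.
  - by move=> y _; rewrite mule_ge0// lee_fin.
  - apply: emeasurable_funM => //; apply/measurable_EFinP/measurable_indic.
    by apply/GM/Gh; exact: measurable_set1.
  congr (_ * _); rewrite [RHS]integral_mkcond; apply: eq_integral => y _.
  by rewrite epatch_indic muleC.
rewrite !key2//; apply: eq_fsbigr => r _; congr (_ * _).
by apply: YZ; exact: Gh.
Qed.

End sub_sigma_algebra.

Lemma integrable_ae_eq d (T : measurableType d) (R : realType)
    (mu : {measure set T -> \bar R}) (Y Y' : T -> R) :
  mu.-integrable setT (EFin \o Y) -> measurable_fun setT Y' ->
  {ae mu, forall x, Y x = Y' x} -> mu.-integrable setT (EFin \o Y').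
Proof.
move=> iY mY' e; have mY := measurable_int _ iY.
have mY'E : measurable_fun setT (EFin \o Y') by exact/measurable_EFinP.
apply/integrableP; split => //; move/integrableP : iY => [_].
rewrite (@ae_eq_integral _ _ _ mu setT (fun x => `|(Y' x)%:E|%E))//.
- exact: measurableT_comp.
- exact: measurableT_comp.
- by apply: filterS e => x /= ->.
Qed.

Section conditional_expectation.
Context d (T : measurableType d) (R : realType) (mu : {measure set T -> \bar R}).
Variable G : set (set T).
Hypothesis sG : sigma_algebra setT G.
Hypothesis GM : G `<=` measurable.
Local Open Scope ereal_scope.
Implicit Types Y Z W : T -> R.

Lemma sub_measurable_funM Y Z : (forall B, measurable B -> G (Y @^-1` B)) ->
  (forall B, measurable B -> G (Z @^-1` B)) ->
  forall B, measurable B -> G ((fun x => Y x * Z x)%R @^-1` B).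
Proof.
move=> /(g_sigma_measurable_fun sG) mY /(g_sigma_measurable_fun sG) mZ.
by apply/(g_sigma_measurable_fun sG); exact: measurable_funM.
Qed.

Lemma sub_measurable_funD Y Z : (forall B, measurable B -> G (Y @^-1` B)) ->
  (forall B, measurable B -> G (Z @^-1` B)) ->
  forall B, measurable B -> G ((fun x => Y x + Z x)%R @^-1` B).
Proof.
move=> /(g_sigma_measurable_fun sG) mY /(g_sigma_measurable_fun sG) mZ.
by apply/(g_sigma_measurable_fun sG); exact: measurable_funD.
Qed.

Lemma sub_measurable_funB Y Z : (forall B, measurable B -> G (Y @^-1` B)) ->
  (forall B, measurable B -> G (Z @^-1` B)) ->
  forall B, measurable B -> G ((fun x => Y x - Z x)%R @^-1` B).
Proof.
move=> /(g_sigma_measurable_fun sG) mY /(g_sigma_measurable_fun sG) mZ.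
by apply/(g_sigma_measurable_fun sG); exact: measurable_funB.
Qed.

Lemma sub_measurable_lt Y Z : (forall B, measurable B -> G (Y @^-1` B)) ->
  (forall B, measurable B -> G (Z @^-1` B)) -> G [set x | (Y x < Z x)%R].
Proof.
move=> gY gZ; have := sub_measurable_funB gZ gY.
move=> /(_ `]0%R, +oo[%classic (measurable_itv _)).
congr G; apply/seteqP; split => x /=; by rewrite in_itv/= andbT subr_gt0.
Qed.

(** Over the [G]-set where [Z' < Z], the integral of the positive function [Z - Z'] equals that of
    [Y - Y'], which is at most [0]; hence this set is null. *)
Lemma is_cond_exp_ae_le Y Z Y' Z' :
  is_cond_exp mu G Y Z -> is_cond_exp mu G Y' Z' ->
  {ae mu, forall x, (Y x <= Y' x)%R} -> {ae mu, forall x, (Z x <= Z' x)%R}.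
Proof.
move=> [iY iZ gZ eZ] [iY' iZ' gZ' eZ'] YY'.
pose A := [set x | (Z' x < Z x)%R].
have GA : G A by exact: sub_measurable_lt.
have mA : measurable A := GM GA.
have mTA f : mu.-integrable setT f -> mu.-integrable A f.
  exact: (integrableS measurableT).
have h : \int[mu]_(x in A) (Z x - Z' x)%:E <= 0.
  under eq_integral do rewrite EFinB.
  rewrite integralB_EFin//; [|exact: mTA..].
  rewrite eZ// eZ'// -integralB_EFin//; [|exact: mTA..].
  rewrite (@ae_eq_integral _ _ _ mu A (fun x => (- `|Y' x - Y x|)%:E))//.
  - rewrite -[leRHS]oppe0; under eq_integral do rewrite EFinN.
    rewrite integral_ge0N; first by rewrite leeN2 integral_ge0.
    by move=> x _; rewrite lee_fin.
  - apply/measurable_EFinP; apply: measurable_funB.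
      by apply/measurable_EFinP; exact: (measurable_int _ (mTA _ iY)).
    by apply/measurable_EFinP; exact: (measurable_int _ (mTA _ iY')).
  - apply/measurable_EFinP; apply: measurableT_comp => //.
    apply: measurableT_comp => //; apply: measurable_funB.
      by apply/measurable_EFinP; exact: (measurable_int _ (mTA _ iY')).
    by apply/measurable_EFinP; exact: (measurable_int _ (mTA _ iY)).
  - apply: filterS YY' => x YY' _; congr EFin.
    by rewrite ger0_norm ?subr_ge0// opprB.
have mZZ : measurable_fun A (fun x => (Z x - Z' x)%:E).
  apply/measurable_EFinP; apply: measurable_funB.
    by apply/measurable_EFinP; exact: (measurable_int _ (mTA _ iZ)).
  by apply/measurable_EFinP; exact: (measurable_int _ (mTA _ iZ')).
have : ae_eq mu A (fun x => (Z x - Z' x)%:E) (cst 0).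
  apply/(ae_eq_integral_abs _ mA mZZ); apply/eqP; rewrite eq_le; apply/andP; split.
    rewrite (le_trans _ h)// le_eqVlt; apply/orP; left; apply/eqP.
    apply: eq_integral => x /[!inE] Ax.
    by rewrite gee0_abs// lee_fin subr_ge0 ltW.
  by apply: integral_ge0 => x _; exact: abse_ge0.
apply: filterS => x Ax; rewrite leNgt; apply/negP => lx.
have /eqP := Ax lx; rewrite eqe subr_eq0 => /eqP e.
by move: lx; rewrite e ltxx.
Qed.

Lemma is_cond_exp_unique Y Z Z' :
  is_cond_exp mu G Y Z -> is_cond_exp mu G Y Z' ->
  {ae mu, forall x, Z x = Z' x}.
Proof.
move=> YZ YZ'; have YY : {ae mu, forall x, (Y x <= Y x)%R} by exact: aeW.
have := is_cond_exp_ae_le YZ YZ' YY; have := is_cond_exp_ae_le YZ' YZ YY.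
by apply: filterS2 => x a b; apply/eqP; rewrite eq_le a b.
Qed.

Lemma is_cond_expD Y Z Y' Z' :
  is_cond_exp mu G Y Z -> is_cond_exp mu G Y' Z' ->
  is_cond_exp mu G (fun x => Y x + Y' x)%R (fun x => Z x + Z' x)%R.
Proof.
move=> [iY iZ gZ eZ] [iY' iZ' gZ' eZ']; split.
- exact: (integrableD measurableT iY iY').
- exact: (integrableD measurableT iZ iZ').
- exact: sub_measurable_funD.
- move=> A GA; have mA := GM GA.
  under eq_integral do rewrite EFinD; under [RHS]eq_integral do rewrite EFinD.
  by rewrite !integralD_EFin// ?eZ ?eZ'//; exact: (integrableS measurableT).
Qed.

Lemma is_cond_expZ (k : R) Y Z :
  is_cond_exp mu G Y Z ->
  is_cond_exp mu G (fun x => k * Y x)%R (fun x => k * Z x)%R.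
Proof.
move=> [iY iZ gZ eZ]; split.
- exact: (integrableZl measurableT k iY).
- exact: (integrableZl measurableT k iZ).
- apply: (@sub_measurable_funM (cst k)) => //.
  by apply/(g_sigma_measurable_fun sG); exact: measurable_cst.
- move=> A GA; have mA := GM GA.
  under eq_integral do rewrite EFinM; under [RHS]eq_integral do rewrite EFinM.
  by rewrite !integralZl// ?eZ//; exact: (integrableS measurableT).
Qed.

Lemma is_cond_expB Y Z Y' Z' :
  is_cond_exp mu G Y Z -> is_cond_exp mu G Y' Z' ->
  is_cond_exp mu G (fun x => Y x - Y' x)%R (fun x => Z x - Z' x)%R.
Proof.
move=> YZ /(is_cond_expZ (-1)) /(is_cond_expD YZ).
under eq_fun do rewrite mulN1r; under [X in is_cond_exp _ _ _ X]eq_fun do rewrite mulN1r.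
by [].
Qed.

Lemma is_cond_exp_ae Y Y' Z :
  is_cond_exp mu G Y Z -> measurable_fun setT Y' ->
  {ae mu, forall x, Y x = Y' x} -> is_cond_exp mu G Y' Z.
Proof.
move=> [iY iZ gZ eZ] mY' YY'.
have iY' := integrable_ae_eq iY mY' YY'.
split => // A GA; have mA := GM GA; rewrite eZ//.
apply: ae_eq_integral => //.
- by apply: measurable_funTS; exact: measurable_int iY.
- by apply: measurable_funTS; exact: measurable_int iY'.
- by apply: filterS YY' => x /= ->.
Qed.

Lemma is_cond_exp_ge0 Y Z : (forall x, 0 <= Y x)%R -> is_cond_exp mu G Y Z ->
  {ae mu, forall x, 0 <= Z x}%R.
Proof.
move=> Y0 YZ; have h0 : is_cond_exp mu G (cst 0%R) (cst 0%R).
  split => //; first exact: integrable0; first exact: integrable0.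
  by apply/(g_sigma_measurable_fun sG); exact: measurable_cst.
by apply: is_cond_exp_ae_le h0 YZ _; exact: aeW.
Qed.

Lemma is_cond_exp_version Y Z Z' : is_cond_exp mu G Y Z ->
  (forall B, measurable B -> G (Z' @^-1` B)) ->
  {ae mu, forall x, Z x = Z' x} -> is_cond_exp mu G Y Z'.
Proof.
move=> [iY iZ gZ eZ] gZ' ZZ'.
have iZ' := integrable_ae_eq iZ (sub_measurable_fun GM gZ') ZZ'.
split => // A GA; have mA := GM GA; rewrite -eZ//.
apply: ae_eq_integral => //.
- by apply: measurable_funTS; exact: measurable_int iZ'.
- by apply: measurable_funTS; exact: measurable_int iZ.
- by apply: filterS ZZ' => x /= ->.
Qed.

(** [Z] is nonnegative only almost everywhere; its positive part is a [G]-measurable version that is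
    nonnegative everywhere, so that [ge0_integralM_agree] applies, without integrability of
    [W * Y]. *)
Lemma is_cond_exp_pull Y Z W :
  is_cond_exp mu G Y Z -> (forall x, 0 <= Y x)%R -> {ae mu, forall x, 0 <= Z x}%R ->
  (forall x, 0 <= W x)%R -> (forall B, measurable B -> G (W @^-1` B)) ->
  \int[mu]_x (W x * Y x)%:E = \int[mu]_x (W x * Z x)%:E.
Proof.
move=> YZ Y0 aZ0 W0 gW.
have gZ := let: And4 _ _ gZ _ := YZ in gZ.
pose Z' x : R := Num.max (Z x) 0%R.
have gZ' B : measurable B -> G (Z' @^-1` B).
  move: B; apply/(g_sigma_measurable_fun sG); apply: measurable_maxr => //.
  exact/(g_sigma_measurable_fun sG).
have ZZ' : {ae mu, forall x, Z x = Z' x}.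
  by apply: filterS aZ0 => x Z0; rewrite /Z' max_l.
have [iY iZ' _ eZ'] := is_cond_exp_version YZ gZ' ZZ'.
have mW : measurable_fun setT W by exact: (sub_measurable_fun GM).
transitivity (\int[mu]_x (W x * Z' x)%:E); last first.
  apply: ae_eq_integral => //.
  - apply/measurable_EFinP/measurable_funM => //; exact: (sub_measurable_fun GM).
  - apply/measurable_EFinP/measurable_funM => //; exact: (sub_measurable_fun GM).
  - by apply: filterS ZZ' => x ->.
under eq_integral do rewrite EFinM; under [RHS]eq_integral do rewrite EFinM.
apply: (@ge0_integralM_agree _ _ _ mu G sG GM (EFin \o Y) (EFin \o Z') (EFin \o W)).
- exact: measurable_int iY.
- exact: measurable_int iZ'.
- by move=> x; rewrite lee_fin.
- by move=> x; rewrite lee_fin /Z' le_max lexx orbT.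
- by move=> A GA; rewrite -eZ'.
- by move=> x; rewrite lee_fin.
- apply/(g_sigma_measurable_fun sG); apply/measurable_EFinP.
  exact/(g_sigma_measurable_fun sG).
Qed.

End conditional_expectation.

Lemma is_cond_exp_tower d (T : measurableType d) (R : realType)
    (mu : {measure set T -> \bar R}) (G H : set (set T)) (Y Z Z' : T -> R) :
  G `<=` H -> is_cond_exp mu H Y Z -> is_cond_exp mu G Y Z' ->
  is_cond_exp mu G Z Z'.
Proof.
move=> GH [_ iZ _ eZ] [_ iZ' gZ' eZ']; split => // A GA.
by rewrite eZ'// eZ//; exact: GH.
Qed.

Lemma indic_ge0_le1 T (R : numDomainType) (B : set T) (x : T) :
  0 <= (\1_B x : R) <= 1.
Proof. by rewrite indicE; case: (_ \in _); rewrite /= ?lexx ?ler01. Qed.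

Lemma measurable_gt_norm d (T : measurableType d) (R : realType) (W : T -> R)
    (a : R) : measurable_fun setT W -> measurable [set x | a < `|W x|].
Proof.
move=> mW; have -> : [set x | a < `|W x|] = (Num.norm \o W) @^-1` `]a, +oo[.
  by apply/seteqP; split => x /=; rewrite in_itv/= andbT.
by rewrite -[X in measurable X]setTI; apply: measurableT_comp.
Qed.

Lemma integral_tail_le d (T : measurableType d) (R : realType)
    (mu : {measure set T -> \bar R}) (W : T -> R) (e : R) :
  mu.-integrable setT (EFin \o W) -> 0 < e ->
  exists L : nat, (\int[mu]_(x in [set x | (L%:R < `|W x|)%R]) `|(W x)%:E| <= e%:E)%E.
Proof.
move=> iW e0.
have mW : measurable_fun setT W by apply/measurable_EFinP; exact: measurable_int iW.
have mA (n : nat) : measurable [set x | (n%:R < `|W x|)%R].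
  exact: measurable_gt_norm.
pose f n x := (\1_[set x | (n%:R < `|W x|)%R] x * `|W x|)%:E.
have : ((\int[mu]_x f n x) @[n --> \oo] --> (\int[mu]_x (cst 0 x)))%E.
  apply: (@dominated_cvg _ _ _ mu setT measurableT _ _ (fun x => `|(W x)%:E|%E)) => //.
  - move=> n; apply/measurable_EFinP; apply: measurable_funM => //.
    exact: measurableT_comp.
  - move=> x _; apply: cvg_near_cst.
    near=> n; rewrite /f indicE memNset ?mul0r//=; apply/negP; rewrite -leNgt.
    near: n; exact: nbhs_infty_ger.
  - exact: integrable_abse iW.
  - move=> n x _; rewrite /f /= lee_fin ger0_norm ?mulr_ge0//.
    by rewrite ler_piMl// indicE; case: (_ \in _).
rewrite integral0 => /fine_cvgP[_] /cvgrPdist_le /(_ _ e0)[N _ /(_ N (leqnn N))] /=.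
move=> h; exists N.
have fi : (\int[mu]_x f N x \is a fin_num)%E.
  apply: integrable_fin_num => //; apply: (le_integrable _ _ _ iW) => //.
    apply/measurable_EFinP; apply: measurable_funM => //.
    exact: measurableT_comp.
  move=> x _; rewrite /f /= lee_fin normrM normr_id ler_piMl//.
  by rewrite indicE; case: (_ \in _); rewrite ?normr1 ?normr0.
rewrite integral_mkcond.
rewrite (_ : (\int[mu]_x _)%E = \int[mu]_x f N x)%E; last first.
  apply: eq_integral => x _; rewrite patchE /f indicE.
  by case: ifPn => _; rewrite ?mul1r ?mul0r.
rewrite -(fineK fi) lee_fin.
by move: h; rewrite sub0r normrN; apply: le_trans; exact: ler_norm.
Unshelve. all: by end_near. Qed.

Lemma integral_uniformly_small d (T : measurableType d) (R : realType)
    (mu : {measure set T -> \bar R}) (W : T -> R) (e : R) :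
  mu.-integrable setT (EFin \o W) -> 0 < e ->
  exists2 r : R, 0 < r & forall A, measurable A -> (mu A <= r%:E)%E ->
    (\int[mu]_(x in A) `|(W x)%:E| <= e%:E)%E.
Proof.
move=> iW e0; have e20 : 0 < e / 2 by rewrite divr_gt0.
have [L hL] := integral_tail_le iW e20.
have mW : measurable_fun setT W by apply/measurable_EFinP; exact: measurable_int iW.
(* Half of [e] pays for the tail of [W] above [L]; off the tail the integrand is at most [L], which
   costs at most [L * r <= e / 2]. The successor avoids a division by [0]. *)
exists (e / 2 / L.+1%:R); first by rewrite divr_gt0.
move=> A mA muA.
have mB : measurable [set x | (L%:R < `|W x|)%R] by exact: measurable_gt_norm.
have mnW : measurable_fun setT (fun x => `|W x|) by exact: measurableT_comp.
rewrite integral_mkcond.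
apply: (@le_trans _ _ (\int[mu]_x ((\1_[set x | (L%:R < `|W x|)%R] x * `|W x|)%:E + (L%:R * \1_A x)%:E))%E).
  apply: ge0_le_integral => //.
  - by move=> x _; rewrite erestrict_ge0.
  - apply/(measurable_restrictT _ mA); apply: measurable_funTS.
    by apply: measurableT_comp => //; exact/measurable_EFinP.
  - by apply: emeasurable_funD; apply/measurable_EFinP/measurable_funM => //; exact: measurable_indic.
  - move=> x _; rewrite -EFinD epatch_indic lee_fin.
    have /andP[A0 A1'] := indic_ge0_le1 R A x.
    have [h|h] := ltP L%:R `|W x|.
      rewrite [X in _ <= X * _ + _]indicE mem_set//= mul1r ler_wpDr ?mulr_ge0//.
      by rewrite ler_piMr.
    apply: ler_wpDl; last by rewrite ler_wpM2r.
    by rewrite mulr_ge0//; have /andP[] := indic_ge0_le1 R [set x | L%:R < `|W x|] x.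
rewrite ge0_integralD//=;
  try (by move=> x _; rewrite lee_fin mulr_ge0);
  try (by apply/measurable_EFinP/measurable_funM => //; exact: measurable_indic).
rewrite [e in leRHS](splitr e) EFinD; apply: leeD.
  apply: le_trans hL; rewrite [leRHS]integral_mkcond le_eqVlt; apply/orP; left; apply/eqP.
  by apply: eq_integral => x _; rewrite epatch_indic muleC -EFinM.
under eq_integral do rewrite EFinM.
rewrite ge0_integralZl//=; last by apply/measurable_EFinP; exact: measurable_indic.
rewrite integral_indic// setIT.
apply: (@le_trans _ _ (L%:R%:E * (e / 2 / L.+1%:R)%:E)%E); first by rewrite lee_wpmul2l.
rewrite -EFinM lee_fin mulrCA ler_piMr// ?(ltW e20)//.
by rewrite ler_pdivrMr// mul1r ler_nat.
Qed.

(** The sets where [Z i > K] and where [Z i < - K] belong to [G i], so on them [Z i] may be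
    exchanged for [Y i] and bounded by [W]. By Markov's inequality their measure is uniformly small,
    and absolute continuity of the integral of [W] concludes. *)
Lemma cond_exp_uniformly_integrable d (T : measurableType d) (R : realType)
    (P : probability T R) (J : Type) (I : set J) (G : J -> set (set T))
    (Y Z : J -> T -> R) (W : T -> R) :
  (forall i, I i -> sigma_algebra setT (G i)) ->
  (forall i, I i -> G i `<=` measurable) ->
  (forall i, I i -> is_cond_exp P (G i) (Y i) (Z i)) ->
  P.-integrable setT (EFin \o W) ->
  (forall i x, I i -> `|Y i x| <= W x) ->
  uniformly_integrable P I (fun i x => (Z i x)%:E).
Proof.
move=> sG GM YZ iW YW; split=> [i Ii|e e0].
  by have [_ /measurable_int] := YZ _ Ii.
have [r r0 hr] := integral_uniformly_small iW e0.
have mW : measurable_fun setT W by apply/measurable_EFinP; exact: measurable_int iW.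
pose EW := (\int[P]_x `|(W x)%:E|)%E.
have EWfin : EW \is a fin_num by exact/integrable_fin_num/integrable_abse.
have EW0 : (0 <= EW)%E by exact: integral_ge0.
(* [EW / r] yields [P A <= EW / K <= r]; the maximum with [1] keeps [K] positive. *)
pose K := Num.max 1 (fine EW / r).
have K0 : 0 < K by rewrite lt_max ltr01.
exists K => i Ii.
have [iY iZ gZ eZ] := YZ _ Ii.
have sGi := sG _ Ii; have GMi := GM _ Ii.
have mZ : measurable_fun setT (Z i) by apply/measurable_EFinP; exact: measurable_int iZ.
have mY : measurable_fun setT (Y i) by apply/measurable_EFinP; exact: measurable_int iY.
pose A1 := [set x | K < Z i x]; pose A2 := [set x | Z i x < - K].
have GA1 : G i A1.
  have -> : A1 = Z i @^-1` `]K, +oo[.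
    by apply/seteqP; split => x /=; rewrite in_itv/= andbT.
  exact: gZ.
have GA2 : G i A2.
  have -> : A2 = Z i @^-1` `]-oo, - K[.
    by apply/seteqP; split => x /=; rewrite in_itv/=.
  exact: gZ.
have mA1 := GMi _ GA1; have mA2 := GMi _ GA2.
have A12 : [disjoint A1 & A2].
  apply/eqP/seteqP; split => x //= -[] /=; rewrite /A1 /A2 /= => a b.
  by have := lt_trans a b; rewrite ltNge ltW// (lt_trans _ K0)// oppr_lt0.
have AE : [set x | K%:E < `|(Z i x)%:E|]%E = A1 `|` A2.
  apply/seteqP; split => x /=; rewrite lte_fin /A1 /A2/=.
    by rewrite ltr_normr => /orP[]; [left|right]; rewrite // ltrNr.
  case=> h; first by rewrite (lt_le_trans h)// ler_norm.
  by rewrite -normrN; rewrite (lt_le_trans _ (ler_norm _))// ltrNr.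
rewrite AE.
set A := A1 `|` A2; have mA : measurable A by exact: measurableU.
have ZW : (\int[P]_(x in A) `|(Z i x)%:E| <= \int[P]_(x in A) (W x)%:E)%E.
  have iA f D : measurable D -> P.-integrable setT f -> P.-integrable D f.
    by move=> mD; exact: (integrableS measurableT).
  have mnZ D : measurable_fun D (fun x => `|(Z i x)%:E|%E).
    by apply: measurable_funTS; apply: measurableT_comp => //; exact/measurable_EFinP.
  have mWE D : measurable_fun D (fun x => (W x)%:E).
    by apply: measurable_funTS; exact/measurable_EFinP.
  rewrite ge0_integral_setU//.
  rewrite integral_setU//.
  apply: leeD.
    rewrite (_ : (\int[P]_(x in A1) `|(Z i x)%:E|)%E = \int[P]_(x in A1) (Z i x)%:E)%E; last first.
      apply: eq_integral => x /[!inE] h; rewrite gee0_abs// lee_fin ltW//.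
      exact: lt_trans K0 h.
    rewrite eZ//; apply: le_integral; [by []|exact: iA|exact: iA|].
    move=> x _; rewrite lee_fin (le_trans _ (YW i x Ii))//; exact: ler_norm.
  rewrite (_ : (\int[P]_(x in A2) `|(Z i x)%:E|)%E = \int[P]_(x in A2) - (Z i x)%:E)%E; last first.
    apply: eq_integral => x /[!inE] h; rewrite lee0_abs// lee_fin ltW//.
    by apply: (lt_trans h); rewrite oppr_lt0.
  rewrite (@integralN _ _ _ _ _ (EFin \o Z i)); last exact/integrable_add_def/iA.
  rewrite /= eZ// -(@integralN _ _ _ _ _ (EFin \o Y i)); last exact/integrable_add_def/iA.
  apply: le_integral; [by []|apply/integrableN|exact: iA|]; first exact: iA.
  move=> x _; rewrite lee_fin (le_trans _ (YW i x Ii))// -normrN; exact: ler_norm.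
have W0 x : 0 <= W x by exact: le_trans (YW i x Ii).
apply: (le_trans ZW).
have KP : (K%:E * P A <= EW)%E.
  rewrite (@le_trans _ _ (\int[P]_(x in A) (W x)%:E)%E)//.
    apply: le_trans ZW; rewrite -integral_cst//; apply: ge0_le_integral => //.
    - by move=> x _; rewrite lee_fin ltW.
    - apply: measurable_funTS; apply: measurableT_comp => //; exact/measurable_EFinP.
    - move=> x; rewrite /A -AE /= => h; exact: ltW.
  rewrite /EW; under [leRHS]eq_integral do rewrite gee0_abs ?lee_fin//.
  apply: ge0_subset_integral => //; first exact/measurable_EFinP.
  by move=> x _; rewrite lee_fin.
have := hr A mA; under eq_integral do rewrite gee0_abs ?lee_fin//; apply.
have PAfin : P A \is a fin_num by exact: fin_num_measure.
move: KP; rewrite -(fineK PAfin) -(fineK EWfin) -EFinM !lee_fin => KP.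
rewrite -[X in (X <= _)%E](fineK PAfin) lee_fin -(ler_pM2l K0) (le_trans KP)// -ler_pdivrMr//.
by rewrite /K le_max lexx orbT.
Qed.

(** * Measurability on path space *)

Section path_measurability.
Variables (R : realType) (X : completePseudoMetricType R).
Implicit Types (s t a b : R) (w : cadlag R X).

(** The path space with the sigma-algebra [sigma_between a b]: measurability of a functional of
    [X_[a, b]] becomes ordinary measurability on this type. *)
Definition between_type a b :=
  g_sigma_algebraType (\bigcup_(r in `[a, b]) @sigma_at R X r).

Lemma sigma_algebra_between a b : sigma_algebra setT (@sigma_between R X a b).
Proof. exact: smallest_sigma_algebra. Qed.

Lemma sigma_algebra_at t : sigma_algebra setT (@sigma_at R X t).
Proof. exact/sigma_algebra_preimage/sigma_algebra_measurable. Qed.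

Lemma sigma_between_mono a b a' b' : a' <= a -> b <= b' ->
  @sigma_between R X a b `<=` sigma_between a' b'.
Proof.
move=> aa bb; apply: sub_sigma_algebra2 => A [r].
rewrite /= in_itv/= => /andP[ar rb] rA; exists r => //=.
by rewrite in_itv/= (le_trans aa)//= (le_trans rb).
Qed.

Lemma sigma_between_measurable a b : 0 <= a -> b <= 1 ->
  @sigma_between R X a b `<=` measurable.
Proof. by move=> a0 b1; exact: sigma_between_mono. Qed.

Lemma sigma_at_between a b t : a <= t <= b ->
  @sigma_at R X t `<=` sigma_between a b.
Proof. by move=> atb A tA; apply: sub_sigma_algebra; exists t. Qed.

Lemma sigma_at_measurable t : 0 <= t <= 1 -> @sigma_at R X t `<=` measurable.
Proof. exact: sigma_at_between. Qed.

Lemma measurable_path_at t : 0 <= t <= 1 -> measurable_fun setT (@path_at R X t).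
Proof. by move=> t01 _ B mB; apply: (sigma_at_measurable t01); exists B. Qed.

Lemma measurable_path_between a b t : a <= t <= b ->
  measurable_fun setT (@path_at R X t : between_type a b -> _).
Proof. by move=> atb _ B mB; apply: (sigma_at_between atb); exists B. Qed.

(** The next point to the right of [s] on the grid of step [1 / (n + 1)], clamped to [[a, b]]. By
    right continuity the values there tend to [w s]; the clamping keeps the times in the observed
    window and gives [b] itself for [s = b]. *)
Let q a b n s : R := Num.max a (Num.min b ((Num.truncn (s * n.+1%:R)).+1%:R / n.+1%:R)).

Lemma cvg_path_right_grid a b s w (U : set X) : 0 <= a -> a <= s <= b ->
  nbhs (w s) U -> exists N, forall n, (N <= n)%N -> U (w (q a b n s)).
Proof.
move=> a0 /andP[as_ sb] wU.
have := sb; rewrite le_eqVlt => /predU1P[sb_eq|s_lt_b].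
  exists 0%N => n _; rewrite /q -sb_eq min_l; last first.
    rewrite ler_pdivlMr// ltW//; apply: (lt_le_trans (truncnS_gt _)) => //.
  by rewrite max_r//; exact: nbhs_singleton.
have /(_ _ wU) := @cadlag_right _ _ w s.
rewrite /= => -[/= e e0 he].
have se : s < s + e by rewrite ltrDl.
have [N hN] := ltr_add_invr se.
exists N => n Nn; apply: he => /=.
  pose c : R := (Num.truncn (s * n.+1%:R)).+1%:R / n.+1%:R.
  have s0 : 0 <= s by exact: le_trans as_.
  have cs : s < c by rewrite ltr_pdivlMr// truncnS_gt.
  have ce : c <= s + n.+1%:R^-1.
    rewrite ler_pdivrMr// mulrDl mulVf// -natr1 lerD2r.
    by have /andP[] := truncn_itv (mulr_ge0 s0 (ler0n R n.+1)).
  have [bc|cb] := leP b c.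
    rewrite /q -/c min_l// max_r ?(le_trans as_ sb)//.
    rewrite distrC ger0_norm ?subr_ge0// ltrBlDl (le_lt_trans bc)// (le_lt_trans ce)//.
    by rewrite (le_lt_trans _ hN)// lerD2l lef_pV2 ?posrE// ler_nat.
  rewrite /q -/c min_r ?(ltW cb)// max_r ?(le_trans as_ (ltW cs))//.
  rewrite distrC ger0_norm ?subr_ge0 ?(ltW cs)// ltrBlDl (le_lt_trans ce)//.
  by rewrite (le_lt_trans _ hN)// lerD2l lef_pV2 ?posrE// ler_nat.
rewrite /q lt_max lt_min s_lt_b/= ltr_pdivlMr// truncnS_gt orbT//.
Qed.

Lemma measurable_path_joint a b : 0 <= a ->
  measurable_fun (`[a, b] `*` [set: between_type a b] : set (measurableTypeR R * _))
    (fun z => z.2 z.1 : borelType X).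
Proof.
move=> a0.
have [ab|ba] := leP a b; last first.
  rewrite set_itv_ge -?leNgt ?bnd_simp -?ltNge//.
  by rewrite (_ : set0 `*` _ = set0) ?set0X//; exact: measurable_fun_set0.
apply: (@measurability _ _ _ (borelType X) _ _ (@open X)) => //.
move=> _ [U oU <-].
set D := _ `*` _.
have mD : measurable D by apply: measurableX.
(* [C k] retreats from the complement of [U] by [1 / (k + 1)]: [w s] is in [U] if and only if, for
   some [k], the path at the approximating times is eventually in [C k]. Interiors are taken because
   balls need not be open. *)
pose C k := ~` \bigcup_(y in ~` U) (ball y (k.+1%:R^-1 : R))°.
have mC k : measurable (C k : set (borelType X)).
  apply: measurableC; apply: sub_sigma_algebra.
  by apply: bigcup_open => y _; exact: open_interior.
pose E k n : set (measurableTypeR R * between_type a b) :=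
  [set z | C k ((z.2 : cadlag R X) (q a b n z.1))].
(* The time [q a b n] takes a single value, [c i], on the cell of index [i]; the set is thus a
   countable union of rectangles. *)
have mq n k : measurable (D `&` E k n).
  pose c i : R := Num.max a (Num.min b (i.+1%:R / n.+1%:R)).
  have -> : D `&` E k n =
     \bigcup_i ((`[a, b] `&` `[i%:R / n.+1%:R, i.+1%:R / n.+1%:R[)%classic
         `*` (@path_at R X (c i) @^-1` C k)).
    apply/seteqP; split => [[s w] [[/= sab _] Cs]|[s w] [i _ [[/= sab si] Ci]]].
      have s0 : 0 <= s by move: sab; rewrite in_itv/= => /andP[/(le_trans a0)].
      exists (Num.truncn (s * n.+1%:R)) => //; split => //=; split => //.
      rewrite in_itv/= ler_pdivrMr// ltr_pdivlMr//.
      by apply: truncn_itv; rewrite mulr_ge0.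
    split => //; rewrite /E /= /q.
    have -> // : Num.truncn (s * n.+1%:R) = i.
    by move: si; rewrite in_itv/= ler_pdivrMr// ltr_pdivlMr// => /truncn_def.
  apply: bigcup_measurable => i _; apply: measurableX; first exact: measurableI.
  rewrite -[X in measurable X]setTI; apply: measurable_path_between => //.
  by rewrite /c le_max lexx ge_max ab ge_min lexx.
rewrite (_ : _ `&` _ = \bigcup_k \bigcup_N \bigcap_(n in [set n | (N <= n)%N])
     (D `&` E k n)).
  apply: bigcup_measurable => k _; apply: bigcup_measurable => N _.
  by apply: bigcap_measurableType => n _; exact: mq.
apply/seteqP; split => [[s w] [Ds /= wU]|[s w] [k _ [N _ h]]].
  have sab : a <= s <= b by case: Ds => /=; rewrite in_itv.
  have : nbhs (w s) U by exact: open_nbhs_nbhs.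
  rewrite -nbhs_ballE => -[e /= e0 he].
  have e20 : 0 < e / 2 by rewrite divr_gt0.
  have [k] := ltr_add_invr e20; rewrite add0r => hk.
  have [N hN] := @cvg_path_right_grid a b s w _ a0 sab (nbhsx_ballx (w s) _ e20).
  exists k => //; exists N => // n /= Nn; split => //=.
  move=> [y /= Uy /interior_subset yw]; apply: Uy; apply: he.
  rewrite [e]splitr; apply: ball_triangle (hN _ Nn) _; apply: ball_sym.
  by apply: le_ball yw; exact: ltW.
have [Ds _] := h N (leqnn N); split => //=.
apply: contrapT => Us.
have sab : a <= s <= b by case: Ds => /=; rewrite in_itv.
have /(cvg_path_right_grid a0 sab) [N' hN'] : nbhs (w s) (ball (w s) (k.+1%:R^-1 : R))°.
  by apply: nbhs_interior; exact: nbhsx_ballx.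
have [_ /=] := h (maxn N N') (leq_maxl _ _); apply.
by exists (w s) => //; apply: hN'; exact: leq_maxr.
Qed.

End path_measurability.

Lemma measurable_integral_in d1 d2 (T1 : measurableType d1) (T2 : measurableType d2)
    (R : realType) (m2 : {sigma_finite_measure set T2 -> \bar R}) (D : set T2)
    (f : T1 * T2 -> \bar R) :
  measurable D -> measurable_fun setT f -> (forall z, 0 <= f z)%E ->
  measurable_fun setT (fun x => \int[m2]_(y in D) f (x, y))%E.
Proof.
move=> mD mf f0.
have mTD : measurable ([set: T1] `*` D) by exact: measurableX.
pose F := f \_ (setT `*` D).
have mF : measurable_fun setT F.
  by apply/(measurable_restrictT _ mTD); exact: measurable_funTS.
have F0 z : (0 <= F z)%E by rewrite /F patchE; case: ifP.
have := @measurable_fun_fubini_tonelli_F _ _ _ _ _ m2 F mF F0.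
congr measurable_fun; apply/funext => x; rewrite /fubini_F [RHS]integral_mkcond.
apply: eq_integral => y _; rewrite /F !patchE; congr (if _ then _ else _).
by apply/idP/idP; rewrite !inE; [case|].
Qed.

(** * Time integrals along paths *)

Section path_integrals.
Variables (R : realType) (X : completePseudoMetricType R).
Implicit Types (s t a b : R) (w : cadlag R X).
Local Notation lambda := (@lebesgue_measure R).

(** Lets every real time be used: [X_t] is measurable, and under stationarity has law [m], for all
    real [t], so windows may leave [[0, 1]]. *)
Lemma cadlag_clamp w t : w t = w (Num.max 0 (Num.min 1 t)).
Proof.
have [t1|t1] := leP 1 t.
  by rewrite max_r ?ler01//; exact: cadlag_ge1.
by have [t0|t0] := leP t 0; rewrite // cadlag_le0.
Qed.

Lemma measurable_path_clamp a b : 0 <= a -> a <= b ->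
  measurable_fun [set: measurableTypeR R * between_type X a b]
    (fun z => (z.2 : cadlag R X) (Num.max a (Num.min b z.1)) : borelType X).
Proof.
move=> a0 ab.
pose c (z : measurableTypeR R * between_type X a b) :
    measurableTypeR R * between_type X a b := (Num.max a (Num.min b z.1) : R, z.2).
have mc : measurable_fun setT c.
  apply: measurable_fun_pair => //=.
  by apply: measurable_maxr => //; exact: measurable_minr.
have := @measurable_path_joint R X a b a0 => mj.
pose ev (z : measurableTypeR R * between_type X a b) : borelType X :=
  (z.2 : cadlag R X) z.1.
apply: (measurable_comp _ _ (mj : measurable_fun _ ev) mc).
  by apply: measurableX.
by move=> _ [z _ <-]; split => //=; rewrite in_itv/= le_max lexx ge_max ab ge_min lexx.
Qed.

Lemma measurable_path_eval :
  measurable_fun [set: measurableTypeR R * cadlag R X]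
    (fun z => z.2 z.1 : borelType X).
Proof.
have := measurable_path_clamp (lexx 0) ler01.
by congr measurable_fun; apply/funext => -[s w]; rewrite /= -cadlag_clamp.
Qed.

Lemma measurable_path_at_all t : measurable_fun setT (@path_at R X t).
Proof.
rewrite (_ : @path_at R X t = path_at (Num.max 0 (Num.min 1 t))); last first.
  by apply/funext => w; exact: cadlag_clamp.
by apply: measurable_path_at; rewrite le_max lexx ge_max ler01 ge_min lexx.
Qed.

Lemma sigma_at_sub_measurable t : @sigma_at R X t `<=` measurable.
Proof. by move=> _ [B mB <-]; exact: measurable_path_at_all. Qed.

Lemma measurable_path_comp d (U : measurableType d)
    (f : measurableTypeR R * borelType X -> U) :
  measurable_fun setT f -> measurable_fun setT
    (fun z : measurableTypeR R * cadlag R X => f (z.1, z.2 z.1)).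
Proof.
move=> mf; apply: (measurableT_comp mf); apply: measurable_fun_pair => //.
exact: measurable_path_eval.
Qed.

Lemma measurable_path_integral a b (f : measurableTypeR R * borelType X -> \bar R) :
  0 <= a -> measurable_fun setT f -> (forall z, 0 <= f z)%E ->
  measurable_fun [set: between_type X a b]
    (fun w => \int[lambda]_(s in `[a, b]) f (s, (w : cadlag R X) s))%E.
Proof.
move=> a0 mf f0.
have [ab|ba] := leP a b; last first.
  rewrite set_itv_ge -?leNgt ?bnd_simp -?ltNge//.
  rewrite (_ : (fun _ => _) = cst 0%E); first exact: measurable_cst.
  by apply/funext => w; rewrite integral_set0.
pose F (z : between_type X a b * measurableTypeR R) : \bar R :=
  ((fun z => f (z.2, (z.1 : cadlag R X) (Num.max a (Num.min b z.2))))
     \_ ([set: between_type X a b] `*` `[a, b])) z.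
have mD : measurable ([set: between_type X a b] `*` (`[a, b] : set (measurableTypeR R))).
  exact: measurableX.
have mF : measurable_fun setT F.
  apply/(measurable_restrictT _ mD); apply: measurable_funTS.
  pose g (z : between_type X a b * measurableTypeR R) : measurableTypeR R * borelType X :=
    (z.2, (z.1 : cadlag R X) (Num.max a (Num.min b z.2))).
  suff mg : measurable_fun setT g by exact: (measurableT_comp mf mg).
  apply: measurable_fun_pair; first exact: measurable_snd.
  exact: (measurableT_comp (measurable_path_clamp a0 ab) (@measurable_swap _ _ (between_type X a b) (measurableTypeR R))).
have F0 z : (0 <= F z)%E by rewrite /F patchE; case: ifP.
have := @measurable_fun_fubini_tonelli_F _ _ _ _ _ lambda F mF F0.
congr measurable_fun; apply/funext => w.
rewrite /fubini_F [RHS]integral_mkcond; apply: eq_integral => s _.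
rewrite /F !patchE; case: ifPn => [/set_mem[_ /=]|sab].
  move=> sab; rewrite mem_set//; move: sab; rewrite in_itv/= => /andP[as_ sb].
  by rewrite min_r// max_r.
by rewrite memNset// => sab'; move: sab; rewrite mem_set.
Qed.

Lemma measurable_path_integral_joint d (T : measurableType d) (al be : T -> R)
    (f : measurableTypeR R * borelType X -> \bar R) :
  measurable_fun setT al -> measurable_fun setT be ->
  measurable_fun setT f -> (forall z, 0 <= f z)%E ->
  measurable_fun [set: T * cadlag R X]
    (fun z => \int[lambda]_(s in `[al z.1, be z.1]) f (s, z.2 s))%E.
Proof.
move=> mal mbe mf f0.
pose D : set (T * cadlag R X * measurableTypeR R) :=
  [set z | al z.1.1 <= z.2] `&` [set z | z.2 <= be z.1.1].
have m11 : measurable_fun setT (fun z : T * cadlag R X * measurableTypeR R => z.1.1).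
  exact: (measurableT_comp measurable_fst measurable_fst).
have mD : measurable D.
  apply: measurableI.
    rewrite -[X in measurable X]setTI; apply: measurable_fun_le => //.
    exact: (measurableT_comp mal m11).
  rewrite -[X in measurable X]setTI; apply: measurable_fun_le => //.
  exact: (measurableT_comp mbe m11).
pose F := ((fun z : T * cadlag R X * measurableTypeR R => f (z.2, z.1.2 z.2)) \_ D).
have mF : measurable_fun setT F.
  apply/(measurable_restrictT _ mD); apply: measurable_funTS.
  have mswap : measurable_fun setT (fun z : T * cadlag R X * measurableTypeR R => (z.2, z.1.2)).
    apply: measurable_fun_pair; first exact: measurable_snd.
    exact: (measurableT_comp measurable_snd measurable_fst).
  exact: (measurableT_comp (measurable_path_comp mf) mswap).
have F0 z : (0 <= F z)%E by rewrite /F patchE; case: ifP.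
have := @measurable_fun_fubini_tonelli_F _ _ _ _ _ lambda F mF F0.
congr measurable_fun; apply/funext => -[t w].
rewrite /fubini_F [RHS]integral_mkcond; apply: eq_integral => s _.
rewrite /F !patchE; congr (if _ then _ else _).
by apply/idP/idP; rewrite !inE /D /= in_itv/= => /andP.
Qed.

End path_integrals.

Lemma tonelli_in d1 d2 (T1 : measurableType d1) (T2 : measurableType d2)
    (R : realType) (m1 : {sigma_finite_measure set T1 -> \bar R})
    (m2 : {sigma_finite_measure set T2 -> \bar R}) (D1 : set T1) (D2 : set T2)
    (f : T1 * T2 -> \bar R) :
  measurable D1 -> measurable D2 -> measurable_fun setT f -> (forall z, 0 <= f z)%E ->
  (\int[m1]_(x in D1) \int[m2]_(y in D2) f (x, y) =
   \int[m2]_(y in D2) \int[m1]_(x in D1) f (x, y))%E.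
Proof.
move=> mD1 mD2 mf f0.
have mD : measurable (D1 `*` D2) by exact: measurableX.
have mF : measurable_fun setT (f \_ (D1 `*` D2)).
  by apply/(measurable_restrictT _ mD); exact: measurable_funTS.
have F0 z : (0 <= (f \_ (D1 `*` D2)) z)%E by rewrite patchE; case: ifP.
have := @fubini_tonelli _ _ _ _ _ m1 m2 _ mF F0.
have pE x y : (f \_ (D1 `*` D2)) (x, y) =
    if x \in D1 then if y \in D2 then f (x, y) else 0%E else 0%E.
  rewrite patchE; have [xD|xD] := boolP (x \in D1); have [yD|yD] := boolP (y \in D2).
  - by rewrite mem_set//; split; exact: set_mem.
  - by rewrite memNset// => -[_ /= h]; move: yD; rewrite mem_set.
  - by rewrite memNset// => -[/= h _]; move: xD; rewrite mem_set.
  - by rewrite memNset// => -[/= h _]; move: xD; rewrite mem_set.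
have e1 : (\int[m1]_x \int[m2]_y (f \_ (D1 `*` D2)) (x, y) =
    \int[m1]_(x in D1) \int[m2]_(y in D2) f (x, y))%E.
  rewrite [RHS]integral_mkcond; apply: eq_integral => x _; rewrite patchE.
  under eq_integral do rewrite pE.
  case: ifPn => _; last by rewrite integral0.
  by rewrite [RHS]integral_mkcond; apply: eq_integral => y _; rewrite patchE.
have e2 : (\int[m2]_y \int[m1]_x (f \_ (D1 `*` D2)) (x, y) =
    \int[m2]_(y in D2) \int[m1]_(x in D1) f (x, y))%E.
  rewrite [RHS]integral_mkcond; apply: eq_integral => y _; rewrite patchE.
  under eq_integral do rewrite pE.
  case: ifPn => yD.
    by rewrite [RHS]integral_mkcond; apply: eq_integral => x _; rewrite patchE.
  by rewrite integral0_eq// => x _; case: ifP.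
by rewrite e1 e2.
Qed.

(** * Jointly measurable versions of conditional expectations *)

Section countably_generated.
Variables (R : realType) (X : completePseudoMetricType R).

(** The base consists of the interiors of the balls of radius [1 / (n + 1)] around the points of a
    countable dense set. *)
Lemma polish_countable_base : polish X ->
  exists B : set (set X), [/\ countable B, (forall b, B b -> open b) &
    forall U, open U -> U = \bigcup_(b in B `&` [set b | b `<=` U]) b].
Proof.
move=> [_ [D cD dD]].
pose F (p : X * nat) := (ball p.1 (p.2.+1%:R^-1 : R))°.
exists (F @` (D `*` [set: nat])); split.
- by apply: (sub_countable (card_image_le _ _)); exact: countableX.
- by move=> _ [p _ <-]; exact: open_interior.
- move=> U oU; apply/seteqP; split => [y Uy|y [b [_ bU] yb]]; last exact: bU.
  have : nbhs y U by exact: open_nbhs_nbhs.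
  rewrite -nbhs_ballE => -[e /= e0 he].
  have e20 : 0 < e / 2 by rewrite divr_gt0.
  have [n] := ltr_add_invr e20; rewrite add0r => hn.
  set r : R := n.+1%:R^-1 in hn.
  have r20 : 0 < r / 2 by rewrite divr_gt0// invr_gt0.
  have [x [/interior_subset yx Dx]] : (ball y (r / 2))° `&` D !=set0.
    apply: dD; last exact: open_interior.
    by exists y; apply: nbhsx_ballx.
  have yFx : F (x, n) y.
    rewrite /F /= /interior -nbhs_ballE; exists (r / 2) => //= z yz.
    by rewrite -/r [r]splitr; apply: ball_triangle yz; exact: ball_sym.
  exists (F (x, n)) => //; split; first by exists (x, n).
  move=> z /interior_subset /= xz; apply: he; rewrite [e]splitr.
  apply: (@ball_triangle _ _ x).
    apply: le_ball yx; rewrite (le_trans _ (ltW hn))// ler_pdivrMr// ler_peMr//.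
      by rewrite invr_ge0.
    by rewrite ler1n.
  by apply: le_ball xz; exact: ltW.
Qed.

(** Stage [n] in the construction of the Boolean algebra generated by [B]. Stages increase, and each
    is countable when [B] is, so their union is a countable algebra. *)
Fixpoint bool_gen (T : Type) (B : set (set T)) (n : nat) : set (set T) :=
  if n isn't n'.+1 then B else
  bool_gen B n' `|` (@setC T @` bool_gen B n') `|`
    ((fun p => p.1 `|` p.2) @` (bool_gen B n' `*` bool_gen B n')).

Lemma polish_countable_algebra : polish X ->
  exists A : nat -> set (borelType X),
    [/\ forall k, measurable (A k),
        forall k, exists l, A l = ~` A k,
        forall k l, exists n, A n = A k `|` A l &
        @measurable _ (borelType X) `<=` <<s range A >>].
Proof.
move=> /polish_countable_base[B [cB oB hB]].
pose G := \bigcup_n bool_gen B n.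
have cU2 (S1 S2 : set (set X)) : countable S1 -> countable S2 -> countable (S1 `|` S2).
  move=> c1 c2; rewrite -bigcup2inE; apply: bigcup_countable => // -[|[|n]] //.
have cG : countable G.
  apply: bigcup_countable => // n _; elim: n => //= n IHn.
  apply: (cU2); first apply: (cU2) => //.
    exact: (sub_countable (card_image_le _ _)).
  by apply: (sub_countable (card_image_le _ _)); exact: countableX.
have mono n m : (n <= m)%N -> bool_gen B n `<=` bool_gen B m.
  move=> /subnK <-; elim: (m - n)%N => // k IHk A /IHk h; rewrite addSn /=.
  by left; left.
have GC A : G A -> G (~` A).
  by move=> [n _ nA]; exists n.+1 => //=; left; right; exists A.
have GU A A' : G A -> G A' -> G (A `|` A').
  move=> [n _ nA] [m _ mA]; exists (maxn n m).+1 => //=; right.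
  exists (A, A') => //; split.
    exact: (mono _ _ (leq_maxl n m) _ nA).
  exact: (mono _ _ (leq_maxr n m) _ mA).
have mG A : G A -> measurable (A : set (borelType X)).
  move=> [n _]; elim: n A => [A /oB oA|n IHn A /= [[/IHn//|[A' /IHn mA' <-]]|[[A1 A2] [/= /IHn m1 /IHn m2] <-]]].
  - exact: sub_sigma_algebra.
  - exact: measurableC.
  - exact: measurableU.
(* An enumeration by [nat] needs a nonempty family; the base is nonempty because it covers the
   inhabited space [X]. *)
have [b Bb] : exists b, B b.
  apply: contrapT => nB.
  have := hB setT openT; rewrite (_ : B `&` _ = set0) ?bigcup_set0.
    by move=> /seteqP[/(_ point Logic.I)].
  by apply/seteqP; split => // b [Bb _]; apply: nB; exists b.
move: cG => /pfcard_geP[G0|[f]].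
  by have : G b; [exists 0%N|rewrite G0].
have fG k : G (f k) by exact: funS.
have Gf A : G A -> exists k, f k = A.
  by have := @surj _ _ _ _ f => /[apply] -[k _ <-]; exists k.
exists (fun k => f k); split.
- by move=> k; exact: mG.
- by move=> k; apply: Gf; exact: GC.
- by move=> k l; apply: Gf; exact: GU.
- apply: smallest_sub; first exact: smallest_sigma_algebra.
  move=> U oU; rewrite (hB _ oU).
  have cU : countable (B `&` [set b | b `<=` U]) by apply: sub_countable cB; exact: subset_card_le.
  have sB (b' : set X) : (B `&` [set b | b `<=` U]) b' -> <<s range (fun k => f k) >> b'.
    move=> [Bb' _]; apply: sub_sigma_algebra.
    by have [|k <-] := Gf b'; [exists 0%N|exists k].
  move: cU => /pfcard_geP[->|[h]].
    by rewrite bigcup_set0; have [] := smallest_sigma_algebra setT (range (fun k => f k)).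
  rewrite (@reindex_bigcup _ _ _ h [set: nat] _ (fun b => b)); last 2 first.
  - exact: funS.
  - exact: surj.
  have [_ _ hU] := smallest_sigma_algebra setT (range (fun k => f k)).
  by apply: hU => n; apply: sB; exact: funS.
Qed.

End countably_generated.

Section generating_algebra.
Context d (T : measurableType d) (R : realType) (m : probability T R).
Variable A : nat -> set T.
Hypothesis mA : forall k, measurable (A k).
Hypothesis AC : forall k, exists l, A l = ~` A k.
Hypothesis AU : forall k l, exists n, A n = A k `|` A l.
Hypothesis AG : measurable `<=` <<s range A >>.

Let sd (B C : set T) := (B `\` C) `|` (C `\` B).

Let msd B C : measurable B -> measurable C -> measurable (sd B C).
Proof. by move=> mB mC; apply: measurableU; exact: measurableD. Qed.

(** The approximable sets form a sigma-algebra containing the [A k]. For a countable union, a finite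
    union is already close, by continuity of the measure from above, and for finite unions the
    errors add up. *)
Lemma algebra_approx B (e : R) : measurable B -> 0 < e ->
  exists k, (m ((B `\` A k) `|` (A k `\` B)) <= e%:E)%E.
Proof.
pose L := [set B | measurable B /\ forall e : R, 0 < e -> exists k, (m (sd B (A k)) <= e%:E)%E].
suff : measurable `<=` L by move=> h mB; move: e; have [] := h _ mB.
have LU B1 B2 : L B1 -> L B2 -> L (B1 `|` B2).
  move=> [m1 h1] [m2 h2]; split; first exact: measurableU.
  move=> {}e e0; have e20 : 0 < e / 2 by rewrite divr_gt0.
  have [k1 hk1] := h1 _ e20; have [k2 hk2] := h2 _ e20.
  have [n hn] := AU k1 k2; exists n; rewrite hn.
  apply: (@le_trans _ _ (m (sd B1 (A k1) `|` sd B2 (A k2)))).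
    apply: le_measure; rewrite ?inE; [|by apply: measurableU; exact: msd|].
      by apply: msd; exact: measurableU.
    move=> x [[[] Bx nA]|[[] Ax nB]].
    - by left; left; split => // Ax; apply: nA; left.
    - by right; left; split => // Ax; apply: nA; right.
    - by left; right; split => // Bx; apply: nB; left.
    - by right; right; split => // Bx; apply: nB; right.
  apply: (le_trans (measureU2 _ _ _)); [exact: msd|exact: msd|].
  by rewrite [e]splitr EFinD leeD.
have L0 : L set0.
  split => // {}e e0; have [l hl] := AC 0; have [n hn] := AU 0 l.
  have [k hk] := AC n; exists k.
  have -> : A k = set0 by rewrite hk hn hl setUv setCT.
  by rewrite /sd setD0 setU0 measure0 lee_fin ltW.
move=> {}B /AG; move: B.
apply: smallest_sub; last first.
  move=> _ [k _ <-]; split => // {}e e0; exists k.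
  by rewrite /sd setDv setU0 measure0 lee_fin ltW.
split => //.
  move=> B [mB hB]; rewrite setTD; split; first exact: measurableC.
  move=> {}e e0; have [k hk] := hB _ e0; have [l hl] := AC k; exists l.
  have -> // : sd (~` B) (A l) = sd B (A k).
  by rewrite hl /sd !setDE !setCK setUC (setIC (~` A k)) (setIC (~` B)).
move=> F LF; have mF n : measurable (F n) by have [] := LF n.
have mUF : measurable (\bigcup_n F n) by exact: bigcup_measurable.
split => // {}e e0; have e20 : 0 < e / 2 by rewrite divr_gt0.
pose D n := (\bigcup_k F k) `\` \big[setU/set0]_(i < n) F i.
have mU n : measurable (\big[setU/set0]_(i < n) F i) by exact: bigsetU_measurable.
have mD n : measurable (D n) by exact: measurableD.
have D0 : \bigcap_n D n = set0.
  apply/seteqP; split => // x Dx; have [[k _ Fk] _] := Dx 0 Logic.I.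
  have [_] := Dx k.+1 Logic.I; apply.
  by rewrite -bigcup_mkord; exists k => /=.
have : (m \o D) n @[n --> \oo] --> m (\bigcap_n D n).
  apply: nonincreasing_cvg_mu => //.
  - by rewrite -ge0_fin_numE ?fin_num_measure.
  - by rewrite D0.
  - move=> n1 n2 n12; apply/subsetPset; apply: setDS.
    by apply: subset_bigsetU.
rewrite D0 measure0 => /fine_cvgP[_] /cvgrPdist_le /(_ _ e20)[N _ /(_ N (leqnn N))] /=.
rewrite sub0r normrN => hN.
have LN : L (\big[setU/set0]_(i < N) F i).
  by elim: N {hN} => [|N IHN]; rewrite ?big_ord0// big_ord_recr /=; exact: LU.
have [_ /(_ _ e20)[k hk]] := LN; exists k.
apply: (@le_trans _ _ (m (D N `|` sd (\big[setU/set0]_(i < N) F i) (A k)))).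
  apply: le_measure; rewrite ?inE; [exact: msd|by apply: measurableU => //; exact: msd|].
  move=> x [[Fx nA]|[Ax nF]].
    by have [Nx|Nx] := pselect ((\big[setU/set0]_(i < N) F i) x); [right; left|left].
  right; right; split => // Nx; apply: nF.
  by move: Nx; rewrite -bigcup_mkord => -[i _ Fi]; exists i.
apply: (le_trans (measureU2 _ _ _)); [exact: mD|exact: msd|].
rewrite [e]splitr EFinD leeD// -[leLHS]fineK ?fin_num_measure// lee_fin.
by apply: le_trans hN; exact: ler_norm.
Qed.

(** Replacing [B] by a nearby member of the algebra costs the integral of [|u|] over a symmetric
    difference as small as desired. Countably many inequalities thus control all measurable sets. *)
Lemma integral_algebra_le (u : T -> R) (c : R) B :
  m.-integrable setT (EFin \o u) ->
  (forall k, `|\int[m]_(x in A k) (u x)%:E| <= c%:E)%E ->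
  measurable B -> (`|\int[m]_(x in B) (u x)%:E| <= c%:E)%E.
Proof.
move=> iu uc mB; apply/lee_addgt0Pr => e e0.
have [r r0 hr] := integral_uniformly_small iu e0.
have [k hk] := algebra_approx mB r0.
have mBA : measurable (B `\` A k) by exact: measurableD.
have mAB : measurable (A k `\` B) by exact: measurableD.
have mI : measurable (A k `&` B) by exact: measurableI.
have iS C : measurable C -> m.-integrable C (EFin \o u).
  by move=> mC; exact: (integrableS measurableT).
have fS C : measurable C -> (\int[m]_(x in C) (u x)%:E \is a fin_num)%E.
  by move=> mC; apply: integrable_fin_num => //; exact: iS.
have mu C : measurable_fun C (fun x => (u x)%:E).
  by apply: measurable_funTS; exact: measurable_int iu.
have eB : (\int[m]_(x in B) (u x)%:E = \int[m]_(x in B `\` A k) (u x)%:E +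
    \int[m]_(x in A k `&` B) (u x)%:E)%E.
  rewrite -integral_setU//.
  - by congr integral; rewrite setUC setIC; apply/esym/setUIDK.
  - by apply/eqP/seteqP; split => // x [[_ +] []].
have eA : (\int[m]_(x in A k) (u x)%:E = \int[m]_(x in A k `\` B) (u x)%:E +
    \int[m]_(x in A k `&` B) (u x)%:E)%E.
  rewrite -integral_setU//.
  - by congr integral; rewrite setUC; apply/esym/setUIDK.
  - by apply/eqP/seteqP; split => // x [[_ +] []].
have -> : (\int[m]_(x in B) (u x)%:E = \int[m]_(x in A k) (u x)%:E +
   (\int[m]_(x in B `\` A k) (u x)%:E - \int[m]_(x in A k `\` B) (u x)%:E))%E.
  rewrite eB eA -(fineK (fS _ mBA)) -(fineK (fS _ mAB)) -(fineK (fS _ mI)).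
  by rewrite -!EFinD; congr EFin; rewrite addrCA addrAC addrN add0r.
apply: (le_trans (lee_abs_add _ _)); rewrite leeD//.
apply: (le_trans (lee_abs_sub _ _)).
apply: (@le_trans _ _ (\int[m]_(x in sd B (A k)) `|(u x)%:E|)%E); last first.
  by apply: hr => //; exact: msd.
rewrite ge0_integral_setU//; last 2 first.
- by apply: measurableT_comp.
- by apply/eqP/seteqP; split => // x [[_ +] []].
by rewrite leeD// le_abse_integral.
Qed.

(** A family dense in [L^1(m)], by [rat_step_dense]. Its members are coded by lists of rationals and
    indices, hence by natural numbers, so that the first suitable member can be selected
    measurably. *)
Definition rat_step (s : seq (rat * nat)) (x : T) : R :=
  \sum_(p <- s) ratr p.1 * \1_(A p.2) x.

Lemma measurable_rat_step s : measurable_fun setT (rat_step s).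
Proof.
apply: measurable_sum => p; apply: measurable_funM => //.
Qed.

Lemma integrable_rat_step s : m.-integrable setT (EFin \o rat_step s).
Proof.
rewrite /rat_step; elim: s => [|p s IHs].
  rewrite (_ : _ \o _ = cst 0%E); first exact: integrable0.
  by apply/funext => x /=; rewrite big_nil.
rewrite (_ : _ \o _ = (fun x => (ratr p.1)%:E * (\1_(A p.2) x)%:E)%E \+
    (EFin \o (fun x => \sum_(p <- s) ratr p.1 * \1_(A p.2) x))); last first.
  by apply/funext => x /=; rewrite big_cons EFinD EFinM.
by apply: integrableD => //; apply: integrableZl => //; exact: integrable_indic.
Qed.

Let dist (u v : T -> R) := (\int[m]_x `|(u x - v x)%:E|)%E.

Let dist_triangle u v w : measurable_fun setT u -> measurable_fun setT v ->
  measurable_fun setT w -> (dist u w <= dist u v + dist v w)%E.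
Proof.
move=> mu mv mw; rewrite /dist -ge0_integralD//; last 2 first.
- by apply: measurableT_comp => //; apply/measurable_EFinP; exact: measurable_funB.
- by apply: measurableT_comp => //; apply/measurable_EFinP; exact: measurable_funB.
apply: ge0_le_integral => //.
- by apply: measurableT_comp => //; apply/measurable_EFinP; exact: measurable_funB.
- by apply: emeasurable_funD; apply: measurableT_comp => //; apply/measurable_EFinP; exact: measurable_funB.
- by move=> x _; rewrite -EFinD lee_fin -[X in `|X|](subrKA (v x)) ler_normD.
Qed.

Let approximable (u : T -> R) := measurable_fun setT u /\
  forall e : R, 0 < e -> exists s, (dist (rat_step s) u <= e%:E)%E.

Let approximableD u v : approximable u -> approximable v ->
  approximable (fun x => u x + v x).
Proof.
move=> [mu hu] [mv hv]; split; first exact: measurable_funD.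
move=> e e0; have e20 : 0 < e / 2 by rewrite divr_gt0.
have [s hs] := hu _ e20; have [t ht] := hv _ e20.
exists (s ++ t); rewrite [e]splitr EFinD; apply: le_trans (leeD hs ht).
have ms := measurable_rat_step s; have mt := measurable_rat_step t.
rewrite /dist -ge0_integralD//; last 2 first.
- by apply: measurableT_comp => //; apply/measurable_EFinP; exact: measurable_funB.
- by apply: measurableT_comp => //; apply/measurable_EFinP; exact: measurable_funB.
apply: ge0_le_integral => //.
- apply: measurableT_comp => //; apply/measurable_EFinP; apply: measurable_funB.
    exact: measurable_rat_step.
  exact: measurable_funD.
- by apply: emeasurable_funD; apply: measurableT_comp => //; apply/measurable_EFinP; exact: measurable_funB.
- by move=> x _; rewrite -EFinD lee_fin /rat_step big_cat /= opprD addrACA ler_normD.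
Qed.

Let approximable_indic (y : R) B : measurable B ->
  approximable (fun x => y * \1_B x).
Proof.
move=> mB; split; first by apply: measurable_funM => //; exact: measurable_indic.
move=> e e0; have e20 : 0 < e / 2 by rewrite divr_gt0.
have [q hq] : exists q : rat, `|ratr q - y| <= e / 2.
  have /rat_in_itvoo[q] : y - e / 2 < y + e / 2.
    by rewrite ltrBlDr -addrA ltrDl addr_gt0.
  rewrite in_itv/= => /andP[h1 h2]; exists q.
  by rewrite ler_norml; apply/andP; split; lra.
have y1 : 0 < `|y| + 1 by rewrite ltr_wpDl.
have [k hk] := algebra_approx mB (divr_gt0 e20 y1).
exists [:: (q, k)].
have mS : measurable (sd B (A k)) by exact: msd.
apply: (@le_trans _ _ (\int[m]_x ((e / 2)%:E + (`|y| * \1_(sd B (A k)) x)%:E))%E).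
  apply: ge0_le_integral => //.
  - apply: measurableT_comp => //; apply/measurable_EFinP; apply: measurable_funB.
      exact: measurable_rat_step.
    by apply: measurable_funM => //; exact: measurable_indic.
  - apply: emeasurable_funD => //; apply/measurable_EFinP.
    by apply: measurable_funM => //; exact: measurable_indic.
  - move=> x _; rewrite -EFinD lee_fin /rat_step big_seq1 /=.
    have -> : ratr q * \1_(A k) x - y * \1_B x =
        (ratr q - y) * \1_(A k) x + y * (\1_(A k) x - \1_B x) :> R by ring.
    apply: (le_trans (ler_normD _ _)); apply: lerD; rewrite normrM.
      apply: le_trans hq; rewrite ler_piMr//.
      by have /andP[A0 A1] := indic_ge0_le1 R (A k) x; rewrite ger0_norm.
    rewrite ler_wpM2l// !indicE /sd in_setU !in_setD.
    by case: (x \in A k); case: (x \in B) => //=; rewrite ?subrr ?normr0 ?sub0r ?normrN ?subr0 ?normr1.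
rewrite ge0_integralD//;
  try (by apply/measurable_EFinP; apply: measurable_funM => //; exact: measurable_indic);
  try (by move=> x _; rewrite lee_fin ?mulr_ge0// ltW).
rewrite integral_cst// [X in (_ * X + _)%E]probability_setT mule1 [e in leRHS]splitr EFinD leeD//.
under eq_integral do rewrite EFinM.
rewrite ge0_integralZl//=; last by apply/measurable_EFinP; exact: measurable_indic.
rewrite integral_indic// setIT.
apply: (@le_trans _ _ (`|y|%:E * (e / 2 / (`|y| + 1))%:E)%E); first by rewrite lee_wpmul2l.
rewrite -EFinM lee_fin mulrCA ler_piMr// ?(ltW e20)//.
by rewrite ler_pdivrMr// mul1r lerDl.
Qed.

Lemma rat_step_dense (u : T -> R) (e : R) : m.-integrable setT (EFin \o u) ->
  0 < e -> exists s, (\int[m]_x `|(rat_step s x - u x)%:E| <= e%:E)%E.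
Proof.
move=> iu e0; have e20 : 0 < e / 2 by rewrite divr_gt0.
have mu : measurable_fun setT u by apply/measurable_EFinP; exact: measurable_int iu.
have [g [ig _]] := approximation_sfun_integrable measurableT iu.
move=> /fine_cvgP[_] /cvgrPdist_le /(_ _ e20)[N _ /(_ N (leqnn N))] /=.
rewrite sub0r normrN => hN.
have gN : approximable (g N).
  have key (s : seq R) : approximable (fun x => \sum_(y <- s) y * \1_(g N @^-1` [set y]) x).
    elim: s => [|y s IHs].
      split; first by under eq_fun do rewrite big_nil; exact: measurable_cst.
      move=> e1 e10; exists [::]; rewrite /dist integral0_eq ?lee_fin ?ltW// => x _.
      by rewrite /rat_step !big_nil subrr abse0.
    under eq_fun do rewrite big_cons.
    apply: approximableD IHs; apply: approximable_indic.
    by rewrite -[X in measurable X]setTI; exact: measurable_funP.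
  have := key (finmap.enum_fset (fset_set (range (g N)))).
  congr approximable; apply/funext => x.
  by rewrite [RHS]fimfunE fsbig_finite.
have [mg /(_ _ e20)[s hs]] := gN; exists s.
apply: (le_trans (dist_triangle (measurable_rat_step s) mg mu)).
rewrite [e]splitr EFinD leeD//.
have -> : dist (g N) u = (\int[m]_z `|(u z)%:E - (g N z)%:E|)%E.
  by apply: eq_integral => x _; rewrite -EFinB /= distrC.
have h : (\int[m]_z `|(u z)%:E - (g N z)%:E| \is a fin_num)%E.
  by apply: integrable_fin_num => //; apply: integrable_abse; exact: (integrableB measurableT iu (ig N)).
rewrite -(fineK h) lee_fin; apply: le_trans hN; exact: ler_norm.
Qed.

Let step n := rat_step (odflt [::] (unpickle n)).

(* For every precision [2^-(k+1)], [y] follows the first rational step function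
   whose integrals over the generating algebra [A] are that close to [nu t]; the
   choice is measurable in [t], and the chosen functions converge almost
   everywhere. *)
Lemma joint_density d' (U : measurableType d') (nu : U -> set T -> \bar R) :
  (forall B, measurable B -> measurable_fun setT (nu^~ B)) ->
  (forall t, exists y : T -> R, m.-integrable setT (EFin \o y) /\
     forall B, measurable B -> nu t B = (\int[m]_(x in B) (y x)%:E)%E) ->
  exists y : U -> T -> R, measurable_fun setT (fun z : U * T => y z.1 z.2) /\
    forall t, m.-integrable setT (EFin \o y t) /\
     forall B, measurable B -> nu t B = (\int[m]_(x in B) (y t x)%:E)%E.
Proof.
move=> mnu hnu.
pose c k : R := 2^-1 ^+ k.+1.
have c0 k : 0 < c k by rewrite exprn_gt0// invr_gt0.
pose C k n := [set t | forall j,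
  (`|\int[m]_(x in A j) (step n x)%:E - nu t (A j)| <= (c k)%:E)%E].
have iS n j : (\int[m]_(x in A j) (step n x)%:E \is a fin_num)%E.
  apply: integrable_fin_num => //.
  exact: (integrableS measurableT (mA j) _ (integrable_rat_step _)).
have mC k n : measurable (C k n).
  have -> : C k n = \bigcap_j (fun t => `|\int[m]_(x in A j) (step n x)%:E - nu t (A j)|%E) @^-1`
      `]-oo, (c k)%:E].
    apply/seteqP; split => t /= h j; have := h j.
      by move=> hj _ /=; rewrite in_itv/=.
    by move=> /(_ Logic.I) /=; rewrite in_itv.
  apply: bigcap_measurableType => j _; rewrite -[X in measurable X]setTI.
  suff h : measurable_fun setT (fun t => `|\int[m]_(x in A j) (step n x)%:E - nu t (A j)|%E).
    by apply: h => //; exact: emeasurable_itv.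
  apply: measurableT_comp => //; apply: emeasurable_funB; first exact: measurable_cst.
  exact: mnu.
have iA (u : T -> R) B : measurable B -> m.-integrable setT (EFin \o u) -> m.-integrable B (EFin \o u).
  by move=> mB; exact: (integrableS measurableT).
have exC k t : exists n, `[< C k n t >].
  have [y [iy hy]] := hnu t; have [s hs] := rat_step_dense iy (c0 k).
  exists (pickle s); apply/asboolP => j.
  have es : step (pickle s) = rat_step s by rewrite /step pickleK.
  rewrite es hy// -integralB_EFin//; [|exact/iA/integrable_rat_step|exact: iA].
  apply: (le_trans (le_abse_integral _ _ _)) => //.
    apply: measurable_funTS; apply/measurable_EFinP; apply: measurable_funB.
      exact: measurable_rat_step.
    by apply/measurable_EFinP; exact: measurable_int iy.
  apply: le_trans hs; apply: ge0_subset_integral => //.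
  apply: measurableT_comp => //; apply/measurable_EFinP; apply: measurable_funB.
    exact: measurable_rat_step.
  by apply/measurable_EFinP; exact: measurable_int iy.
pose N k t := ex_minn (exC k t).
have NP k t : C k (N k t) t by rewrite /N; case: ex_minnP => n /asboolP.
have mN k n : measurable [set t | N k t = n].
  have -> : [set t | N k t = n] = C k n `&` \bigcap_(i in `I_n) ~` C k i.
    apply/seteqP; split => [t <-|t [Cn hn]].
      split; first exact: NP.
      move=> i /= iN Ci; move: iN; rewrite /N; case: ex_minnP => n' _ /(_ i).
      by rewrite leqNgt => h; apply/negP/h/asboolP.
    rewrite /= /N; case: ex_minnP => n' /asboolP Cn' h; apply/eqP.
    rewrite eqn_leq h/=; last exact/asboolP.
    by rewrite leqNgt; apply/negP => /hn.
  apply: measurableI => //; apply: bigcap_measurableType => i _; exact: measurableC.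
pose yk k (z : U * T) := step (N k z.1) z.2.
have myk k : measurable_fun setT (yk k).
  move=> _ B mB; rewrite setTI.
  have -> : yk k @^-1` B = \bigcup_n ([set t | N k t = n] `*` (step n @^-1` B)).
    apply/seteqP; split => [[t x] /= h|[t x] [n _ [/= <-]]] //.
    by exists (N k t).
  apply: bigcup_measurable => n _; apply: measurableX => //.
  by rewrite -[X in measurable X]setTI; exact: measurable_rat_step.
(* The upper limit exists and is measurable everywhere, even where the sequence diverges; [fine]
   then replaces infinite values by [0]. *)
pose Y (z : U * T) := limn_esup (fun k => (yk k z)%:E).
exists (fun t x => fine (Y (t, x))).
have mY : measurable_fun setT Y.
  by apply: measurable_fun_limn_esup => k; apply/measurable_EFinP.
split.
  by apply: measurableT_comp => //; under eq_fun do rewrite -surjective_pairing.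
move=> t.
have mYt : measurable_fun setT (fun x => fine (Y (t, x))).
  apply: measurableT_comp => //.
  by apply: (measurableT_comp mY); exact: pair1_measurable.
have [y [iy hy]] := hnu t.
have my : measurable_fun setT y by apply/measurable_EFinP; exact: measurable_int iy.
have iD k : m.-integrable setT (EFin \o (fun x => step (N k t) x - y x)).
  rewrite (_ : _ \o _ = (EFin \o step (N k t)) \- (EFin \o y))%E; last first.
    by apply/funext => x.
  by apply: integrableB => //; exact: integrable_rat_step.
have small k B : measurable B -> (`|\int[m]_(x in B) (step (N k t) x - y x)%:E| <= (c k)%:E)%E.
  apply: integral_algebra_le => // j; have := NP k t j; rewrite hy//.
  by rewrite -integralB_EFin//; [exact/iA/integrable_rat_step|exact: iA].
(* The bound [small] is used on the set where the difference is nonnegative and on its complement: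
   hence the factor [2], and a bound in [L^1]. *)
have small1 k : (\int[m]_x `|(step (N k t) x - y x)%:E| <= (2 * c k)%:E)%E.
  have mD : measurable_fun setT (fun x => step (N k t) x - y x).
    by apply: measurable_funB => //; exact: measurable_rat_step.
  pose B := [set x | 0 <= step (N k t) x - y x].
  have mB : measurable B.
    by rewrite -[X in measurable X]setTI; apply: measurable_fun_le.
  rewrite -(setUv B) ge0_integral_setU//; last 3 first.
  - exact: measurableC.
  - by rewrite setUv; apply: measurableT_comp => //; exact/measurable_EFinP.
  - by apply/eqP/seteqP; split => // x [].
  rewrite mulr2n mulrDl mul1r EFinD; apply: leeD.
    apply: le_trans (small k B mB); rewrite gee0_abs.
      rewrite le_eqVlt; apply/orP; left; apply/eqP.
      by apply: eq_integral => x /[!inE] Bx; rewrite gee0_abs.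
    by apply: integral_ge0 => x Bx; rewrite lee_fin.
  have mCB : measurable (~` B) by exact: measurableC.
  apply: le_trans (small k _ mCB); rewrite lee0_abs; last first.
    rewrite -oppe_ge0 -integralN; last exact/integrable_add_def/iA.
    by apply: integral_ge0 => x /= /negP; rewrite -ltNge => h; rewrite lee_fin oppr_ge0 ltW.
  rewrite -integralN; last exact/integrable_add_def/iA.
  rewrite le_eqVlt; apply/orP; left; apply/eqP.
  apply: eq_integral => x /[!inE] /= /negP; rewrite -ltNge => h.
  by rewrite ltr0_norm.
(* The distances in [L^1] are summable, so for almost every [x] the series of the differences
   converges and its terms tend to [0]. *)
have ae_lim : {ae m, forall x, fine (Y (t, x)) = y x}.
  pose S x := (\sum_(0 <= k <oo) `|(step (N k t) x - y x)%:E|)%E.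
  have mSk k : measurable_fun setT (fun x => `|(step (N k t) x - y x)%:E|%E).
    apply: measurableT_comp => //; apply/measurable_EFinP.
    by apply: measurable_funB => //; exact: measurable_rat_step.
  have iSS : m.-integrable setT S.
    apply/integrableP; split.
      by apply: ge0_emeasurable_sum => // k _; exact: mSk.
    under eq_integral do rewrite gee0_abs ?nneseries_ge0//.
    rewrite integral_nneseries//.
    apply: (@le_lt_trans _ _ (\sum_(0 <= k <oo) (2 / (2 ^ k.+1)%:R)%:E)%E).
      apply: lee_nneseries => [k _ _|k _]; first exact: integral_ge0.
      by apply: le_trans (small1 k) _; rewrite lee_fin /c exprVn natrX.
    by apply: (le_lt_trans (epsilon_trick0 xpredT _)) => //; exact: ltry.
  apply: filterS (integrable_ae measurableT iSS) => x /(_ Logic.I) Sx.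
  have : (series (fun k => `|step (N k t) x - y x|) @ \oo --> lim (series (fun k => `|step (N k t) x - y x|) @ \oo)).
    apply: nnseries_is_cvg => //.
    by move: Sx; rewrite fin_numElt => /andP[].
  move=> /cvgP /cvg_series_cvg_0 /norm_cvg0P h.
  have {}h : step (N k t) x @[k --> \oo] --> y x.
    by apply/subr_cvg0; exact: h.
  rewrite /Y (_ : limn_esup _ = (y x)%:E)//.
  have hE : (yk k (t, x))%:E @[k --> \oo] --> (y x)%:E by apply: cvg_comp h _.
  by have [_ ->] := cvg_limn_einf_sup hE.
have mYE : measurable_fun setT (EFin \o (fun x => fine (Y (t, x)))).
  exact/measurable_EFinP.
have myE : measurable_fun setT (EFin \o y) by exact/measurable_EFinP.
split.
  by apply: (integrable_ae_eq iy mYt); apply: filterS ae_lim => x ->.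
move=> B mB; rewrite hy//; apply: ae_eq_integral => //.
- exact: measurable_funTS.
- exact: measurable_funTS.
- by apply: filterS ae_lim => x /= ->.
Qed.

End generating_algebra.

Section joint_conditional_expectation.
Variables (R : realType) (X : completePseudoMetricType R).
Variables (P : probability (cadlag R X) R) (m : probability (borelType X) R).
Hypothesis X_polish : polish X.
Hypothesis P_stationary : is_stationary P m.
Implicit Types (t : R) (w : cadlag R X).

Lemma path_lawE t (B : set (borelType X)) : measurable B ->
  P (path_at t @^-1` B) = m B.
Proof.
move=> mB.
rewrite (_ : @path_at R X t = path_at (Num.max 0 (Num.min 1 t))); last first.
  by apply/funext => w; exact: cadlag_clamp.
by apply: P_stationary => //; rewrite le_max lexx ge_max ler01 ge_min lexx.
Qed.

Lemma ge0_integral_path t (f : borelType X -> \bar R) B : measurable B ->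
  measurable_fun setT f -> (forall x, 0 <= f x)%E ->
  (\int[P]_(w in path_at t @^-1` B) f (path_at t w) = \int[m]_(x in B) f x)%E.
Proof.
move=> mB mf f0; have mt := @measurable_path_at_all R X t.
rewrite -(@ge0_integral_pushforward _ _ _ _ _ _ mt P B f)//; last exact: measurable_funTS.
apply: eq_measure_integral => A mA _; rewrite /pushforward /=; exact: path_lawE.
Qed.

Lemma ge0_integral_pathT t (f : borelType X -> \bar R) :
  measurable_fun setT f -> (forall x, 0 <= f x)%E ->
  (\int[P]_w f (w t) = \int[m]_x f x)%E.
Proof. by move=> mf f0; rewrite -(ge0_integral_path t measurableT mf f0). Qed.

(** The integral of [Y] over [X_t in B] is a charge in [B], dominated by the law [m] of [X_t]; its
    Radon-Nikodym density is the function [E(Y | X_t = x)] of [x]. *)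
Lemma path_density t (Y : cadlag R X -> R) :
  P.-integrable setT (EFin \o Y) ->
  exists y : borelType X -> R, m.-integrable setT (EFin \o y) /\
    forall B, measurable B ->
      (\int[P]_(w in path_at t @^-1` B) (Y w)%:E = \int[m]_(x in B) (y x)%:E)%E.
Proof.
move=> iY; have mt := @measurable_path_at_all R X t.
pose nu (B : set (borelType X)) := (\int[P]_(w in path_at t @^-1` B) (Y w)%:E)%E.
have nuE : nu = pushforward (induced_charge iY) (path_at t) by [].
have nu0 : nu set0 = 0%E by rewrite /nu preimage_set0 integral_set0.
have mpre (B : set (borelType X)) : measurable B -> measurable (path_at t @^-1` B).
  by move=> mB; rewrite -[X in measurable X]setTI; exact: mt.
have nufin B : measurable B -> nu B \is a fin_num.
  move=> mB; apply: integrable_fin_num; first exact: mpre.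
  exact: (integrableS measurableT (mpre _ mB) _ iY).
have nus : semi_sigma_additive nu.
  move=> F mF tF mUF; rewrite nuE /pushforward preimage_bigcup.
  apply: charge_semi_sigma_additive.
  - by move=> n; exact: mpre.
  - apply/trivIsetP => /= i j _ _ ij; rewrite -preimage_setI.
    by move/trivIsetP : tF => /(_ _ _ _ _ ij) ->//; rewrite preimage_set0.
  - by rewrite -preimage_bigcup; exact: mpre.
pose nuc : {charge set (borelType X) -> \bar R} :=
  HB.pack nu (isCharge.Build _ _ _ nu nu0 nufin nus).
have num : nuc `<< m.
  apply/null_content_dominatesP => B mB mB0.
  rewrite /nuc /= /nu; apply: null_set_integral; first exact: mpre.
    by apply: measurable_funTS; exact: measurable_int iY.
  exact: etrans (path_lawE t mB) mB0.
exists (fine \o Radon_Nikodym nuc m); split.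
  rewrite (_ : _ \o _ = Radon_Nikodym nuc m); first exact: Radon_Nikodym_integrable.
  by apply/funext => x /=; rewrite fineK//; exact: Radon_Nikodym_fin_num.
move=> B mB; transitivity (nuc B) => //; rewrite (Radon_Nikodym_integral num mB).
by apply: eq_integral => x _ /=; rewrite fineK//; exact: Radon_Nikodym_fin_num.
Qed.

Lemma cond_exp_atP t (Y : cadlag R X -> R) (y : borelType X -> R) :
  P.-integrable setT (EFin \o Y) -> measurable_fun setT y -> (forall x, 0 <= y x) ->
  (forall B, measurable B ->
    (\int[P]_(w in path_at t @^-1` B) (Y w)%:E = \int[m]_(x in B) (y x)%:E)%E) ->
  cond_exp_at P t Y y.
Proof.
move=> iY my y0 hy; split => //.
have myE : measurable_fun setT (EFin \o y) by exact/measurable_EFinP.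
have mt := @measurable_path_at_all R X t.
split => //.
- apply/integrableP; split.
    by apply/measurable_EFinP; exact: (measurableT_comp my mt).
  rewrite (_ : (\int[P]_x _)%E = (\int[m]_x (y x)%:E)%E); last first.
    rewrite -(ge0_integral_pathT t myE); last by move=> x; rewrite lee_fin.
    by apply: eq_integral => w _; rewrite /= ger0_norm.
  by rewrite -hy// preimage_setT; exact: integrable_lty.
- by move=> B mB; exists (y @^-1` B); rewrite ?setTI// -[X in measurable X]setTI; exact: my.
- move=> _ [B mB <-]; rewrite setTI hy//.
  by rewrite (ge0_integral_path t mB myE)// => x; rewrite lee_fin.
Qed.

(** For each [u] a density is given by [path_density]. The integral of [Y u] over [X_(tau u) in B]
    is measurable in [u] by Tonelli, so [joint_density] provides a choice measurable in [(u, x)], to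
    which Fubini's theorem can be applied. *)
Lemma joint_cond_exp d (U : measurableType d) (tau : U -> R) (Y : U -> cadlag R X -> R) :
  measurable_fun setT tau ->
  measurable_fun setT (fun z : U * cadlag R X => Y z.1 z.2) ->
  (forall u w, 0 <= Y u w) ->
  (forall u, P.-integrable setT (EFin \o Y u)) ->
  exists y : U -> borelType X -> R,
    [/\ measurable_fun setT (fun z : U * borelType X => y z.1 z.2),
        forall u x, 0 <= y u x &
        forall u, cond_exp_at P (tau u) (Y u) (y u)].
Proof.
move=> mtau mY Y0 iY.
have [A [mA AC AU AG]] := polish_countable_algebra X_polish.
pose nu u (B : set (borelType X)) :=
  (\int[P]_(w in path_at (tau u) @^-1` B) (Y u w)%:E)%E.
have mnu B : measurable B -> measurable_fun setT (nu^~ B).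
  move=> mB.
  pose F (z : U * cadlag R X) := (Y z.1 z.2 * \1_B (z.2 (tau z.1) : borelType X))%:E.
  have mF : measurable_fun setT F.
    apply/measurable_EFinP; apply: measurable_funM => //.
    have mB1 : measurable_fun setT (\1_B : borelType X -> R) by exact: measurable_indic.
    have me := @measurable_path_eval R X.
    have mp : measurable_fun setT
        (fun z : U * cadlag R X => (tau z.1, z.2) : measurableTypeR R * cadlag R X).
      by apply: measurable_fun_pair => //; exact: measurableT_comp.
    exact: (measurableT_comp mB1 (measurableT_comp me mp)).
  have F0 z : (0 <= F z)%E by rewrite lee_fin mulr_ge0.
  have := @measurable_fun_fubini_tonelli_F _ _ _ _ _ P F mF F0.
  congr measurable_fun; apply/funext => u; rewrite /fubini_F /nu [RHS]integral_mkcond.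
  by apply: eq_integral => w _; rewrite epatch_indic /F EFinM.
have [y [my hy]] := joint_density mA AC AU AG mnu (fun u => path_density (tau u) (iY u)).
(* The positive part is still a density: the integral of [y u] over the set where it is negative is
   an integral of [Y u >= 0], so this set is [m]-null. *)
exists (fun u x => Num.max (y u x) 0); split.
- exact: (measurable_maxr my (measurable_cst _)).
- by move=> u x; rewrite le_max lexx orbT.
move=> u; have [iyu hyu] := hy u.
have myu : measurable_fun setT (y u) by apply/measurable_EFinP; exact: measurable_int iyu.
apply: cond_exp_atP => //.
- exact: (measurable_maxr myu (measurable_cst _)).
- by move=> x; rewrite le_max lexx orbT.
move=> B mB; rewrite -/(nu u B) hyu//.
have myE : measurable_fun setT (EFin \o y u) by exact/measurable_EFinP.
apply: ae_eq_integral => //.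
- exact: measurable_funTS.
- by apply: measurable_funTS; apply/measurable_EFinP; exact: (measurable_maxr myu (measurable_cst _)).
suff : {ae m, forall x, 0 <= y u x} by apply: filterS => x y0 _; rewrite max_l.
pose N := [set x | y u x < 0].
have mN : measurable N.
  have -> : N = y u @^-1` `]-oo, 0[ by apply/seteqP; split => x /=; rewrite in_itv.
  by rewrite -[X in measurable X]setTI; exact: myu.
have : ae_eq m N (EFin \o y u) (cst 0%E).
  apply/ae_eq_integral_abs => //; first exact: measurable_funTS.
  apply/eqP; rewrite eq_le integral_ge0// andbT.
  rewrite (_ : (\int[m]_(x in N) _)%E = (- \int[m]_(x in N) (y u x)%:E)%E).
    rewrite -hyu// oppe_le0; apply: integral_ge0 => w _; rewrite lee_fin; exact: Y0.
  rewrite -integralN; last exact/integrable_add_def/(integrableS measurableT mN _ iyu).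
  by apply: eq_integral => x /[!inE] /= Nx; rewrite /= ltr0_norm.
apply: filterS => x; rewrite /N /= => h; rewrite leNgt; apply/negP => yx.
by have /eqP := h yx; rewrite eqe => /eqP y0; move: yx; rewrite y0 ltxx.
Qed.

(** [joint_cond_exp] with a dummy parameter, for the positive and the negative part. *)
Lemma cond_exp_at_exists t (Y : cadlag R X -> R) :
  P.-integrable setT (EFin \o Y) -> exists y, cond_exp_at P t Y y.
Proof.
move=> iY.
have mY : measurable_fun setT Y by apply/measurable_EFinP; exact: measurable_int iY.
have pos (Z : cadlag R X -> R) : P.-integrable setT (EFin \o Z) -> (forall w, 0 <= Z w) ->
    exists y, cond_exp_at P t Z y.
  move=> iZ Z0.
  have mZ : measurable_fun setT Z by apply/measurable_EFinP; exact: measurable_int iZ.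
  have mZ2 : measurable_fun setT (fun z : measurableTypeR R * cadlag R X => Z z.2).
    exact: (measurableT_comp mZ measurable_snd).
  have [y [_ _ hy]] := @joint_cond_exp _ (measurableTypeR R) (cst t) (fun _ => Z)
    (measurable_cst _) mZ2 (fun _ => Z0) (fun _ => iZ).
  by exists (y 0); exact: hy.
have [y1 [my1 h1]] := pos _ (integrable_funrpos measurableT iY) (fun w => funrpos_ge0 _ _).
have [y2 [my2 h2]] := pos _ (integrable_funrneg measurableT iY) (fun w => funrneg_ge0 _ _).
exists (fun x => y1 x - y2 x); split; first exact: measurable_funB.
have := is_cond_expB (sigma_algebra_at X t) (@sigma_at_sub_measurable R X t) h1 h2.
congr is_cond_exp; apply/funext => w.
by rewrite -[RHS](congr1 (@^~ w) (funrposBneg Y)).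
Qed.

End joint_conditional_expectation.

(** * The Markov property for functionals of the future *)

Section markov.
Variables (R : realType) (X : completePseudoMetricType R).
Variables (P : probability (cadlag R X) R).
Hypothesis P_markov : is_markov P.
Implicit Types (t : R) (w : cadlag R X).

Let integral_indicE (A : set (cadlag R X)) (f : cadlag R X -> R) :
  (\int[P]_w (f w * \1_A w)%:E = \int[P]_(w in A) (f w)%:E)%E.
Proof.
by rewrite [RHS]integral_mkcond; apply: eq_integral => w _; rewrite epatch_indic EFinM.
Qed.

(** [is_markov] speaks of events. For [A] in the past, [\1_A] and its conditional mean [a] given
    [X_t] have the same integral over all future events, hence against the future functional [Y]:
    [E(1_A Y) = E(a Y) = E(a y) = E(1_A y)], with [y] taken at [X_t]. *)
Lemma markov_cond_exp t (Y : cadlag R X -> R) y : 0 <= t <= 1 ->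
  (forall w, 0 <= Y w) ->
  (forall B, measurable B -> sigma_between t 1 (Y @^-1` B)) ->
  cond_exp_at P t Y y ->
  is_cond_exp P (sigma_between 0 t) Y (fun w => y (path_at t w)).
Proof.
move=> t01 Y0 gY [my hy]; have /andP[t0 t1] := t01.
have st := sigma_algebra_at X t; have sM := @sigma_at_sub_measurable R X t.
have s0t := sigma_algebra_between X 0 t; have st1 := sigma_algebra_between X t 1.
have M0t := @sigma_between_measurable R X 0 t (lexx _) t1.
have Mt1 := @sigma_between_measurable R X t 1 t0 (lexx _).
have [iY iy gy ey] := hy.
have mYE : measurable_fun setT (EFin \o Y) := measurable_int _ iY.
have at0t : @sigma_at R X t `<=` sigma_between 0 t.
  by apply: sigma_at_between; rewrite t0 lexx.
split => //; first by move=> B mB; apply: at0t; exact: gy.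
move=> A FA; have mA := M0t _ FA.
have T1 : sigma_between t 1 (@setT (cadlag R X)).
  by have [h0 hC _] := st1; rewrite -(setD0 setT); exact: hC.
have [a0 [_ [_ [ha0 _ _ _]]]] := P_markov t01 FA T1.
pose a w := Num.max (a0 w) 0.
have a_ge0 w : 0 <= a w by rewrite /a le_max lexx orbT.
have ga : forall B, measurable B -> sigma_at t (a @^-1` B).
  apply/(g_sigma_measurable_fun st); apply: measurable_maxr; last exact: measurable_cst.
  by apply/(g_sigma_measurable_fun st); have [] := ha0.
have a0_ge0 := is_cond_exp_ge0 st sM (fun w => (andP (indic_ge0_le1 R A w)).1) ha0.
have ha : is_cond_exp P (sigma_at t) \1_A a.
  apply: (is_cond_exp_version sM ha0) => //.
  by apply: filterS a0_ge0 => w h; rewrite /a max_l.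
have iA : measurable_fun setT (EFin \o (\1_A : cadlag R X -> R)).
  by apply/measurable_EFinP; exact: measurable_indic.
have ma : measurable_fun setT (EFin \o a) by have [_ /measurable_int] := ha.
(* Both sides equal [E(a b')], with [b'] the conditional mean of [\1_B] given [X_t]: the left one by
   the Markov property, the right one because [a] is a function of [X_t]. *)
have agree B : sigma_between t 1 B ->
    (\int[P]_(w in B) (\1_A w)%:E = \int[P]_(w in B) (a w)%:E)%E.
  move=> FB; have mB := Mt1 _ FB.
  have [a' [b' [c' [ha' hb' hc' cab]]]] := P_markov t01 FA FB.
  have aa := is_cond_exp_unique st sM ha ha'.
  have b0 := is_cond_exp_ge0 st sM (fun w => (andP (indic_ge0_le1 R B w)).1) hb'.
  have TT : sigma_at t (@setT (cadlag R X)).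
    by have [h0 hC _] := st; rewrite -(setD0 setT); exact: hC.
  have mb' : measurable_fun setT b'.
    by apply/measurable_EFinP; have [_ /measurable_int] := hb'.
  transitivity (\int[P]_w (\1_(A `&` B) w)%:E)%E.
    rewrite -integral_indicE; apply: eq_integral => w _; congr EFin.
    by rewrite indicI.
  have [_ ic' _ /(_ _ TT) <-] := hc'.
  rewrite -[RHS]integral_indicE (is_cond_exp_pull st sM hb')//.
  apply: ae_eq_integral => //; first exact: measurable_int ic'.
    by apply/measurable_EFinP; apply: measurable_funM => //; exact/measurable_EFinP.
  by apply: filterS2 cab aa => w -> ->.
have h1 := ge0_integralM_agree st1 Mt1 iA ma _ _ agree _ (W := EFin \o Y).
have {}h1 : (\int[P]_w (Y w * \1_A w)%:E = \int[P]_w (Y w * a w)%:E)%E.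
  apply: h1.
  - by move=> w; rewrite lee_fin.
  - by move=> w; rewrite lee_fin.
  - by move=> w; rewrite lee_fin.
  - apply/(g_sigma_measurable_fun st1)/measurable_EFinP.
    exact/(g_sigma_measurable_fun st1).
rewrite -[RHS]integral_indicE h1.
under [RHS]eq_integral do rewrite mulrC.
have y0 := is_cond_exp_ge0 st sM Y0 hy.
rewrite (is_cond_exp_pull st sM hy)//.
pose y' w := Num.max (y (path_at t w)) 0.
have yy' : {ae P, forall w, y (path_at t w) = y' w}.
  by apply: filterS y0 => w h; rewrite /y' max_l.
have gy' : forall B, measurable B -> sigma_at t (y' @^-1` B).
  apply/(g_sigma_measurable_fun st); apply: measurable_maxr; last exact: measurable_cst.
  exact/(g_sigma_measurable_fun st).
have my' : measurable_fun setT y' by exact: (sub_measurable_fun sM).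
have myt : measurable_fun setT (fun w => y (path_at t w)).
  by apply/measurable_EFinP; exact: measurable_int iy.
have mar : measurable_fun setT a by exact/measurable_EFinP.
transitivity (\int[P]_w (y' w * a w)%:E)%E; last first.
  apply: ae_eq_integral => //.
  - by apply/measurable_EFinP; exact: measurable_funM.
  - by apply/measurable_EFinP; exact: measurable_funM.
  - by apply: filterS yy' => w ->; rewrite mulrC.
rewrite -(is_cond_exp_pull st sM ha)//; try (by apply: aeW);
  try (by move=> w; rewrite /y' le_max lexx orbT).
rewrite -integral_indicE; apply: ae_eq_integral => //.
- by apply/measurable_EFinP; apply: measurable_funM => //; exact: measurable_indic.
- by apply/measurable_EFinP; apply: measurable_funM => //; exact: measurable_indic.
- by apply: filterS yy' => w ->.
Qed.

End markov.

(** * The exponential of an integral *)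

Section exponential_of_integral.
Variables (R : realType) (a b : R) (f : R -> R).
Local Notation lambda := (@lebesgue_measure R).
Hypothesis f_int : lambda.-integrable `[a, b] (EFin \o f).

Lemma expR_lipschitz (u v L : R) : u <= L -> v <= L ->
  `|expR u - expR v| <= expR L * `|u - v|.
Proof.
wlog uv : u v / v <= u => [h uL vL|uL vL].
  have [/h|/ltW /h] := leP v u; first exact.
  by rewrite distrC [`|v - u|]distrC; exact.
rewrite !ger0_norm ?subr_ge0 ?ler_expR//.
have : expR u * (1 + (v - u)) <= expR u * expR (v - u).
  by rewrite ler_wpM2l ?expR_ge0// expR_ge1Dx.
rewrite -expRD (addrC u) subrK => h.
apply: (@le_trans _ _ (expR u * (u - v))).
  by move: h; rewrite mulrDr mulr1; lra.
by rewrite ler_wpM2r ?subr_ge0// ler_expR.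
Qed.

(** Convexity encloses [expR u - expR v] between [expR v * (u - v)] and [expR u * (u - v)]; the gap
    is then controlled by [expR_lipschitz]. *)
Lemma expR_taylor1 (u v L : R) : u <= L -> v <= L ->
  `|expR u - expR v - expR v * (u - v)| <= expR L * `|u - v| ^+ 2.
Proof.
move=> uL vL.
have h1 : expR v * (1 + (u - v)) <= expR u.
  have -> : expR u = expR v * expR (u - v) by rewrite -expRD (addrC v) subrK.
  by rewrite ler_wpM2l ?expR_ge0// expR_ge1Dx.
have h2 : expR u * (1 + (v - u)) <= expR v.
  have -> : expR v = expR u * expR (v - u) by rewrite -expRD (addrC u) subrK.
  by rewrite ler_wpM2l ?expR_ge0// expR_ge1Dx.
rewrite ger0_norm; last by move: h1; rewrite mulrDr mulr1; lra.
apply: (@le_trans _ _ ((expR u - expR v) * (u - v))).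
  by move: h2; rewrite mulrDr mulr1 mulrBl; lra.
rewrite expr2 mulrA (le_trans (ler_norm _))// normrM ler_wpM2r//.
exact: expR_lipschitz.
Qed.

Let intS p q : a <= p -> q <= b -> lambda.-integrable `[p, q] (EFin \o f).
Proof.
move=> ap qb; apply: integrableS f_int => //.
by apply: subset_itv; rewrite bnd_simp.
Qed.

Lemma Rintegral_itv_cat (g : R -> R) p r q : p <= r -> r <= q ->
  lambda.-integrable `[p, q] (EFin \o g) ->
  \int[lambda]_(x in `[p, q]) g x =
    \int[lambda]_(x in `[p, r]) g x + \int[lambda]_(x in `[r, q]) g x.
Proof.
move=> pr rq ig; have := @Rintegral_itvB R g (BLeft p) (BRight q) r ig.
rewrite !bnd_simp => /(_ pr rq).
rewrite Rintegral_itv_obnd_cbnd; last first.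
  apply: integrableS ig => //; apply: subset_itv; rewrite bnd_simp//.
by move=> <-; rewrite addrC subrK.
Qed.

Let I x := \int[lambda]_(r in `[a, x]) f r.
Let mu p q := \int[lambda]_(r in `[p, q]) `|f r|.

Let normS p q : a <= p -> q <= b -> lambda.-integrable `[p, q] (EFin \o (fun r => `|f r|)).
Proof. by move=> ap qb; exact/integrable_norm/intS. Qed.

Let mu_ge0 p q : 0 <= mu p q. Proof. exact: Rintegral_ge0. Qed.

Let mu_mono p q p' q' : a <= p -> p <= p' -> p' <= q' -> q' <= q -> q <= b -> mu p' q' <= mu p q.
Proof.
move=> ap pp p'q' qq qb.
rewrite /mu (@Rintegral_itv_cat _ p p' q)//; last 2 first.
- exact: le_trans qq.
- exact: normS.
rewrite (@Rintegral_itv_cat _ p' q' q)//; last by apply: normS; rewrite ?(le_trans ap).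
by rewrite -/(mu p p') -/(mu p' q') -/(mu q' q) addrCA lerDl addr_ge0.
Qed.

Let I_diff p q : a <= p -> p <= q -> q <= b -> I q - I p = \int[lambda]_(r in `[p, q]) f r.
Proof.
move=> ap pq qb; rewrite /I (@Rintegral_itv_cat _ a p q)//; last exact: intS.
by rewrite addrC addKr.
Qed.

Let I_le p q : a <= p -> p <= q -> q <= b -> `|I q - I p| <= mu p q.
Proof.
move=> ap pq qb; rewrite I_diff//; apply: le_normr_Rintegral => //.
exact: intS.
Qed.

Let M := mu a b.

Let I_leM p : a <= p -> p <= b -> I p <= M.
Proof.
move=> ap pb; apply: (le_trans (ler_norm _)).
apply: (le_trans (le_normr_Rintegral _ (intS (lexx a) pb))) => //.
exact: mu_mono.
Qed.

Let expI_int : lambda.-integrable `[a, b] (EFin \o (fun r => f r * expR (I r))).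
Proof.
have [ab|ba] := leP a b; last first.
  by rewrite set_itv_ge -?leNgt ?bnd_simp -?ltNge//; exact: integrable_set0.
have mI : measurable_fun `[a, b] (fun r => expR (I r)).
  apply: measurableT_comp => //; apply: subspace_continuous_measurable_fun => //.
  exact: parameterized_integral_continuous.
have := @integrableMl _ _ _ lambda `[a, b] (measurable_itv _) (EFin \o f) _ f_int mI.
apply; exists (expR M); split; first exact: num_real.
move=> x Mx r /=; rewrite in_itv/= => /andP[ar rb].
by rewrite ger0_norm ?expR_ge0// (le_trans _ (ltW Mx))// ler_expR I_leM.
Qed.

Let expIS p q : a <= p -> q <= b ->
  lambda.-integrable `[p, q] (EFin \o (fun r => f r * expR (I r))).
Proof.
move=> ap qb; apply: integrableS expI_int => //.
by apply: subset_itv; rewrite bnd_simp.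
Qed.

(** The defect in the chain rule for [expR (I x)] on [[p, q]]. As [f] is merely integrable, the
    identity is not obtained by differentiation; instead, [D] is additive in the interval and at
    most quadratic in the mass [mu p q] of [|f|]. *)
Let D p q := expR (I q) - expR (I p) - \int[lambda]_(r in `[p, q]) (f r * expR (I r)).

Let D_add p r q : a <= p -> p <= r -> r <= q -> q <= b -> D p q = D p r + D r q.
Proof.
move=> ap pr rq qb; rewrite /D (@Rintegral_itv_cat _ p r q)//; last exact: expIS.
have key (x y z u v : R) : x - z - (u + v) = y - z - u + (x - y - v) by ring.
exact: key.
Qed.

Let D_bound p q : a <= p -> p <= q -> q <= b -> `|D p q| <= 2 * expR M * mu p q ^+ 2.
Proof.
move=> ap pq qb.
have pb : p <= b by exact: le_trans qb.
have aq : a <= q by exact: le_trans pq.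
have ic : lambda.-integrable `[p, q] (EFin \o (fun r => expR (I p) * f r)).
  by apply: (integrableZl _ _ (intS ap qb)).
have -> : D p q = (expR (I q) - expR (I p) - expR (I p) * (I q - I p)) -
    \int[lambda]_(r in `[p, q]) (f r * expR (I r) - expR (I p) * f r).
  rewrite RintegralB//; last exact: expIS.
  rewrite RintegralZl//; last exact: intS.
  rewrite /D -I_diff//; move: (Rintegral _ _ _) (expR (I q)) (expR (I p)) (I q) (I p).
  by move=> u x y z t; ring.
apply: (le_trans (ler_normB _ _)); rewrite -mulrA mulr2n mulrDl mul1r.
apply: lerD.
  apply: (le_trans (expR_taylor1 (I_leM aq qb) (I_leM ap pb))).
  by rewrite ler_wpM2l ?expR_ge0// lerXn2r ?nnegrE// I_le.
have iB : lambda.-integrable `[p, q] (EFin \o (fun r => f r * expR (I r) - expR (I p) * f r)).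
  exact: (integrableB _ (expIS ap qb) ic).
apply: (le_trans (le_normr_Rintegral _ iB)) => //.
apply: (@le_trans _ _ (\int[lambda]_(r in `[p, q]) ((expR M * mu p q) * `|f r|))).
  apply: le_Rintegral => //.
  - exact: integrable_norm iB.
  - exact: (integrableZl _ _ (normS ap qb)).
  move=> r /=; rewrite in_itv/= => /andP[pr rq].
  rewrite [f r * _]mulrC -mulrBl normrM ler_wpM2r//.
  have rb : r <= b by exact: le_trans qb.
  have ar : a <= r by exact: le_trans pr.
  apply: (le_trans (expR_lipschitz (I_leM ar rb) (I_leM ap pb))).
  rewrite ler_wpM2l ?expR_ge0// (le_trans (I_le ap pr rb))// mu_mono//.
rewrite RintegralZl//; last exact: normS.
by rewrite -/(mu p q) expr2 mulrA.
Qed.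

(** The mass of [|f|] depends continuously on the end point, so the intermediate value theorem finds
    the point that halves it. *)
Let mid p q : a <= p -> p <= q -> q <= b -> exists r, [/\ p <= r, r <= q,
  mu p r = mu p q / 2 & mu r q = mu p q / 2].
Proof.
move=> ap pq qb; have inpq := normS ap qb.
have cm : {within `[p, q], continuous (fun x => mu p x)}.
  exact: parameterized_integral_continuous.
have [|r] := IVT (v := mu p q / 2) pq cm.
  have -> : mu p p = 0 by rewrite /mu set_itv1 Rintegral_set1.
  by rewrite min_l// max_r// divr_ge0//= ler_pdivrMr// ler_peMr// ler1n.
rewrite in_itv/= => /andP[pr rq] hr; exists r; split => //.
have := @Rintegral_itv_cat (fun r => `|f r|) p r q pr rq inpq.
rewrite -/(mu p q) -/(mu p r) -/(mu r q) hr => h.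
by rewrite {1}h addrC addrK || lra.
Qed.

(* Halving the interval with respect to [mu] halves the constant in the
   quadratic bound on the additive function [D], which therefore vanishes. *)
Let D_bound_halving n p q : a <= p -> p <= q -> q <= b ->
  `|D p q| <= 2 * expR M * mu p q ^+ 2 / 2 ^+ n.
Proof.
elim: n p q => [|n IHn] p q ap pq qb; first by rewrite expr0 divr1 D_bound.
have [r [pr rq h1 h2]] := mid ap pq qb.
rewrite (D_add ap pr rq qb) (le_trans (ler_normD _ _))//.
have := IHn p r ap pr (le_trans rq qb).
have := IHn r q (le_trans ap pr) rq qb.
rewrite h1 h2 => e1 e2; apply: (le_trans (lerD e2 e1)).
have X0 : 2 ^+ n != 0 :> R by rewrite expf_neq0.
rewrite [2 ^+ n.+1]exprS; move: (2 ^+ n) X0 (mu p q) (expR M) => x x0 y z.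
by rewrite le_eqVlt; apply/orP; left; apply/eqP; field.
Qed.

Lemma expR_Rintegral p q : a <= p -> p <= q -> q <= b ->
  expR (I q) - expR (I p) = \int[lambda]_(r in `[p, q]) (f r * expR (I r)).
Proof.
move=> ap pq qb; apply/eqP; rewrite -subr_eq0 -normr_eq0 -/(D p q).
rewrite eq_le normr_ge0 andbT; apply/ler_addgt0Pr => e e0; rewrite add0r.
set c := 2 * expR M * mu p q ^+ 2.
have c0 : 0 <= c by rewrite mulr_ge0// ?sqr_ge0// mulr_ge0// expR_ge0.
(* With this choice [2 ^ (n + 1)] exceeds [n + 1], hence [c / e]. *)
pose n := Num.truncn (c / e).
apply: (le_trans (D_bound_halving n.+1 ap pq qb)); rewrite -/c.
rewrite ler_pdivrMr ?exprn_gt0// -ler_pdivrMl// mulrC.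
apply: (le_trans (ltW (truncnS_gt _))).
by rewrite -natrX ler_nat ltnW// ltn_expl.
Qed.

End exponential_of_integral.

(** * Young functions *)

Section young.
Variables (R : realType) (gamma : R -> \bar R).
Hypothesis young : young_function gamma.
Local Open Scope ereal_scope.

Lemma young_ge0 a : 0 <= gamma a. Proof. by have [] := young. Qed.

Lemma young0 : gamma 0%R = 0. Proof. by have [] := young. Qed.

Lemma young_norm a : gamma `|a|%R = gamma a.
Proof.
have [_ _ gN _ _] := young.
by have [a0|a0] := leP 0%R a; [rewrite ger0_norm|rewrite ltr0_norm].
Qed.

(** Convexity between [0] and [b], where [gamma 0 = 0]. *)
Lemma young_mono (a b : R) : (0 <= a)%R -> (a <= b)%R -> gamma a <= gamma b.
Proof.
move=> a0 ab; have [b0|b0] := ltP 0%R b; last first.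
  have -> : a = 0%R by lra.
  by rewrite young0 young_ge0.
have [_ cv _ _ _] := young.
have t01 : (0 <= a / b <= 1)%R by rewrite divr_ge0 ?(ltW b0)//= ler_pdivrMr// mul1r.
have := cv b 0%R _ t01; rewrite mulr0 addr0 divfK ?gt_eqF// young0 mule0 adde0.
move=> /le_trans; apply; rewrite -[leRHS]mul1e lee_wpmul2r ?young_ge0// lee_fin.
by have /andP[] := t01.
Qed.

Lemma measurable_young : measurable_fun setT gamma.
Proof. by apply: lower_semicontinuous_measurable; have [] := young. Qed.

Lemma young_conj_ge0 b : 0 <= young_conj gamma b.
Proof.
apply: ereal_sup_ubound; exists 0%R => //=.
by rewrite mul0r young0 sube0.
Qed.

Lemma young_inequality a b : (0 <= a)%R ->
  (a * `|b|)%:E <= young_conj gamma b + gamma a.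
Proof.
move=> a0; have := young_ge0 a; case ga : (gamma a) => [r| |]// _; last first.
  by rewrite addeC addye ?leey// -ltNye (lt_le_trans _ (young_conj_ge0 b))// ltNy0.
rewrite -leeBlDr//; apply: ereal_sup_ubound; exists a => //.
by rewrite ga.
Qed.

Lemma young_convex3 (x y z : R) : (x <= y <= z)%R -> gamma x \is a fin_num ->
  gamma z \is a fin_num -> gamma y \is a fin_num /\
  ((z - x) * fine (gamma y) <= (z - y) * fine (gamma x) + (y - x) * fine (gamma z))%R.
Proof.
move=> /andP[xy yz] fx fz.
have [xz|zx] := ltP x z; last first.
  have e1 : y = x by lra.
  have e2 : z = x by lra.
  by rewrite e1; split => //; rewrite e2 !subrr !mul0r addr0.
have d0 : (0 < z - x)%R by rewrite subr_gt0.
have [_ cv _ _ _] := young.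
have t01 : (0 <= (z - y) / (z - x) <= 1)%R.
  by rewrite divr_ge0 ?subr_ge0// ?(le_trans xy)//= ler_pdivrMr// mul1r lerB.
have := cv x z _ t01.
have -> : ((z - y) / (z - x) * x + (1 - (z - y) / (z - x)) * z = y)%R.
  by field; rewrite gt_eqF.
rewrite -(fineK fx) -(fineK fz) -!EFinM -EFinD => h.
have fy : gamma y \is a fin_num.
  by rewrite ge0_fin_numE ?young_ge0// (le_lt_trans h) ?ltry.
split => //; move: h; rewrite -{1}(fineK fy) lee_fin => h.
rewrite -(ler_pM2l d0) in h; apply: (le_trans h); rewrite le_eqVlt.
by apply/orP; left; apply/eqP; rewrite !fineK//; field; rewrite gt_eqF.
Qed.

(* The slope of the secant over [[z / 2, z]], whose line supports [gamma] at [z]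
   once [gamma z] is replaced by [gamma (z / 2)]; this avoids one-sided
   derivatives.  The power is [(z / 2)^-1], with value [0] at [z = 0]. *)
Definition young_slope (z : R) : R :=
  ((fine (gamma z) - fine (gamma (z / 2))) * (z / 2) `^ (-1))%R.

Lemma young_slope_ge0 z : (0 <= z)%R -> gamma z \is a fin_num -> (0 <= young_slope z)%R.
Proof.
move=> z0 fz; rewrite /young_slope mulr_ge0 ?powR_ge0// subr_ge0.
have h : gamma (z / 2)%R <= gamma z.
  by apply: young_mono; rewrite ?divr_ge0// ler_pdivrMr// ler_peMr// ler1n.
apply: fine_le => //; rewrite ge0_fin_numE ?young_ge0// (le_lt_trans h)//.
by rewrite -ge0_fin_numE ?young_ge0.
Qed.

(** For [y >= z] and for [y < z / 2], convexity puts the graph above the secant line over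
    [[z / 2, z]], all the more above the lowered line. For [y] in between,
    [gamma (z / 2) <= gamma y] by monotonicity and the slope is nonnegative. *)
Lemma young_support (y z : R) : (0 <= y)%R -> (0 <= z)%R -> gamma z \is a fin_num ->
  gamma (z / 2)%R + (young_slope z * y)%:E <= gamma y + (young_slope z * z)%:E.
Proof.
move=> y0 z0 fz; have := young_ge0 y; case gy : (gamma y) => [gyr| |]// _; last first.
  by rewrite addye// leey.
have fy : gamma y \is a fin_num by rewrite gy.
have zz : (z / 2 <= z)%R by lra.
have f2 : gamma (z / 2)%R \is a fin_num.
  rewrite ge0_fin_numE ?young_ge0// (le_lt_trans (young_mono _ zz)) ?divr_ge0//.
  by rewrite -ge0_fin_numE ?young_ge0.
have s0 := young_slope_ge0 z0 fz.
have [z0'|zpos] := leP z 0%R.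
  have -> : z = 0%R by lra.
  by rewrite /young_slope mul0r young0 subrr !mul0r add0e adde0 -gy young_ge0.
have sE : (young_slope z * (z / 2) = fine (gamma z) - fine (gamma (z / 2)%R))%R.
  by rewrite /young_slope powR_inv1 ?divr_ge0// divfK// gt_eqF// divr_gt0.
rewrite -(fineK f2) -!EFinD lee_fin.
have -> : gyr = fine (gamma y) by rewrite gy.
have m2 : (fine (gamma (z / 2)%R) <= fine (gamma z))%R.
  by apply: fine_le => //; apply: young_mono => //; rewrite divr_ge0.
move: (young_slope z) s0 sE => s s0 sE.
have z20 : (0 < z / 2)%R by rewrite divr_gt0.
have e1 x : (z / 2 * (s * x) = (fine (gamma z) - fine (gamma (z / 2)%R)) * x)%R.
  by rewrite mulrA [(z / 2 * s)%R]mulrC sE.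
have m3 : (0 <= z / 2 * (fine (gamma z) - fine (gamma (z / 2)%R)))%R.
  by rewrite mulr_ge0 ?subr_ge0// ltW.
have [zy|yz] := leP z y.
  have zzy : (z / 2 <= z <= y)%R by rewrite zz zy.
  have [_ h] := young_convex3 zzy f2 fy.
  rewrite -(ler_pM2l z20) !mulrDr !e1; move: h m3.
  move: (fine (gamma (z / 2)%R)) (fine (gamma z)) (fine (gamma y)) => G2 Gz Gy h m3.
  by lra.
have [y2|y2] := leP (z / 2)%R y.
  have h : (fine (gamma (z / 2)%R) <= fine (gamma y))%R.
    by apply: fine_le => //; apply: young_mono => //; rewrite ltW.
  by rewrite lerD// ler_wpM2l// ltW.
have yzz : (y <= z / 2 <= z)%R by rewrite zz ltW.
have [_ h] := young_convex3 yzz fy fz.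
rewrite -(ler_pM2l z20) !mulrDr !e1; move: h m3.
move: (fine (gamma (z / 2)%R)) (fine (gamma z)) (fine (gamma y)) => G2 Gz Gy h m3.
by lra.
Qed.

End young.

Section cond_jensen.
Context d (T : measurableType d) (R : realType) (P : probability T R).
Variables (gamma : R -> \bar R) (G : set (set T)) (Y Z : T -> R).
Hypothesis young : young_function gamma.
Hypothesis sG : sigma_algebra setT G.
Hypothesis GM : G `<=` measurable.
Hypothesis YZ : is_cond_exp P G Y Z.
Hypothesis Y0 : forall w, 0 <= Y w.
Hypothesis gammaY : (\int[P]_w gamma (Y w) < +oo)%E.
Local Open Scope ereal_scope.

Let mY : measurable_fun setT Y.
Proof. by apply/measurable_EFinP; have [/measurable_int] := YZ. Qed.

Let gZ := let: And4 _ _ gZ _ := YZ in gZ.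

Let mZ : measurable_fun setT Z.
Proof. exact: (sub_measurable_fun GM). Qed.

Let mg := measurable_young young.

Let gg d' (U : measurableType d') (h : R -> U) : measurable_fun setT h ->
  forall B, measurable B -> G ((h \o Z) @^-1` B).
Proof.
move=> mh; apply/(g_sigma_measurable_fun sG); apply: measurableT_comp => //.
exact/(g_sigma_measurable_fun sG).
Qed.

Let Z_ge0 : {ae P, forall w, (0 <= Z w)%R}.
Proof. by have := is_cond_exp_ge0 sG GM Y0 YZ. Qed.

Let gammaY_fin : {ae P, forall w, gamma (Y w) \is a fin_num}.
Proof.
have iY : P.-integrable setT (fun w => gamma (Y w)).
  apply/integrableP; split; first exact: measurableT_comp.
  by under eq_integral do rewrite gee0_abs ?(young_ge0 young)//.
by have := integrable_ae measurableT iY; apply: filterS => w; apply.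
Qed.

(** On the [G]-set where [Z >= 0] and [gamma (Z w)] is infinite, finiteness of [gamma (Y w)] and
    monotonicity force [Y < Z], while [Y] and [Z] have the same integral there; so the set is
    null. *)
Let gammaZ_fin : {ae P, forall w, gamma (Z w) \is a fin_num}.
Proof.
pose D := [set w | gamma (Z w) = +oo /\ (0 <= Z w)%R].
have GD : G D.
  have mD : measurable (gamma @^-1` [set +oo] `&` [set x | (0 <= x)%R]).
    apply: measurableI.
      by rewrite -[X in measurable X]setTI; exact: mg.
    have -> : [set x | (0 <= x)%R] = `[0%R, +oo[%classic :> set R.
      by apply/seteqP; split => x /=; rewrite in_itv/= andbT.
    exact: measurable_itv.
  exact: (gZ mD).
have mD := GM GD.
have [iY iZ _ eZ] := YZ.
have YD : {ae P, forall w, D w -> (Y w < Z w)%R}.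
  apply: filterS gammaY_fin => w fY [gZw Zw]; rewrite ltNge; apply/negP => ZY.
  have := young_mono young Zw ZY; rewrite gZw leye_eq => /eqP gYw.
  by move: fY; rewrite gYw.
have iDf f : P.-integrable setT f -> P.-integrable D f.
  exact: (integrableS measurableT).
have h : \int[P]_(w in D) (Z w - Y w)%:E = 0.
  under eq_integral do rewrite EFinB.
  rewrite integralB_EFin//; [|exact: iDf..].
  by rewrite eZ// subee//; apply: integrable_fin_num => //; exact: iDf.
have mZY : measurable_fun D (fun w => (Z w - Y w)%:E).
  by apply: measurable_funTS; apply/measurable_EFinP; exact: measurable_funB.
have : ae_eq P D (fun w => (Z w - Y w)%:E) (cst 0).
  apply/ae_eq_integral_abs => //; rewrite -h.
  apply: ae_eq_integral => //; first exact: measurableT_comp.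
  apply: filterS YD => w + Dw => /(_ Dw) h'.
  by rewrite gee0_abs// lee_fin subr_ge0 ltW.
move: YD Z_ge0; apply: filterS3 => w h1 h2 h3.
rewrite ge0_fin_numE ?(young_ge0 young)// ltey; apply/eqP => gZw.
have Dw : D w by [].
have /eqP := h3 Dw; rewrite eqe subr_eq0 => /eqP e.
by have := h1 Dw; rewrite e ltxx.
Qed.

(** Integrate [young_support] at [z = Z w] and [y = Y w]: with [s] the slope at [Z w], which is
    [G]-measurable, [s * Y] and [s * Z] have the same integral and cancel. The factor [1 / 2] is the
    price of the lowered line, harmless in an Orlicz space. *)
Lemma cond_jensen : \int[P]_w gamma (Z w / 2)%R <= \int[P]_w gamma (Y w).
Proof.
(* Restricting to slopes at most [N] makes the integral of [s * Y] finite, so that it can be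
   subtracted; monotone convergence in [N] follows. *)
pose B N := [set z | [/\ (0 <= z)%R, gamma z \is a fin_num & (young_slope gamma z <= N%:R)%R]].
have m2 : measurable_fun setT (fun z : R => (z / 2)%R) by exact: measurable_funM.
have mslope : measurable_fun setT (young_slope gamma).
  apply: measurable_funM.
    apply: measurable_funB; apply: measurableT_comp => //.
    exact: (measurableT_comp mg m2).
  exact: (measurableT_comp (measurable_powR (-1)) m2).
have mB N : measurable (B N).
  have -> : B N = [set x | (0 <= x)%R] `&` (gamma @^-1` (~` [set +oo])) `&`
      [set x | (young_slope gamma x <= N%:R)%R].
    apply/seteqP; split => [x [x0 fx sx]|x [[x0 /= fx] sx]].
      by split => //; split => //= gx; move: fx; rewrite gx.
    split => //; rewrite ge0_fin_numE ?(young_ge0 young)// ltey; exact/eqP.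
  apply: measurableI; first apply: measurableI.
  - have -> : [set x | (0 <= x)%R] = `[0%R, +oo[%classic :> set R.
      by apply/seteqP; split => x /=; rewrite in_itv/= andbT.
    exact: measurable_itv.
  - by rewrite -[X in measurable X]setTI; apply: mg => //; exact: measurableC.
  - by rewrite -[X in measurable X]setTI; apply: measurable_fun_le.
have mZ2 : measurable_fun setT (fun w => gamma (Z w / 2)%R).
  exact: (measurableT_comp mg (measurableT_comp m2 mZ)).
have mgY : measurable_fun setT (fun w => gamma (Y w)) by exact: measurableT_comp.
have mZB N : measurable (Z @^-1` B N) by rewrite -[X in measurable X]setTI; exact: mZ.
have key N : \int[P]_(w in Z @^-1` B N) gamma (Z w / 2)%R <= \int[P]_w gamma (Y w).
  pose W w := (\1_(B N) (Z w) * young_slope gamma (Z w))%R.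
  have W0 w : (0 <= W w)%R.
    rewrite /W indicE; case: (boolP (_ \in _)) => [/set_mem[z0 fz _]|]; last by rewrite mul0r.
    by rewrite mul1r young_slope_ge0.
  have gW : forall B', measurable B' -> G (W @^-1` B').
    apply: (@gg _ R (fun z => \1_(B N) z * young_slope gamma z)%R).
    by apply: measurable_funM => //; exact: measurable_indic.
  have mW : measurable_fun setT W by exact: (sub_measurable_fun GM).
  have WN w : (W w <= N%:R)%R.
    rewrite /W indicE; case: (boolP (_ \in _)) => [/set_mem[z0 fz h]|]; last by rewrite mul0r.
    by rewrite mul1r.
  have pull := is_cond_exp_pull sG GM YZ Y0 Z_ge0 W0 gW.
  have [iY iZ _ _] := YZ.
  have fWY : \int[P]_w (W w * Y w)%:E \is a fin_num.
    rewrite ge0_fin_numE; last by apply: integral_ge0 => w _; rewrite lee_fin mulr_ge0.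
    apply: (@le_lt_trans _ _ (\int[P]_w (N%:R * Y w)%:E)).
      apply: ge0_le_integral => //.
      - by move=> w _; rewrite lee_fin mulr_ge0.
      - by apply/measurable_EFinP; exact: measurable_funM.
      - by apply/measurable_EFinP; exact: measurable_funM.
      - by move=> w _; rewrite lee_fin ler_wpM2r.
    apply: integrable_lty => //; exact: (integrableZl measurableT N%:R iY).
  rewrite -(leeD2rE _ _ fWY).
  rewrite [in leRHS]pull.
  have mWYE : measurable_fun setT (fun w => (W w * Y w)%:E).
    by apply/measurable_EFinP; exact: measurable_funM.
  have mWZE : measurable_fun setT (fun w => (W w * Z w)%:E).
    by apply/measurable_EFinP; exact: measurable_funM.
  pose Zp w := Num.max (Z w) 0%R.
  have mZp : measurable_fun setT Zp by apply: measurable_maxr => //; exact: measurable_cst.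
  have mWZp : measurable_fun setT (fun w => (W w * Zp w)%:E).
    by apply/measurable_EFinP; exact: measurable_funM.
  have -> : \int[P]_w (W w * Z w)%:E = \int[P]_w (W w * Zp w)%:E.
    by apply: ae_eq_integral => //; apply: filterS Z_ge0 => w h _; rewrite /Zp max_l.
  have W0E (f : T -> R) : (forall w, 0 <= f w)%R -> forall w, [set: T] w -> 0 <= (W w * f w)%:E.
    by move=> f0 w _; rewrite lee_fin mulr_ge0.
  have Zp0 w : (0 <= Zp w)%R by rewrite /Zp le_max lexx orbT.
  have mr : measurable_fun setT ((fun w => gamma (Z w / 2)%R) \_ (Z @^-1` B N)).
    by apply/(measurable_restrictT _ (mZB N)); exact: measurable_funTS.
  rewrite integral_mkcond -ge0_integralD//; last 2 first.
  - by move=> w _; apply: erestrict_ge0 => ? _; exact: young_ge0.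
  - exact: W0E.
  rewrite -ge0_integralD//; last 2 first.
  - by move=> w _; exact: young_ge0.
  - exact: W0E.
  apply: ge0_le_integral => //.
  - move=> w _; apply: adde_ge0; first by apply: erestrict_ge0 => ? _; exact: young_ge0.
    exact: W0E.
  - exact: emeasurable_funD.
  - exact: emeasurable_funD.
  move=> w _; rewrite patchE; case: ifPn => [/set_mem/= BZ|nB].
    have [z0 fz _] := BZ.
    by rewrite /W indicE mem_set//= mul1r /Zp max_l//; exact: young_support.
  rewrite add0e /W indicE memNset ?mul0r ?adde0 ?(young_ge0 young)//.
  by move=> BZ; move: nB; rewrite mem_set.
have cv : \int[P]_(w in Z @^-1` B N) gamma (Z w / 2)%R @[N --> \oo] -->
    \int[P]_(w in \bigcup_N (Z @^-1` B N)) gamma (Z w / 2)%R.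
  apply: ge0_nondecreasing_set_cvg_integral => //.
  - move=> n k nk; apply/subsetPset => w [z0 fz h]; split => //.
    by rewrite (le_trans h)// ler_nat.
  - by move=> N; exact: measurable_funTS.
  - by move=> N w _; exact: young_ge0.
rewrite (_ : \int[P]_w gamma (Z w / 2)%R = \int[P]_(w in \bigcup_N (Z @^-1` B N)) gamma (Z w / 2)%R).
  by rewrite -(cvg_lim _ cv)//; apply: lime_le; [apply/cvg_ex; eexists; exact: cv|exact: nearW].
have mU : measurable (\bigcup_N (Z @^-1` B N)) by exact: bigcup_measurable.
rewrite [RHS]integral_mkcond; apply: ge0_ae_eq_integral => //.
- by apply/(measurable_restrictT _ mU); exact: measurable_funTS.
- by move=> w _; exact: young_ge0.
- by move=> w _; apply: erestrict_ge0 => ? _; exact: young_ge0.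
move: gammaZ_fin Z_ge0; apply: filterS2 => w h1 h2 _.
rewrite patchE mem_set//; exists (Num.truncn (young_slope gamma (Z w))).+1 => //.
by split => //; rewrite ltW// (lt_le_trans (truncnS_gt _)).
Qed.

End cond_jensen.

(** * Conditional means of time integrals *)

Lemma integrable_fine d (T : measurableType d) (R : realType)
    (mu : {measure set T -> \bar R}) (f : T -> \bar R) :
  mu.-integrable setT f -> mu.-integrable setT (EFin \o (fun x => fine (f x))).
Proof.
move=> fi; have mf := measurable_int _ fi; have /integrableP[_] := fi.
move=> lty; apply/integrableP; split.
  by apply/measurable_EFinP; exact: measurableT_comp.
apply: le_lt_trans lty; apply: ge0_le_integral => //.
- by apply: measurableT_comp => //; apply/measurable_EFinP; exact: measurableT_comp.
- exact: measurableT_comp.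
- by move=> x _ /=; case: (f x) => [r| |] //=; rewrite normr0 leey.
Qed.

Section lebesgue_translation.
Variable R : realType.
Local Notation lambda := (@lebesgue_measure R).

Lemma lebesgue_measureD (c : R) (A : set R) : measurable A ->
  pushforward lambda (fun x : R => x + c : measurableTypeR R) A = lambda A.
Proof.
move=> mA.
have mf : measurable_fun [set: measurableTypeR R] (fun x : measurableTypeR R => (x : R) + c : measurableTypeR R).
  have mf0 : measurable_fun [set: R] (fun x : R => x + c) by exact: measurable_funD.
  by move=> mT B mB; exact: mf0.
pose mixin := isMeasurableFun.Build _ _ _ _ _ mf.
pose F : {mfun measurableTypeR R >-> measurableTypeR R} := 
  HB.pack (fun x : measurableTypeR R => (x : R) + c : measurableTypeR R) mixin.
apply/esym; apply: (@lebesgue_measure_unique R (pushforward lambda F)) => //= _ [[a b]] _ <-.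
rewrite /pushforward /= (_ : _ @^-1` _ = `]a - c, b - c]%classic).
  rewrite !lebesgue_measure_itv/= !lte_fin ltrD2r.
  by case: ifPn => // _; rewrite -!EFinB; congr EFin; ring.
by apply/seteqP; split => x /=; rewrite !in_itv/= ltrBlDr lerBrDr.
Qed.

Lemma ge0_integral_translation (c : R) (f : R -> \bar R) :
  measurable_fun setT f -> (forall x, 0 <= f x)%E ->
  (\int[lambda]_x f (x + c)%R = \int[lambda]_x f x)%E.
Proof.
move=> mf f0.
have mg : measurable_fun [set: measurableTypeR R] (fun x : measurableTypeR R => (x : R) + c : measurableTypeR R).
  have mf0 : measurable_fun [set: R] (fun x : R => x + c) by exact: measurable_funD.
  by move=> mT B mB; exact: mf0.
have mf' : measurable_fun [set: measurableTypeR R] f by move=> mT B mB; exact: mf.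
have := @ge0_integral_pushforward _ _ _ _ R _ mg (@lebesgue_measure R) setT f measurableT mf' (fun x _ => f0 x).
rewrite preimage_setT => /= <-.
apply: eq_measure_integral => A mA _ /=; exact: lebesgue_measureD.
Qed.

End lebesgue_translation.

Section conditional_time_integral.
Variables (R : realType) (X : completePseudoMetricType R).
Variables (P : probability (cadlag R X) R) (m : probability (borelType X) R).
Hypothesis X_polish : polish X.
Hypothesis P_stationary : is_stationary P m.
Local Notation lambda := (@lebesgue_measure R).
Implicit Types (t r h : R) (w : cadlag R X).

(** Vanishing outside [[0, 1]] lets windows [[t, t + h]] overrun time [1] and lets integrals over
    time extend to the whole line, where translation is available. The bound [C] is uniform in
    time. *)
Definition is_rate (f : measurableTypeR R * borelType X -> R) (C : R) :=
  [/\ measurable_fun setT f, forall z, 0 <= f z,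
      forall z, ~ (0 <= z.1 <= 1) -> f z = 0 &
      forall r, (\int[m]_x (f (r, x))%:E <= C%:E)%E].

(* [q t r x] is a version of [E(f(r, X_r) | X_t = x)]. *)
Definition is_transition (f : measurableTypeR R * borelType X -> R)
    (q : R -> R -> borelType X -> R) :=
  [/\ measurable_fun setT
        (fun z : measurableTypeR R * measurableTypeR R * borelType X => q z.1.1 z.1.2 z.2),
      forall t r x, 0 <= q t r x &
      forall t r, cond_exp_at P t (fun w => f (r, w r)) (q t r)].

Lemma rate_integrable f C r : is_rate f C ->
  P.-integrable setT (fun w => (f (r, w r))%:E).
Proof.
move=> [mf f0 _ fC].
have mfr : measurable_fun setT (fun x => f (r, x)).
  by apply: (measurableT_comp mf); exact: pair1_measurable.
apply/integrableP; split.
  apply/measurable_EFinP; apply: (measurableT_comp mfr).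
  exact: measurable_path_at_all.
apply: (@le_lt_trans _ _ C%:E); last exact: ltry.
apply: le_trans (fC r).
rewrite -(ge0_integral_pathT P_stationary r (f := fun x => (f (r, x))%:E))//.
- rewrite le_eqVlt; apply/orP; left; apply/eqP; apply: eq_integral => w _.
  by rewrite gee0_abs// lee_fin.
- exact/measurable_EFinP.
- by move=> x; rewrite lee_fin.
Qed.

Lemma is_transition_exists f C : is_rate f C -> exists q, is_transition f q.
Proof.
move=> fC; have [mf f0 _ _] := fC.
have mY : measurable_fun setT
    (fun z : (measurableTypeR R * measurableTypeR R) * cadlag R X => f (z.1.2, z.2 z.1.2)).
  have mp : measurable_fun setT
     (fun z : (measurableTypeR R * measurableTypeR R) * cadlag R X =>
        (z.1.2, z.2) : measurableTypeR R * cadlag R X).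
    apply: measurable_fun_pair; last exact: measurable_snd.
    exact: (measurableT_comp measurable_snd measurable_fst).
  exact: (measurableT_comp (measurable_path_comp mf) mp).
have [y [my y0 hy]] := @joint_cond_exp R X P m X_polish P_stationary _
  (measurableTypeR R * measurableTypeR R)%type fst
  (fun u w => f (u.2, w u.2)) measurable_fst mY (fun u w => f0 _)
  (fun u => rate_integrable u.2 fC).
exists (fun t r => y (t, r)); split => //; last by move=> t r; exact: (hy (t, r)).
congr measurable_fun : my; apply/funext => -[[t r] x] //.
Qed.

Definition path_occ (f : measurableTypeR R * borelType X -> R) t h w : \bar R :=
  (\int[lambda]_(r in `[t, (t + h)%R]) (f (r, w r))%:E)%E.

(** A version of the conditional mean of [path_occ f t h] given [X_t = x], built from the same [q]
    for all [h]: it is nondecreasing in [h], with no exceptional null set depending on [h]. *)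
Definition trans_occ (q : R -> R -> borelType X -> R) t h x : \bar R :=
  (\int[lambda]_(r in `[t, (t + h)%R]) (q t r x)%:E)%E.

Lemma path_occ_ge0 f C t h w : is_rate f C -> (0 <= path_occ f t h w)%E.
Proof. by move=> [_ f0 _ _]; apply: integral_ge0 => r _; rewrite lee_fin. Qed.

Lemma trans_occ_ge0 f q t h x : is_transition f q -> (0 <= trans_occ q t h x)%E.
Proof. by move=> [_ q0 _]; apply: integral_ge0 => r _; rewrite lee_fin. Qed.

Lemma measurable_trans_occ f q h : is_transition f q ->
  measurable_fun setT (fun z : measurableTypeR R * borelType X => trans_occ q z.1 h z.2).
Proof.
move=> [mq q0 _].
pose D : set (measurableTypeR R * borelType X * measurableTypeR R) :=
  [set z | z.1.1 <= z.2] `&` [set z | z.2 <= z.1.1 + h].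
have m11 : measurable_fun setT (fun z : measurableTypeR R * borelType X * measurableTypeR R => z.1.1).
  exact: (measurableT_comp measurable_fst measurable_fst).
have mD : measurable D.
  apply: measurableI.
    by rewrite -[X in measurable X]setTI; exact: measurable_fun_le.
  rewrite -[X in measurable X]setTI; apply: measurable_fun_le => //.
  by apply: measurable_funD.
pose F := ((fun z : measurableTypeR R * borelType X * measurableTypeR R =>
   (q z.1.1 z.2 z.1.2)%:E) \_ D).
have mF : measurable_fun setT F.
  apply/(measurable_restrictT _ mD); apply: measurable_funTS.
  apply/measurable_EFinP.
  have mp : measurable_fun setT (fun z : measurableTypeR R * borelType X * measurableTypeR R =>
      ((z.1.1, z.2), z.1.2) : measurableTypeR R * measurableTypeR R * borelType X).
    apply: measurable_fun_pair; first exact: measurable_fun_pair.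
    exact: (measurableT_comp measurable_snd measurable_fst).
  exact: (measurableT_comp mq mp).
have F0 z : (0 <= F z)%E by rewrite /F patchE; case: ifP => // _; rewrite lee_fin.
have := @measurable_fun_fubini_tonelli_F _ _ _ _ _ lambda F mF F0.
congr measurable_fun; apply/funext => -[t x].
rewrite /fubini_F /trans_occ [RHS]integral_mkcond; apply: eq_integral => r _.
rewrite /F !patchE; congr (if _ then _ else _).
by apply/idP/idP; rewrite !inE /D /= in_itv/= => /andP.
Qed.

Lemma measurable_path_occ f C t h : is_rate f C -> measurable_fun setT (path_occ f t h).
Proof.
move=> [mf f0 _ _].
have mfE : measurable_fun setT (EFin \o f) by exact/measurable_EFinP.
have := @measurable_path_integral_joint R X _ (measurableTypeR R) (cst t) (cst (t + h))
  (EFin \o f) (measurable_cst _) (measurable_cst _).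
move=> /(_ mfE (fun z => f0 z)) mj.
have mp : measurable_fun setT (fun w : cadlag R X => (0, w) : measurableTypeR R * cadlag R X).
  exact: pair1_measurable.
exact: (measurableT_comp mj mp).
Qed.

Lemma integral_path_occ f C t h (A : set (cadlag R X)) : is_rate f C -> measurable A ->
  (\int[P]_(w in A) path_occ f t h w =
   \int[lambda]_(r in `[t, (t + h)%R]) \int[P]_(w in A) (f (r, w r))%:E)%E.
Proof.
move=> [mf f0 _ _] mA.
have mF : measurable_fun setT (fun z : cadlag R X * measurableTypeR R => (f (z.2, z.1 z.2))%:E).
  apply/measurable_EFinP.
  exact: (measurableT_comp (measurable_path_comp mf) (@measurable_swap _ _ (cadlag R X) (measurableTypeR R))).
exact: (@tonelli_in _ _ _ _ R P lambda A `[t, t + h] _ mA (measurable_itv _) mF (fun z => f0 _)).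
Qed.

Lemma integral_path_occ_le f C t h (A : set (cadlag R X)) : is_rate f C -> measurable A ->
  0 <= h -> (\int[P]_(w in A) path_occ f t h w <= (C * h)%:E)%E.
Proof.
move=> fC mA h0; rewrite (integral_path_occ _ _ fC mA).
have [mf f0 _ fB] := fC.
apply: (@le_trans _ _ (\int[lambda]_(r in `[t, (t + h)%R]) C%:E)%E).
  apply: ge0_le_integral => //.
  - by move=> r _; apply: integral_ge0 => w _; rewrite lee_fin.
  - apply: measurable_funTS.
    have mF : measurable_fun setT (fun z : measurableTypeR R * cadlag R X => (f (z.1, z.2 z.1))%:E).
      by apply/measurable_EFinP; exact: measurable_path_comp.
    exact: (@measurable_integral_in _ _ _ _ R P A _ mA mF (fun z => f0 _)).
  - move=> r _; apply: (@le_trans _ _ (\int[P]_w (f (r, w r))%:E)%E).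
      apply: ge0_subset_integral => //.
      - by have /measurable_int := rate_integrable r fC.
      - by move=> w _; rewrite lee_fin.
    apply: le_trans (fB r).
    rewrite (ge0_integral_pathT P_stationary r (f := fun x => (f (r, x))%:E))//.
    - by apply/measurable_EFinP; apply: (measurableT_comp mf); exact: pair1_measurable.
    - by move=> x; rewrite lee_fin.
rewrite integral_cst//= lebesgue_measure_itv/= lte_fin ltrDl.
case: ifPn => [_|]; last by rewrite mule0 lee_fin mulr_ge0// -lee_fin (le_trans _ (fB 0))// integral_ge0// => x _; rewrite lee_fin.
by rewrite -EFinB -EFinM addrAC subrr add0r.
Qed.

Lemma integrable_path_occ f C t h : is_rate f C -> 0 <= h ->
  P.-integrable setT (EFin \o (fun w => fine (path_occ f t h w))) /\
  {ae P, forall w, path_occ f t h w \is a fin_num}.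
Proof.
move=> fC h0; have mo := measurable_path_occ t h fC.
have io : P.-integrable setT (path_occ f t h).
  apply/integrableP; split => //.
  apply: (@le_lt_trans _ _ (C * h)%:E); last exact: ltry.
  apply: le_trans (integral_path_occ_le t fC measurableT h0).
  rewrite le_eqVlt; apply/orP; left; apply/eqP; apply: eq_integral => w _.
  by rewrite gee0_abs//; exact: path_occ_ge0 fC.
have aefin : {ae P, forall w, path_occ f t h w \is a fin_num}.
  by have := integrable_ae measurableT io; apply: filterS => w; apply.
by split => //; exact: integrable_fine.
Qed.

(** Tonelli's theorem moves the conditional expectation under the time integral. *)
Lemma integral_trans_occ f C q t h A : is_rate f C -> is_transition f q -> sigma_at t A ->
  (\int[P]_(w in A) trans_occ q t h (path_at t w) = \int[P]_(w in A) path_occ f t h w)%E.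
Proof.
move=> fC fq At; have mA := sigma_at_sub_measurable At.
rewrite (integral_path_occ _ _ fC mA).
have [mq q0 hq] := fq.
have mF : measurable_fun setT (fun z : cadlag R X * measurableTypeR R => (q t z.2 (path_at t z.1))%:E).
  apply/measurable_EFinP.
  have mp : measurable_fun setT (fun z : cadlag R X * measurableTypeR R =>
      ((t, z.2), path_at t z.1) : measurableTypeR R * measurableTypeR R * borelType X).
    apply: measurable_fun_pair.
      by apply: measurable_fun_pair; [exact: measurable_cst|exact: measurable_snd].
    exact: (measurableT_comp (@measurable_path_at_all R X t) measurable_fst).
  exact: (measurableT_comp mq mp).
rewrite (@tonelli_in _ _ _ _ R P lambda A `[t, t + h] _ mA (measurable_itv _) mF (fun z => q0 _ _ _)).
by apply: eq_integral => r _ /=; have [_ [_ _ _ ->]] := hq t r.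
Qed.

Lemma cond_exp_trans_occ f C q t h : is_rate f C -> is_transition f q -> 0 <= h ->
  cond_exp_at P t (fun w => fine (path_occ f t h w)) (fun x => fine (trans_occ q t h x)) /\
  {ae P, forall w, trans_occ q t h (path_at t w) \is a fin_num}.
Proof.
move=> fC fq h0; have [io aefin] := integrable_path_occ t fC h0.
have mt := measurable_trans_occ h fq.
have mtt : measurable_fun setT (fun x => trans_occ q t h x).
  have mp : measurable_fun setT (fun x : borelType X => (t, x) : measurableTypeR R * borelType X).
    exact: pair1_measurable.
  exact: (measurableT_comp mt mp).
have mpt := @measurable_path_at_all R X t.
have sTt : sigma_at t (@setT (cadlag R X)) by exists setT => //; rewrite setTI preimage_setT.
have mtp : measurable_fun setT (fun w => trans_occ q t h (path_at t w)).
  exact: (measurableT_comp mtt mpt).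
have itr : P.-integrable setT (fun w => trans_occ q t h (path_at t w)).
  apply/integrableP; split => //.
  apply: (@le_lt_trans _ _ (C * h)%:E); last exact: ltry.
  apply: le_trans (integral_path_occ_le t fC measurableT h0).
  rewrite -(integral_trans_occ h fC fq sTt).
  rewrite le_eqVlt; apply/orP; left; apply/eqP; apply: eq_integral => w _.
  by rewrite gee0_abs//; exact: trans_occ_ge0 fq.
have aet : {ae P, forall w, trans_occ q t h (path_at t w) \is a fin_num}.
  by have := integrable_ae measurableT itr; apply: filterS => w; apply.
split; last exact: aet.
split; first exact: measurableT_comp.
split; first exact: io.
- exact: (integrable_fine itr).
- move=> B mB; exists ((fun x => fine (trans_occ q t h x)) @^-1` B); last by rewrite setTI.
  have mft : measurable_fun setT (fun x => fine (trans_occ q t h x)) by exact: measurableT_comp.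
  by rewrite -[X in measurable X]setTI; exact: mft.
- move=> A At; have mA := sigma_at_sub_measurable At.
  rewrite (@ae_eq_integral _ _ _ P A (fun w => trans_occ q t h (path_at t w)))//; last 3 first.
  + apply: measurable_funTS; apply/measurable_EFinP; exact: measurableT_comp.
  + exact: measurable_funTS.
  + by apply: filterS aet => w fw _; rewrite fineK.
  rewrite (integral_trans_occ h fC fq At); apply: ae_eq_integral => //.
  + by apply: measurable_funTS; exact: (measurable_path_occ t h fC).
  + by apply: measurable_funTS; exact: measurable_int io.
  + by apply: filterS aefin => w fw _; rewrite /= fineK.
Qed.

End conditional_time_integral.

Lemma ge0_integral_itv_cat (R : realType) (f : R -> \bar R) (p r q : R) :
  p <= r -> r <= q -> measurable_fun setT f -> (forall x, 0 <= f x)%E ->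
  (\int[lebesgue_measure]_(x in `[p, q]) f x =
   \int[lebesgue_measure]_(x in `[p, r]) f x +
   \int[lebesgue_measure]_(x in `[r, q]) f x)%E.
Proof.
move=> pr rq mf f0.
rewrite -(@integral_itv_obnd_cbnd R r (BRight q)); last exact: measurable_funTS.
rewrite -ge0_integral_setU//=; last 2 first.
- exact: measurable_funTS.
- apply/disj_setPS => x [] /=; rewrite !in_itv/= => /andP[_ xr] /andP[rx _].
  by have := lt_le_trans rx xr; rewrite ltxx.
congr integral; apply/seteqP; split => x /=; rewrite !in_itv/=.
  by move=> /andP[px xq]; case: (leP x r) => xr; [left|right]; rewrite ?px ?xr.
by move=> [/andP[px xr]|/andP[rx xq]]; rewrite ?px ?xq ?(le_trans xr)//= (le_trans pr)// ltW.
Qed.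

Section occupation_rates.
Variables (R : realType) (X : completePseudoMetricType R).
Variables (P : probability (cadlag R X) R) (m : probability (borelType X) R).
Hypothesis P_markov : is_markov P.
Hypothesis P_stationary : is_stationary P m.
Local Notation lambda := (@lebesgue_measure R).
Implicit Types (t r h : R) (w : cadlag R X).
Variables (f : measurableTypeR R * borelType X -> R) (C : R).
Hypothesis fC : is_rate m f C.

Lemma rate_path_measurable w : measurable_fun setT (fun r : R => (f (r, w r))%:E).
Proof.
have [mf _ _ _] := fC.
apply/measurable_EFinP.
have mp : measurable_fun setT (fun r : measurableTypeR R => (r, w) : measurableTypeR R * cadlag R X).
  exact: pair2_measurable.
exact: (measurableT_comp (measurable_path_comp mf) mp).
Qed.

Lemma rate_le (g : measurableTypeR R * borelType X -> R) : measurable_fun setT g -> (forall z, 0 <= g z <= f z) ->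
  is_rate m g C.
Proof.
have [mf f0 fs fB] := fC => mg gf; split => //.
- by move=> z; have /andP[] := gf z.
- by move=> z /fs fz; apply/eqP; rewrite eq_le andbC; have := gf z; rewrite fz.
- move=> r; apply: le_trans (fB r); apply: ge0_le_integral => //.
  + by move=> x _; rewrite lee_fin; have /andP[] := gf (r, x).
  + by apply/measurable_EFinP; apply: (measurableT_comp mg); exact: pair1_measurable.
  + by apply/measurable_EFinP; apply: (measurableT_comp mf); exact: pair1_measurable.
  + by move=> x _; rewrite lee_fin; have /andP[] := gf (r, x).
Qed.

Lemma path_occ_cat t h h' w : 0 <= h -> 0 <= h' ->
  path_occ f t (h + h') w = (path_occ f t h w + path_occ f (t + h) h' w)%E.
Proof.
have [_ f0 _ _] := fC; move=> h0 h'0.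
rewrite /path_occ addrA (@ge0_integral_itv_cat _ _ t (t + h)) ?lerDl//.
  exact: rate_path_measurable.
by move=> r; rewrite lee_fin.
Qed.

Lemma path_occ_gt1 t h w : 1 < t -> path_occ f t h w = 0%E.
Proof.
have [_ _ fs _] := fC; move=> t1; rewrite /path_occ integral0_eq// => r /=.
rewrite in_itv/= => /andP[tr _]; rewrite fs//= => /andP[_ r1].
by have := lt_le_trans t1 (le_trans tr r1); rewrite ltxx.
Qed.

(** The part of the window beyond time [1] contributes nothing, because the rate vanishes there;
    what remains depends on [X_[t, 1]] only. *)
Lemma path_occ_between t h : 0 <= t <= 1 -> forall B : set R, measurable B ->
  sigma_between t 1 ((fun w => fine (path_occ f t h w)) @^-1` B).
Proof.
move=> /andP[t0 t1]; have [mf f0 fs _] := fC.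
pose F (z : measurableTypeR R * borelType X) : \bar R :=
  (f z * \1_(`]-oo, (t + h)]%classic : set R) z.1)%:E.
have mF : measurable_fun setT F.
  apply/measurable_EFinP; apply: measurable_funM => //.
  have m1 : measurable_fun setT (\1_(`]-oo, (t + h)]%classic : set R) : R -> R).
    exact: measurable_indic.
  exact: (measurableT_comp m1 measurable_fst).
have F0 z : (0 <= F z)%E.
  by rewrite lee_fin mulr_ge0//; have /andP[] := indic_ge0_le1 R (`]-oo, (t + h)]%classic : set R) z.1.
have := @measurable_path_integral R X t 1 F t0 mF F0.
move=> mI.
have -> : (fun w => fine (path_occ f t h w)) =
    fine \o (fun w : cadlag R X => (\int[lebesgue_measure]_(s in `[t, 1%R]) F (s, w s))%E).
  apply/funext => w /=; congr fine.
  rewrite /path_occ integral_mkcond [RHS]integral_mkcond; apply: eq_integral => r _.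
  rewrite !patchE /F /= indicE.
  rewrite !mem_setE !in_itv/=; case: (t <= r) => //=.
  case: (leP r 1) => r1; case: (r <= t + h) => //=; rewrite ?mulr1 ?mulr0//.
  by rewrite fs//= => /andP[_ /le_lt_trans/(_ r1)]; rewrite ltxx.
move=> B mB.
have : measurable_fun [set: between_type X t 1]
    (fine \o (fun w => (\int[lambda]_(s in `[t, 1%R]) F (s, w s))%E)).
  exact: measurableT_comp.
by move=> /(_ measurableT B mB); rewrite setTI; exact.
Qed.

Lemma occ_markov q t h : is_transition P f q -> 0 <= t <= 1 -> 0 <= h ->
  is_cond_exp P (sigma_between 0 t) (fun w => fine (path_occ f t h w))
    (fun w => fine (trans_occ q t h (path_at t w))).
Proof.
move=> fq t01 h0.
apply: (@markov_cond_exp R X P P_markov t _ (fun x => fine (trans_occ q t h x)) t01).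
- by move=> w; apply: fine_ge0; exact: path_occ_ge0 fC.
- exact: path_occ_between.
- by have [] := cond_exp_trans_occ P_stationary t fC fq h0.
Qed.

End occupation_rates.

(** * A maximal inequality *)

Lemma measurable_ltr_set d (T : measurableType d) (R : realType) (f g : T -> R) :
  measurable_fun setT f -> measurable_fun setT g -> measurable [set x | f x < g x].
Proof.
move=> mf mg; have /= := measurable_fun_ltr mf mg measurableT (Y := [set true]) I.
rewrite setTI; congr measurable.
Qed.

Section garsia.
Variables (R : realType) (X : completePseudoMetricType R).
Variables (P : probability (cadlag R X) R) (m : probability (borelType X) R).
Hypothesis X_polish : polish X.
Hypothesis P_markov : is_markov P.
Hypothesis P_stationary : is_stationary P m.
Local Notation lambda := (@lebesgue_measure R).
Implicit Types (t r h : R) (w : cadlag R X) (x : borelType X).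
Variables (f : measurableTypeR R * borelType X -> R) (C : R).
Hypothesis fC : is_rate m f C.
Variable q : R -> R -> borelType X -> R.
Hypothesis fq : is_transition P f q.

Lemma trans_occ_mono t h h' x : h <= h' -> (trans_occ q t h x <= trans_occ q t h' x)%E.
Proof.
move=> hh; have [mq q0 _] := fq; apply: ge0_subset_integral => //.
- apply: measurable_funTS; apply/measurable_EFinP.
  have mp : measurable_fun setT
    (fun r : measurableTypeR R => ((t, r), x) : measurableTypeR R * measurableTypeR R * borelType X).
    apply: measurable_fun_pair; last exact: measurable_cst.
    exact: pair1_measurable.
  exact: (measurableT_comp mq mp).
- by move=> r _; rewrite lee_fin.
- by apply: subset_itv; rewrite bnd_simp// lerD2l.
Qed.

Lemma measurable_trans_occ_at t h : measurable_fun setT (trans_occ q t h).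
Proof.
have mp : measurable_fun setT (fun x : borelType X => (t, x) : measurableTypeR R * borelType X).
  exact: pair1_measurable.
exact: (measurableT_comp (measurable_trans_occ h fq) mp).
Qed.

Definition rate_mass r : \bar R := (\int[m]_x (f (r, x))%:E)%E.

Lemma integral_state_trans_occ t h :
  (\int[m]_x trans_occ q t h x = \int[lambda]_(r in `[t, (t + h)%R]) rate_mass r)%E.
Proof.
have [mf f0 _ _] := fC.
rewrite -(ge0_integral_pathT P_stationary t (f := trans_occ q t h)); last 2 first.
- exact: measurable_trans_occ_at.
- by move=> x; exact: trans_occ_ge0 fq.
have sTt : sigma_at t (@setT (cadlag R X)) by exists setT => //; rewrite setTI preimage_setT.
rewrite (integral_trans_occ h fC fq sTt) (integral_path_occ P t h fC measurableT).
apply: eq_integral => r _.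
rewrite (ge0_integral_pathT P_stationary r (f := fun x => (f (r, x))%:E))//.
- by apply/measurable_EFinP; apply: (measurableT_comp mf); exact: pair1_measurable.
- by move=> x; rewrite lee_fin.
Qed.

Variables (l delta : R).
Hypothesis l0 : 0 <= l.
Hypothesis delta0 : 0 < delta.

(** The partial sum of Hopf's lemma for [n] grid steps, each charged [delta * l]: a positive value
    means that the conditional mean of the rate over the window exceeds [l]. *)
Definition excess (n : nat) t x : R :=
  fine (trans_occ q t (n%:R * delta) x) - n%:R * delta * l.

Fixpoint max_excess (n : nat) t x : R :=
  if n is n'.+1 then Num.max (max_excess n' t x) (excess n t x) else 0.

Lemma max_excess_ge0 n t x : 0 <= max_excess n t x.
Proof. by elim: n => //= n IH; rewrite le_max IH. Qed.

Lemma le_max_excess n k t x : (k <= n)%N -> excess k t x <= max_excess n t x.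
Proof.
elim: n => [|n IH]; last first.
  by rewrite leq_eqVlt => /orP[/eqP ->|/IH kn] /=; rewrite le_max ?lexx ?kn ?orbT.
rewrite leqn0 => /eqP -> /=; rewrite /excess !mul0r subr0 /trans_occ addr0.
by rewrite set_itv1 integral_set1.
Qed.

Lemma max_excess_le n t x b : 0 <= b ->
  (forall k, (0 < k <= n)%N -> excess k t x <= b) -> max_excess n t x <= b.
Proof.
move=> b0; elim: n => [//|n IH] hb /=; rewrite ge_max IH ?hb ?leqnn//.
by move=> k /andP[k0 kn]; rewrite hb// k0 ltnW.
Qed.

Lemma max_excess_le_trans_occ n t x :
  ((max_excess n t x)%:E <= trans_occ q t (n%:R * delta) x)%E.
Proof.
have t0 := trans_occ_ge0 t (n%:R * delta) x fq.
case E : (trans_occ q t (n%:R * delta) x) => [b| |]; last by rewrite E in t0.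
- rewrite lee_fin; apply: max_excess_le; first by rewrite -lee_fin -E.
  move=> k /andP[_ kn]; rewrite /excess.
  have kd0 : 0 <= k%:R * delta * l by rewrite !mulr_ge0// ltW.
  apply: (@le_trans _ _ (fine (trans_occ q t (k%:R * delta) x))); first by rewrite gerBl.
  rewrite -[b]/(fine b%:E) -E.
  have le : (trans_occ q t (k%:R * delta) x <= trans_occ q t (n%:R * delta) x)%E.
    by apply: trans_occ_mono; rewrite ler_wpM2r ?ler_nat// ltW.
  apply: fine_le => //; last by rewrite E.
  rewrite ge0_fin_numE; last exact: trans_occ_ge0 fq.
  by apply: le_lt_trans le _; rewrite E ltry.
- by rewrite leey.
Qed.

Lemma measurable_max_excess n :
  measurable_fun setT (fun z : measurableTypeR R * borelType X => max_excess n z.1 z.2).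
Proof.
elim: n => [|n IH] /=; first exact: measurable_cst.
apply: measurable_maxr => //; apply: measurable_funB; last exact: measurable_cst.
by apply: measurableT_comp => //; exact: (measurable_trans_occ _ fq).
Qed.

Lemma measurable_max_excess_at n t : measurable_fun setT (max_excess n t).
Proof.
have mp : measurable_fun setT (fun x : borelType X => (t, x) : measurableTypeR R * borelType X).
  exact: pair1_measurable.
exact: (measurableT_comp (measurable_max_excess n) mp).
Qed.

Lemma integrable_max_excess n t :
  P.-integrable setT (fun w => (max_excess n t (path_at t w))%:E).
Proof.
have nd0 : 0 <= n%:R * delta by rewrite mulr_ge0// ltW.
have sTt : sigma_at t (@setT (cadlag R X)) by exists setT => //; rewrite setTI preimage_setT.
apply/integrableP; split.
  apply/measurable_EFinP; apply: (measurableT_comp (measurable_max_excess_at n t)).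
  exact: measurable_path_at_all.
apply: (@le_lt_trans _ _ (C * (n%:R * delta))%:E); last exact: ltry.
apply: le_trans (integral_path_occ_le P_stationary t fC measurableT nd0).
rewrite -(integral_trans_occ (n%:R * delta) fC fq sTt).
apply: ge0_le_integral => //.
- do 2! apply: measurableT_comp => //.
  apply: (measurableT_comp (measurable_max_excess_at n t)).
  exact: measurable_path_at_all.
- apply: (measurableT_comp (measurable_trans_occ_at t _)).
  exact: measurable_path_at_all.
- move=> w _; rewrite gee0_abs ?lee_fin ?max_excess_ge0//.
  exact: max_excess_le_trans_occ.
Qed.

(** After time [1] the rate vanishes and, up to null sets, no excess is positive any more: the
    maximum is replaced by [0]. *)
Definition future_excess n t w : R :=
  if t + delta <= 1 then max_excess n (t + delta) (path_at (t + delta) w) else 0.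

(** [y] is the conditional mean given [X_t] of the maximum one step later. The occupation over
    [k + 1] steps less that over the first step is the occupation over [k] steps from [t + delta]
    on; by the Markov property its conditional mean at time [t + delta] is [excess k] plus
    [k * delta * l], at most the maximum plus that amount. *)
Lemma garsia_version n t : 0 <= t <= 1 -> exists y : borelType X -> R,
  [/\ cond_exp_at P t (future_excess n t) y, {ae P, forall w, 0 <= y (path_at t w)} &
   forall k, (k <= n)%N -> {ae P, forall w,
     fine (trans_occ q t (k.+1%:R * delta) (path_at t w)) -
     fine (trans_occ q t delta (path_at t w)) <= y (path_at t w) + k%:R * delta * l}].
Proof.
move=> /andP[t0 t1]; have sG := sigma_algebra_at X t; have GM := @sigma_at_sub_measurable R X t.
have d0 := ltW delta0.
have iF : P.-integrable setT (EFin \o future_excess n t).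
  rewrite /future_excess; case: (t + delta <= 1); first exact: integrable_max_excess.
  exact: integrable0.
have [y hy] := cond_exp_at_exists X_polish P_stationary t iF.
exists y; split => //.
  apply: (is_cond_exp_ge0 sG GM _ hy.2) => w.
  by rewrite /future_excess; case: ifP => // _; exact: max_excess_ge0.
move=> k kn.
have kd0 : 0 <= k%:R * delta by rewrite mulr_ge0.
have kd1 : 0 <= k.+1%:R * delta by rewrite mulr_ge0.
have [[_ ceH] _] := cond_exp_trans_occ P_stationary t fC fq kd1.
have [[_ ce1] _] := cond_exp_trans_occ P_stationary t fC fq d0.
have [_ aek] := integrable_path_occ P_stationary (t + delta) fC kd0.
have [_ ae1] := integrable_path_occ P_stationary t fC d0.
have ceD := is_cond_expB sG GM ceH ce1.
have mo := measurable_path_occ (t + delta) (k%:R * delta) fC.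
have {}ceD : is_cond_exp P (sigma_at t)
    (fun w => fine (path_occ f (t + delta) (k%:R * delta) w))
    (fun w => fine (trans_occ q t (k.+1%:R * delta) (path_at t w)) -
              fine (trans_occ q t delta (path_at t w))).
  apply: (is_cond_exp_ae GM ceD); first exact: measurableT_comp.
  apply: filterS2 aek ae1 => w fk f1.
  have -> : k.+1%:R * delta = delta + k%:R * delta by rewrite -natr1; ring.
  by rewrite (path_occ_cat fC)// fineD// addrAC subrr add0r.
have ceK : is_cond_exp P (sigma_at t)
    (fun w => future_excess n t w + k%:R * delta * l)
    (fun w => y (path_at t w) + k%:R * delta * l).
  apply: (is_cond_expD sG GM hy.2).
  have ic : P.-integrable setT (EFin \o cst (k%:R * delta * l : R)).
    exact: finite_measure_integrable_cst.
  split => //; move=> B mB; rewrite preimage_cst; case: ifP => _.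
    by exists setT => //; rewrite setTI preimage_setT.
  by exists set0 => //; rewrite setTI preimage_set0.
have [t1d|t1d] := leP (t + delta) 1; last first.
  apply: (is_cond_exp_ae_le sG GM ceD ceK); apply: aeW => w.
  rewrite (path_occ_gt1 fC)//= /future_excess (leNgt (t + delta)) t1d /=.
  by rewrite add0r mulr_ge0.
have td01 : 0 <= t + delta <= 1 by rewrite t1d addr_ge0.
have GH : @sigma_at R X t `<=` sigma_between 0 (t + delta).
  by apply: sigma_at_between; rewrite t0 lerDl.
have ceT := is_cond_exp_tower GH (occ_markov P_markov P_stationary fC fq td01 kd0) ceD.
apply: (is_cond_exp_ae_le sG GM ceT ceK); apply: aeW => w.
rewrite /future_excess t1d -lerBlDr.
exact: le_max_excess.
Qed.

(* Garsia's argument for the maximal ergodic lemma, with [n] fixed on both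
   sides. *)
Lemma garsia_at n t : 0 <= t <= 1 ->
  (\int[m]_x (max_excess n t x)%:E +
   (delta * l)%:E * m [set x | (0 < max_excess n t x)%R] <=
   \int[m]_x trans_occ q t delta x + 
   if (t + delta <= 1)%R then \int[m]_x (max_excess n (t + delta) x)%:E else 0)%E.
Proof.
move=> t01; have [y [hy y0 yk]] := garsia_version n t01.
have d0 := ltW delta0.
have [iY iy _ hint] := hy.2.
have sTt : sigma_at t (@setT (cadlag R X)) by exists setT => //; rewrite setTI preimage_setT.
pose y' x := Num.max (y x) 0.
have mpt := @measurable_path_at_all R X t.
have my' : measurable_fun setT y' by apply: measurable_maxr => //; exact: hy.1.
have mmt := measurable_max_excess_at n t.
have Iy : (\int[P]_w (y' (path_at t w))%:E =
    if (t + delta <= 1)%R then \int[m]_x (max_excess n (t + delta) x)%:E else 0)%E.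
  transitivity (\int[P]_w (y (path_at t w))%:E)%E.
    apply: ae_eq_integral => //.
    - by apply/measurable_EFinP; exact: (measurableT_comp my' mpt).
    - exact: measurable_int iy.
    - by apply: filterS y0 => w wy _; congr EFin; exact/max_idPl.
  rewrite (hint setT sTt) /future_excess; case: ifP => _; last exact: integral0.
  rewrite -(ge0_integral_pathT P_stationary (t + delta)
    (f := fun x => (max_excess n (t + delta) x)%:E))//.
  - by apply/measurable_EFinP; exact: measurable_max_excess_at.
  - by move=> x; rewrite lee_fin max_excess_ge0.
rewrite -Iy.
pose E := [set x | 0 < max_excess n t x].
have mE : measurable E.
  by apply: measurable_ltr_set => //; exact: measurable_cst.
have -> : (\int[m]_x (max_excess n t x)%:E + (delta * l)%:E * m E =
    \int[P]_w (max_excess n t (path_at t w) + delta * l * \1_E (path_at t w))%:E)%E.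
  rewrite (ge0_integral_pathT P_stationary t
    (f := fun x => (max_excess n t x + delta * l * \1_E x)%:E)); last 2 first.
  - apply/measurable_EFinP; apply: measurable_funD => //; apply: measurable_funM => //.
  - move=> x; rewrite lee_fin addr_ge0 ?max_excess_ge0//.
    by rewrite !mulr_ge0//; have /andP[] := indic_ge0_le1 R E x.
  under [RHS]eq_integral do rewrite EFinD EFinM.
  rewrite ge0_integralD//=; last 4 first.
  - by move=> x _; rewrite lee_fin max_excess_ge0.
  - exact/measurable_EFinP.
  - move=> x _; rewrite -EFinM lee_fin !mulr_ge0//; by have /andP[] := indic_ge0_le1 R E x.
  - by apply/measurable_EFinP; apply: measurable_funM => //.
  rewrite ge0_integralZl//=; last 2 first.
  - by apply/measurable_EFinP.
  - by rewrite lee_fin mulr_ge0.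
  by rewrite integral_indic// setIT.
have -> : (\int[m]_x trans_occ q t delta x + \int[P]_w (y' (path_at t w))%:E =
    \int[P]_w (trans_occ q t delta (path_at t w) + (y' (path_at t w))%:E))%E.
  rewrite [RHS]ge0_integralD//; last 4 first.
  - by move=> w _; exact: trans_occ_ge0 fq.
  - exact: (measurableT_comp (measurable_trans_occ_at t delta) mpt).
  - by move=> w _; rewrite lee_fin le_max lexx orbT.
  - by apply/measurable_EFinP; exact: (measurableT_comp my' mpt).
  rewrite (ge0_integral_pathT P_stationary t (f := trans_occ q t delta))//.
  - exact: measurable_trans_occ_at.
  - by move=> x; exact: trans_occ_ge0 fq.
have [_ fin1] := cond_exp_trans_occ P_stationary t fC fq d0.
have yk' : {ae P, forall w, forall k, (k <= n)%N ->
     fine (trans_occ q t (k.+1%:R * delta) (path_at t w)) -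
     fine (trans_occ q t delta (path_at t w)) <= y (path_at t w) + k%:R * delta * l}.
  apply: ae_foralln => k; case: (leqP k n) => kn; last exact: aeW.
  by have := yk k kn; apply: filterS.
apply: ae_ge0_le_integral => //.
- move=> w _; rewrite lee_fin addr_ge0 ?max_excess_ge0//.
  by rewrite !mulr_ge0//; have /andP[] := indic_ge0_le1 R E (path_at t w).
- have ms : measurable_fun setT (fun x => (max_excess n t x + delta * l * \1_E x)%:E).
    by apply/measurable_EFinP; apply: measurable_funD => //; exact: measurable_funM.
  exact: (measurableT_comp ms mpt).
- by move=> w _; rewrite adde_ge0 ?lee_fin ?le_max ?lexx ?orbT//; exact: trans_occ_ge0 fq.
- apply: emeasurable_funD.
    exact: (measurableT_comp (measurable_trans_occ_at t delta) mpt).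
  by apply/measurable_EFinP; exact: (measurableT_comp my' mpt).
- apply: filterS3 fin1 y0 yk' => w fw yw kw _.
  set x := path_at t w; rewrite -[trans_occ _ _ _ _]fineK// -EFinD lee_fin.
  have t0 : 0 <= fine (trans_occ q t delta x) by apply: fine_ge0; exact: trans_occ_ge0 fq.
  rewrite /y' (max_idPl yw) indicE.
  (* An excess of index [k >= 1] is at most the first step plus [y] minus [delta * l]. Where the
     maximum is positive it is attained at such an index, the one of index [0] being [0]: this
     produces the term [delta * l] on [E]. Elsewhere the maximum is [0] and the right side is
     nonnegative. *)
  have bound k b : fine (trans_occ q t delta x) + y x - delta * l <= b ->
      (0 < k <= n)%N -> excess k t x <= b.
    move=> hb; case: k => [//|k] /andP[_ kn]; apply: le_trans hb; rewrite /excess.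
    have := kw k (ltnW kn); rewrite -/x.
    have -> : k.+1%:R * delta * l = k%:R * delta * l + delta * l by rewrite -natr1; ring.
    rewrite !lerBlDr => /le_trans; apply; rewrite le_eqVlt; apply/orP; left.
    by apply/eqP; ring.
  case: (boolP (x \in E)) => [|/negP]; rewrite inE /E /= => M0.
    rewrite mulr1 -lerBrDr.
    have [b0|b0] := leP 0 (fine (trans_occ q t delta x) + y x - delta * l); last first.
      suff : max_excess n t x <= 0 by rewrite leNgt M0.
      by apply: max_excess_le => // k; apply: bound; exact: ltW.
    by apply: max_excess_le => // k; exact: bound.
  rewrite mulr0 addr0 (le_trans _ (addr_ge0 t0 yw))// leNgt; exact/negP.
Qed.
End garsia.

(** By Tonelli: each [r] lies in the windows that start in [[r - h, r]], an interval of length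
    [h]. *)
Lemma ge0_integral_window (R : realType) (phi : R -> \bar R) (h : R) : 0 <= h ->
  measurable_fun setT phi -> (forall r, 0 <= phi r)%E ->
  (\int[lebesgue_measure]_t \int[lebesgue_measure]_(r in `[t, (t + h)%R]) phi r =
   h%:E * \int[lebesgue_measure]_r phi r)%E.
Proof.
move=> h0 mphi phi0.
pose D : set (measurableTypeR R * measurableTypeR R) :=
  [set z | z.1 <= z.2] `&` [set z | z.2 <= z.1 + h].
have mD : measurable D.
  apply: measurableI.
    by rewrite -[X in measurable X]setTI; exact: measurable_fun_le.
  rewrite -[X in measurable X]setTI; apply: measurable_fun_le => //.
  by apply: measurable_funD.
pose F := ((fun z : measurableTypeR R * measurableTypeR R => phi z.2) \_ D).
have mF : measurable_fun setT F.
  apply/(measurable_restrictT _ mD); apply: measurable_funTS.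
  exact: (measurableT_comp (mphi : measurable_fun [set: measurableTypeR R] phi) measurable_snd).
have F0 z : (0 <= F z)%E by rewrite /F patchE; case: ifP.
have FE1 t : (\int[lebesgue_measure]_(r in `[t, (t + h)%R]) phi r =
    \int[lebesgue_measure]_r F (t, r))%E.
  rewrite integral_mkcond; apply: eq_integral => r _.
  rewrite /F !patchE; congr (if _ then _ else _).
  by apply/idP/idP; rewrite !inE /D /= in_itv/= => /andP.
have FE2 r : (\int[lebesgue_measure]_t F (t, r) = h%:E * phi r)%E.
  transitivity (\int[lebesgue_measure]_(t in `[(r - h)%R, r]) phi r)%E.
    rewrite [RHS]integral_mkcond; apply: eq_integral => t _.
    rewrite /F !patchE; congr (if _ then _ else _).
    apply/idP/idP; rewrite !inE /D /= in_itv/= lerBlDr => -[].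
      by move=> -> ->.
    by move=> /andP[-> ->].
  rewrite integral_cst//= lebesgue_measure_itv/= lte_fin gtrBl.
  move: h0; rewrite le_eqVlt => /orP[/eqP <-|h0]; first by rewrite ltxx mule0 mul0e.
  by rewrite h0 -EFinB opprB addrC subrK muleC.
under eq_integral do rewrite FE1.
have := @fubini_tonelli _ _ _ _ R (@lebesgue_measure R) (@lebesgue_measure R) F mF F0.
rewrite /fubini_F => ->.
under eq_integral do rewrite FE2.
by rewrite ge0_integralZl.
Qed.

Section weak_type.
Variables (R : realType) (X : completePseudoMetricType R).
Variables (P : probability (cadlag R X) R) (m : probability (borelType X) R).
Hypothesis X_polish : polish X.
Hypothesis P_markov : is_markov P.
Hypothesis P_stationary : is_stationary P m.
Local Notation lambda := (@lebesgue_measure R).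
Implicit Types (t r h : R) (w : cadlag R X) (x : borelType X).
Variables (f : measurableTypeR R * borelType X -> R) (C : R).
Hypothesis fC : is_rate m f C.
Variable q : R -> R -> borelType X -> R.
Hypothesis fq : is_transition P f q.

Lemma measurable_rate_mass : measurable_fun setT (rate_mass m f).
Proof.
have [mf f0 _ _] := fC.
have mF : measurable_fun setT (EFin \o f) by exact/measurable_EFinP.
exact: (@measurable_fun_fubini_tonelli_F _ _ _ _ _ m (EFin \o f) mF (fun z => f0 z)).
Qed.

Lemma rate_mass_ge0 r : (0 <= rate_mass m f r)%E.
Proof. by have [_ f0 _ _] := fC; apply: integral_ge0 => x _; rewrite lee_fin. Qed.

Lemma integral_rate_mass_lt :
  (\int[lambda]_r rate_mass m f r < +oo)%E.
Proof.
have [_ f0 fs fB] := fC.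
have C0 : 0 <= C by rewrite -lee_fin (le_trans _ (fB 0))// rate_mass_ge0.
apply: (@le_lt_trans _ _ (\int[lambda]_(r in `[0%R, 1%R]) C%:E)%E).
  rewrite [leRHS]integral_mkcond; apply: ge0_le_integral => //.
  - by move=> r _; exact: rate_mass_ge0.
  - exact: measurable_rate_mass.
  - by apply/(measurable_restrictT _ (measurable_itv _)); exact: measurable_cst.
  - move=> r _; rewrite patchE; case: ifPn => [_|]; first exact: fB.
    rewrite mem_setE in_itv/= => /negP r01.
    by rewrite /rate_mass integral0_eq// => x _; rewrite fs.
by rewrite integral_cst//= lebesgue_measure_itv/= lte_fin ltr01 oppr0 adde0 mule1 ltry.
Qed.

(** Integrate [garsia_at] over [t]. The maxima, extended by [0] outside [[0, 1]], contribute the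
    same integral to both sides by translation invariance and cancel, since this integral is finite.
    There remains [delta * l] times the measure of the exceedance set, against [delta] times the
    total mass. *)
Lemma weak_type_step (l delta : R) n : 0 < l -> 0 < delta ->
  (l%:E * \int[lambda]_(t in `[0%R, 1%R]) m [set x | (0 < max_excess q l delta n t x)%R]
   <= \int[lambda]_r rate_mass m f r)%E.
Proof.
move=> l0 d0.
pose M t x := max_excess q l delta n t x.
have M0 t x : 0 <= M t x := max_excess_ge0 q l delta n t x.
pose e := (fun t => \int[m]_x (M t x)%:E)%E \_ `[0%R, 1%R].
pose a := (fun t => m [set x | (0 < M t x)%R]) \_ `[0%R, 1%R].
have mI : measurable (`[0%R, 1%R]%classic : set R) by exact: measurable_itv.
have mM := measurable_max_excess fq l delta n.
have me : measurable_fun setT e.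
  apply/(measurable_restrictT _ mI); apply: measurable_funTS.
  have mF : measurable_fun setT (EFin \o (fun z : measurableTypeR R * borelType X => M z.1 z.2)).
    exact/measurable_EFinP.
  exact: (@measurable_fun_fubini_tonelli_F _ _ _ _ _ m _ mF (fun z => M0 _ _)).
have ma : measurable_fun setT a.
  apply/(measurable_restrictT _ mI); apply: measurable_funTS.
  pose A : set (measurableTypeR R * borelType X) := [set z | 0 < M z.1 z.2].
  have mA : measurable A by apply: measurable_ltr_set => //; exact: measurable_cst.
  have := measurable_fun_xsection m mA.
  by congr measurable_fun; apply/funext => t /=; congr (m _); apply/seteqP; split => x;
    rewrite /xsection/= inE.
have e0 t : (0 <= e t)%E.
  by rewrite /e patchE; case: ifP => // _; apply: integral_ge0 => x _; rewrite lee_fin.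
have a0 t : (0 <= a t)%E by rewrite /a patchE; case: ifP.
pose I := (\int[lambda]_r rate_mass m f r)%E.
have mH h : 0 <= h -> (\int[lambda]_t \int[m]_x trans_occ q t h x = h%:E * I)%E.
  move=> h0; under eq_integral do rewrite (integral_state_trans_occ P_stationary fC fq).
  rewrite ge0_integral_window//; first exact: measurable_rate_mass.
  exact: rate_mass_ge0.
have mHm h : measurable_fun setT (fun t => \int[m]_x trans_occ q t h x)%E.
  exact: (@measurable_fun_fubini_tonelli_F _ _ _ _ _ m _ (measurable_trans_occ h fq)
    (fun z => trans_occ_ge0 _ _ _ fq)).
have H0 h t : (0 <= \int[m]_x trans_occ q t h x)%E.
  by apply: integral_ge0 => x _; exact: trans_occ_ge0 fq.
have Ifin : I \is a fin_num.
  rewrite ge0_fin_numE; first exact: integral_rate_mass_lt.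
  by apply: integral_ge0 => r _; exact: rate_mass_ge0.
have efin : (\int[lambda]_t e t)%E \is a fin_num.
  rewrite ge0_fin_numE; last by apply: integral_ge0.
  apply: (@le_lt_trans _ _ ((n%:R * delta)%:E * I)%E); last first.
    by rewrite -(fineK Ifin) -EFinM ltry.
  rewrite -mH; last by rewrite mulr_ge0// ltW.
  apply: ge0_le_integral => //; first exact: mHm.
  move=> t _; rewrite /e patchE; case: ifP => // _.
  apply: ge0_le_integral => //.
  - by move=> x _; rewrite lee_fin.
  - by apply/measurable_EFinP; exact: (measurable_max_excess_at fq).
  - exact: (measurable_trans_occ_at fq).
  - by move=> x _; exact: (max_excess_le_trans_occ fq (ltW l0) d0).
have step t : (e t + (delta * l)%:E * a t <= \int[m]_x trans_occ q t delta x + e (t + delta)%R)%E.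
  have := e0 (t + delta); rewrite /e /a !patchE !mem_setE !in_itv/= => ed.
  case: ifPn => [t01|_]; last by rewrite mule0 add0e adde_ge0.
  apply: le_trans (garsia_at X_polish P_markov P_stationary fC fq (ltW l0) d0 n t01) _.
  rewrite leeD2l//; case: (t + delta <= 1); rewrite ?andbF//.
  by have /andP[t0 _] := t01; rewrite addr_ge0 ?(ltW d0).
have : (\int[lambda]_t e t + (delta * l)%:E * \int[lambda]_t a t <=
        delta%:E * I + \int[lambda]_t e t)%E.
  rewrite -(mH delta (ltW d0)) -{2}(ge0_integral_translation delta me e0).
  rewrite -ge0_integralZl//; last by rewrite lee_fin mulr_ge0// ltW.
  have med : measurable_fun setT (fun t => e (t + delta)%R).
    by apply: (measurableT_comp me); exact: measurable_funD.
  rewrite -ge0_integralD//; last 2 first.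
  - by move=> s _; rewrite mule_ge0// lee_fin mulr_ge0// ltW.
  - exact: measurable_funeM.
  rewrite -ge0_integralD//; last exact: mHm.
  apply: ge0_le_integral => //.
  - by move=> s _; rewrite adde_ge0// mule_ge0// lee_fin mulr_ge0// ltW.
  - by apply: emeasurable_funD => //; exact: measurable_funeM.
  - by apply: emeasurable_funD => //; exact: mHm.
rewrite addeC leeD2rE// EFinM -muleA lee_pmul2l ?fin_numE//.
by rewrite /a -integral_mkcond.
Qed.

End weak_type.

Section maximal_inequality.
Variables (R : realType) (X : completePseudoMetricType R).
Variables (P : probability (cadlag R X) R) (m : probability (borelType X) R).
Hypothesis X_polish : polish X.
Hypothesis P_markov : is_markov P.
Hypothesis P_stationary : is_stationary P m.
Local Notation lambda := (@lebesgue_measure R).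
Implicit Types (t r h l : R) (w : cadlag R X) (x : borelType X).
Implicit Types (z : measurableTypeR R * borelType X).

Definition mean_occ (q : R -> R -> borelType X -> R) (k : nat) z : R :=
  k.+1%:R * fine (trans_occ q z.1 k.+1%:R^-1 z.2).

Variables (f : measurableTypeR R * borelType X -> R) (C : R).
Hypothesis fC : is_rate m f C.
Variable q : R -> R -> borelType X -> R.
Hypothesis fq : is_transition P f q.

Lemma mean_occ_ge0 k z : 0 <= mean_occ q k z.
Proof. by rewrite mulr_ge0//; apply: fine_ge0; exact: trans_occ_ge0 fq. Qed.

Lemma measurable_mean_occ k : measurable_fun setT (mean_occ q k).
Proof.
apply: measurable_funM; first exact: measurable_cst.
by apply: measurableT_comp => //; exact: (measurable_trans_occ _ fq).
Qed.

Lemma measurable_I01X : measurable (@I01X R X).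
Proof. by apply: measurableX => //; exact: measurable_itv. Qed.

(** For [k < K] the window [1 / (k + 1)] consists of a whole number of steps [1 / K!], so
    [weak_type_step] with this step and [n = K!] controls the first [K] windows at once, with a
    bound independent of [K]; continuity from below lets [K] grow. *)
Lemma maximal_inequality l : 0 < l ->
  (l%:E * (lambda \x m)%E (@I01X R X `&` [set z | exists k, (l < mean_occ q k z)%R])
   <= \int[lambda]_r rate_mass m f r)%E.
Proof.
move=> l0.
pose W K : set (measurableTypeR R * borelType X) :=
  @I01X R X `&` \bigcup_(k in `I_K) [set z | l < mean_occ q k z].
have mW K : measurable (W K).
  apply: measurableI; first exact: measurable_I01X.
  apply: bigcup_measurable => k _.
  by apply: measurable_ltr_set; [exact: measurable_cst|exact: measurable_mean_occ].
have WE : @I01X R X `&` [set z | exists k, l < mean_occ q k z] = \bigcup_K W K.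
  apply/seteqP; split => z.
    by move=> [Iz [k hk]]; exists k.+1 => //; split => //; exists k => //=.
  by move=> [K _ [Iz [k _ hk]]]; split => //; exists k.
have W_le K : ((lambda \x m)%E (W K) <= \int[lambda]_r rate_mass m f r * l^-1%:E)%E.
  have N0 : 0 < (K`!%:R : R) by rewrite ltr0n fact_gt0.
  have d0 : 0 < (K`!%:R : R)^-1 by rewrite invr_gt0.
  have := weak_type_step X_polish P_markov P_stationary fC fq K`! l0 d0.
  rewrite muleC -lee_pdivlMr// => /(le_trans _); apply.
  rewrite /product_measure1 [leRHS]integral_mkcond.
  apply: ge0_le_integral => //.
  - exact: measurable_fun_xsection.
  - apply/(measurable_restrictT _ (measurable_itv _)); apply: measurable_funTS.
    pose A : set (measurableTypeR R * borelType X) :=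
      [set z | 0 < max_excess q l K`!%:R^-1 K`! z.1 z.2].
    have mA : measurable A.
      apply: measurable_ltr_set; first exact: measurable_cst.
      exact: (measurable_max_excess fq).
    have := measurable_fun_xsection m mA.
    by congr measurable_fun; apply/funext => t /=; congr (m _); apply/seteqP; split => x;
      rewrite /xsection/= inE.
  - move=> t _ /=; rewrite patchE mem_setE in_itv/=; case: ifPn => t01; last first.
      rewrite (_ : xsection _ _ = set0) ?measure0//.
      apply/seteqP; split => x //; rewrite /xsection/= inE => -[[]] /=.
      by rewrite in_itv/= (negbTE t01).
    apply: le_measure; rewrite ?inE.
    + exact: measurable_xsection.
    + apply: measurable_ltr_set; first exact: measurable_cst.
      exact: (measurable_max_excess_at fq).
    + move=> x; rewrite /xsection/= inE => -[_ [k kK]] /=.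
      rewrite /mean_occ/= => hk.
      have kd : (k.+1 %| K`!)%N by rewrite dvdn_fact//.
      set n := (K`! %/ k.+1)%N.
      have nE : (k.+1%:R : R)^-1 = n%:R * K`!%:R^-1.
        rewrite -[in RHS](divnK kd) -/n natrM invfM mulrA mulfV ?mul1r//.
        by rewrite pnatr_eq0 -lt0n divn_gt0// dvdn_leq// fact_gt0.
      apply: lt_le_trans (le_max_excess q l K`!%:R^-1 t x (leq_div K`! k.+1)).
      rewrite /excess -nE subr_gt0.
      by rewrite mulrC ltr_pdivrMr// mulrC.
rewrite muleC -lee_pdivlMr// WE.
have cv := @nondecreasing_cvg_mu _ _ _ (lambda \x m)%E W mW (bigcupT_measurable _ mW).
rewrite -(cvg_lim (@ereal_hausdorff R) (cv _)); last first.
  move=> a b ab; apply/subsetPset => z [Iz [k ka hk]]; split => //; exists k => //=.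
  exact: leq_trans ka ab.
apply: lime_le; last by apply: nearW.
apply/cvg_ex; eexists; apply: cv.
move=> a b ab; apply/subsetPset => z [Iz [k ka hk]]; split => //; exists k => //=.
exact: leq_trans ka ab.
Qed.

End maximal_inequality.

(** * Differentiation of conditional means *)

Section almost_everywhere_convergence.
Context d (T : measurableType d) (R : realType).

(** Membership for some threshold [1 / (i + 1)] is failure of convergence: almost everywhere
    convergence becomes the nullity of countably many measurable sets. *)
Definition recurrent_dev (u : nat -> T -> R) (v : T -> R) (e : R) : set T :=
  [set z | forall n, exists2 k, (n <= k)%N & e < `|u k z - v z|].

Implicit Types (u : nat -> T -> R) (v : T -> R).

Lemma measurable_deviation u v e n :
  (forall k, measurable_fun setT (u k)) -> measurable_fun setT v ->
  measurable [set z | exists2 k, (n <= k)%N & e < `|u k z - v z|].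
Proof.
move=> mu mv.
rewrite (_ : [set _ | _] = \bigcup_(k in [set k | (n <= k)%N]) [set z | e < `|u k z - v z|]).
  apply: bigcup_measurable => k _; apply: measurable_ltr_set; first exact: measurable_cst.
  by apply: measurableT_comp => //; exact: measurable_funB.
by apply/seteqP; split => z [k nk hk]; exists k.
Qed.

Lemma measurable_recurrent_dev u v e :
  (forall k, measurable_fun setT (u k)) -> measurable_fun setT v ->
  measurable (recurrent_dev u v e).
Proof.
move=> mu mv.
rewrite (_ : recurrent_dev u v e =
    \bigcap_n [set z | exists2 k, (n <= k)%N & e < `|u k z - v z|]).
  by apply: bigcapT_measurable => n; exact: measurable_deviation.
by apply/seteqP; split => z hz n; [move=> _|]; exact: hz.
Qed.

Lemma cvg_recurrent_dev u v e z : 0 < e -> u k z @[k --> \oo] --> v z ->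
  ~ recurrent_dev u v e z.
Proof.
move=> e0 /cvgrPdist_le/(_ e e0)[N _ hN] /(_ N)[k Nk].
by rewrite ltNge distrC hN.
Qed.

Lemma cvg_not_recurrent_dev u v z :
  (forall i, ~ recurrent_dev u v i.+1%:R^-1 z) -> u k z @[k --> \oo] --> v z.
Proof.
move=> h; apply/cvgrPdist_le => e e0.
have [i ie] : exists i, i.+1%:R^-1 <= e.
  by have [i _ /(_ i)/= hi] := near_infty_natSinv_lt (PosNum e0); exists i; rewrite ltW// hi.
have /existsNP[N hN] := h i.
exists N => // k /= Nk; rewrite distrC leNgt; apply/negP => ek.
by apply: hN; exists k => //; exact: le_lt_trans ek.
Qed.

End almost_everywhere_convergence.

(** By Tonelli, both integrals of the indicator of [A] vanish. This turns a statement for every path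
    and almost every time into one for almost every time and almost every path. *)
Lemma ae_swap d1 d2 (T1 : measurableType d1) (T2 : measurableType d2) (R : realType)
    (m1 : {sigma_finite_measure set T1 -> \bar R})
    (m2 : {sigma_finite_measure set T2 -> \bar R}) (A : set (T1 * T2)) :
  measurable A -> (forall y, m1 [set x | A (x, y)] = 0%E) ->
  {ae m1, forall x, m2 [set y | A (x, y)] = 0%E}.
Proof.
move=> mA h.
have mA1 : measurable_fun setT (EFin \o (\1_A : T1 * T2 -> R)).
  by apply/measurable_EFinP; exact: measurable_indic.
have A0 z : (0 <= (EFin \o (\1_A : T1 * T2 -> R)) z)%E.
  by rewrite /= lee_fin; have /andP[] := indic_ge0_le1 R A z.
have sec1 x : (\int[m2]_y (\1_A (x, y))%:E)%E = m2 [set y | A (x, y)].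
  have mAx : measurable [set y | A (x, y)].
    by rewrite (_ : [set _ | _] = xsection A x); [exact: measurable_xsection|
      apply/seteqP; split => y; rewrite /xsection/= inE].
  rewrite -(setIT [set y | A (x, y)]) -(@integral_indic _ _ _ m2 setT)//.
have sec2 y : (\int[m1]_x (\1_A (x, y))%:E)%E = m1 [set x | A (x, y)].
  have mAy : measurable [set x | A (x, y)].
    by rewrite (_ : [set _ | _] = ysection A y); [exact: measurable_ysection|
      apply/seteqP; split => x; rewrite /ysection/= inE].
  rewrite -(setIT [set x | A (x, y)]) -(@integral_indic _ _ _ m1 setT)//.
have I0 : (\int[m1]_x m2 [set y | A (x, y)] = 0)%E.
  under eq_integral do rewrite -sec1.
  rewrite (@tonelli_in _ _ _ _ R m1 m2 setT setT (EFin \o \1_A))//.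
  by rewrite integral0_eq// => y _; rewrite sec2 h.
have mm : measurable_fun setT (fun x => m2 [set y | A (x, y)]).
  have := measurable_fun_xsection m2 mA.
  by congr measurable_fun; apply/funext => x /=; congr (m2 _); apply/seteqP; split => y;
    rewrite /xsection/= inE.
have := (ae_eq_integral_abs m1 measurableT mm).1.
under eq_integral do rewrite gee0_abs//.
by move=> /(_ I0); apply: filterS => x; apply.
Qed.

(* Conditional bounded convergence: for [k >= n], [`|Z k - F|] is at most
   [e + B * E[1_(A n) | G]] where [A n] is the event that
   [`|Y k - F| > e] for some [k >= n]. *)
Lemma cond_bounded_cvg d (T : measurableType d) (R : realType) (P : probability T R)
    (G : set (set T)) (Y Z : nat -> T -> R) (F : T -> R) (B : R) :
  sigma_algebra setT G -> G `<=` measurable ->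
  (forall W, P.-integrable setT (EFin \o W) -> exists W', is_cond_exp P G W W') ->
  (forall k, is_cond_exp P G (Y k) (Z k)) -> is_cond_exp P G F F ->
  (forall k w, `|Y k w - F w| <= B) ->
  {ae P, forall w, Y k w @[k --> \oo] --> F w} ->
  {ae P, forall w, Z k w @[k --> \oo] --> F w}.
Proof.
move=> sG GM ex YZ FF YB cvY.
have mY k : measurable_fun setT (Y k).
  by have [/measurable_int/measurable_EFinP] := YZ k.
have mZ k : measurable_fun setT (Z k).
  by have [_ /measurable_int/measurable_EFinP] := YZ k.
have mF : measurable_fun setT F by have [/measurable_int/measurable_EFinP] := FF.
suff h i : P (recurrent_dev Z F i.+1%:R^-1) = 0%E.
  have : {ae P, forall w, forall i, ~ recurrent_dev Z F i.+1%:R^-1 w}.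
    apply: ae_foralln => i; exists (recurrent_dev Z F i.+1%:R^-1); split; last 1 first.
    - by move=> w /= /contrapT.
    - exact: measurable_recurrent_dev.
    - exact: h.
  by apply: filterS => w; exact: cvg_not_recurrent_dev.
(* Half the threshold: if [|Z k - F|] exceeds [2 * e] and is at most [e + B * a], then [B * a]
   exceeds [e], and integration bounds [e] times the probability of the event by [B * P (A n)]. *)
pose e : R := i.+1%:R^-1 / 2.
have e0 : 0 < e by rewrite divr_gt0 ?invr_gt0.
pose A n := [set w | exists2 k, (n <= k)%N & e < `|Y k w - F w|].
have mA n : measurable (A n) by exact: measurable_deviation.
have B0 : 0 <= B by exact: le_trans (YB 0%N point).
have PA : P (A n) @[n --> \oo] --> 0%E.
  have <- : P (\bigcap_n A n) = 0%E.
    apply/eqP; rewrite -measure_le0; have [N [mN PN hN]] := cvY.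
    rewrite -PN; apply: le_measure; rewrite ?inE//; first exact: bigcapT_measurable.
    move=> w hw; apply: hN => /= cv; apply: (cvg_recurrent_dev e0 cv) => n; exact: hw.
  apply: nonincreasing_cvg_mu => //.
  - by rewrite (le_lt_trans (probability_le1 P (mA 0%N)))// ltry.
  - exact: bigcapT_measurable.
  - move=> a b ab; apply/subsetPset => w [k bk hk]; exists k => //; exact: leq_trans bk.
have le_n n : (e%:E * P (recurrent_dev Z F i.+1%:R^-1) <= B%:E * P (A n))%E.
  have iA : P.-integrable setT (EFin \o (\1_(A n) : T -> R)).
    exact: integrable_indic.
  have [a ha] := ex _ iA.
  have cB : is_cond_exp P G (fun w => B * \1_(A n) w) (fun w => B * a w).
    exact: is_cond_expZ.
  have cc : is_cond_exp P G (cst e) (cst e).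
    have ic : P.-integrable setT (EFin \o cst e) by exact: finite_measure_integrable_cst.
    split => // C mC; rewrite preimage_cst; case: ifP => _.
      by rewrite -[setT]setD0; have [s0 sD _] := sG; exact: sD.
    by have [] := sG.
  have cBe := is_cond_expD sG GM cB cc.
  have aek : {ae P, forall w, forall k, (n <= k)%N -> `|Z k w - F w| <= B * a w + e}.
    apply: ae_foralln => k; have [kn|nk] := ltnP k n; first exact: aeW.
    have cD := is_cond_expB sG GM (YZ k) FF.
    have cN := is_cond_expB sG GM FF (YZ k).
    have pt w : `|Y k w - F w| <= B * \1_(A n) w + e.
      rewrite indicE; have [wA|wA] := boolP (w \in A n).
        by rewrite mulr1 (le_trans (YB k w))// lerDl ltW.
      rewrite mulr0 add0r leNgt; apply/negP => ek.
      by move: wA; rewrite notin_setE; apply; exists k.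
    have h1 := is_cond_exp_ae_le sG GM cD cBe.
    have h2 := is_cond_exp_ae_le sG GM cN cBe.
    have {}h1 := h1 (aeW _ (fun w => le_trans (ler_norm _) (pt w))).
    have {}h2 : {ae P, forall w, F w - Z k w <= B * a w + e}.
      by apply: h2; apply: aeW => w; rewrite (le_trans _ (pt w))// -[leLHS]opprB (le_trans (ler_norm _))// normrN.
    by apply: filterS2 h1 h2 => w u1 u2 _; rewrite ler_norml lerNl opprB u1 u2.
  have a0 : {ae P, forall w, 0 <= a w}.
    by apply: (is_cond_exp_ge0 sG GM _ ha) => w; have /andP[] := indic_ge0_le1 R (A n) w.
  have [_ ia _ inta] := ha.
  have mr := measurable_recurrent_dev i.+1%:R^-1 mZ mF.
  have -> : (B%:E * P (A n) = \int[P]_w (B * Num.max (a w) 0)%:E)%E.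
    have sT : G setT by rewrite -[setT]setD0; have [s0 sD _] := sG; exact: sD.
    have := inta _ sT; rewrite integral_indic// setIT => <-.
    have mma : measurable_fun setT (fun w => Num.max (a w) 0).
      by apply: measurable_maxr => //; exact/measurable_EFinP/(measurable_int _ ia).
    under [RHS]eq_integral do rewrite EFinM.
    rewrite ge0_integralZl//; last 2 first.
    - exact/measurable_EFinP.
    - by move=> w _; rewrite lee_fin le_max lexx orbT.
    congr (_ * _)%E; apply: ae_eq_integral => //.
    - exact: measurable_int ia.
    - exact/measurable_EFinP.
    - by apply: filterS a0 => w aw _; congr EFin; rewrite (max_idPl aw).
  have -> : (e%:E * P (recurrent_dev Z F i.+1%:R^-1) =
      \int[P]_w (e * \1_(recurrent_dev Z F i.+1%:R^-1) w)%:E)%E.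
    under [RHS]eq_integral do rewrite EFinM.
    rewrite ge0_integralZl//; last 2 first.
    - by apply/measurable_EFinP; exact: measurable_indic.
    - by rewrite lee_fin ltW.
    by rewrite integral_indic// setIT.
  apply: ae_ge0_le_integral => //.
  - move=> w _; rewrite lee_fin mulr_ge0 ?(ltW e0)//.
  - by apply/measurable_EFinP; apply: measurable_funM => //; exact: measurable_indic.
  - by move=> w _; rewrite lee_fin mulr_ge0// le_max lexx orbT.
  - apply/measurable_EFinP; apply: measurable_funM => //; apply: measurable_maxr => //.
    exact/measurable_EFinP/(measurable_int _ ia).
  - apply: filterS2 aek a0 => w hk aw _; rewrite lee_fin (max_idPl aw) indicE.
    have [|_] := boolP (w \in _); last by rewrite mulr0 mulr_ge0.
    rewrite inE mulr1 => /(_ n)[k nk /lt_le_trans/(_ (hk k nk))].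
    by rewrite -ltrBlDr (splitr i.+1%:R^-1) addrK => /ltW.
have : (e%:E * P (recurrent_dev Z F i.+1%:R^-1) <= 0)%E.
  have cv : (B%:E * P (A n) @[n --> \oo] --> 0)%E.
    by rewrite -[0%E](mule0 B%:E); apply: cvgeZl.
  by rewrite -(cvg_lim (@ereal_hausdorff R) cv); apply: lime_ge;
    [apply/cvg_ex; eexists; exact: cv|exact: nearW].
rewrite pmule_rle0 ?lte_fin// => h; apply/eqP; rewrite -measure_le0//.
Qed.

Section bounded_rates.
Variables (R : realType) (X : completePseudoMetricType R).
Variables (P : probability (cadlag R X) R) (m : probability (borelType X) R).
Hypothesis X_polish : polish X.
Hypothesis P_stationary : is_stationary P m.
Local Notation lambda := (@lebesgue_measure R).
Implicit Types (t r h l : R) (w : cadlag R X) (x : borelType X).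
Implicit Types (z : measurableTypeR R * borelType X).
Variables (f : measurableTypeR R * borelType X -> R) (C : R).
Hypothesis fC : is_rate m f C.
Variable B : R.
Hypothesis fB : forall z, f z <= B.
Variable q : R -> R -> borelType X -> R.
Hypothesis fq : is_transition P f q.

Let mean_path k (z : measurableTypeR R * cadlag R X) : R :=
  k.+1%:R * fine (path_occ f z.1 k.+1%:R^-1 z.2).

Let rate_path_integrable w :
  lambda.-integrable setT (EFin \o (fun r => f (r, w r))).
Proof.
have [mf f0 fs _] := fC; have mfw := rate_path_measurable fC w.
apply/integrableP; split => //.
apply: (@le_lt_trans _ _ (\int[lambda]_(r in `[0%R, 1%R]) B%:E)%E); last first.
  by rewrite integral_cst//= lebesgue_measure_itv/= lte_fin ltr01 oppr0 adde0 mule1 ltry.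
rewrite [leRHS]integral_mkcond; apply: ge0_le_integral => //.
- exact: measurableT_comp.
- by apply/(measurable_restrictT _ (measurable_itv _)); exact: measurable_cst.
- move=> r _ /=; rewrite ger0_norm// patchE mem_setE in_itv/=; case: ifPn => [_|/negP r01].
    by rewrite lee_fin.
  by rewrite fs.
Qed.

Lemma path_differentiation w :
  {ae lambda, forall t, mean_path k (t, w) @[k --> \oo] --> f (t, w t)}.
Proof.
have ii := rate_path_integrable w; have [_ f0 _ _] := fC.
pose phi r := f (r, w r).
have iT y : lambda.-integrable `]-oo, y] (EFin \o phi).
  by apply: integrableS ii => //; exact: measurable_itv.
have loc : locally_integrable setT phi by exact: (open_integrable_locally openT ii).
have := FTC1Ny iT loc; apply: filterS.
  exact: (ae_filter_ringOfSetsType lambda).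
move=> t [dF /= dFt].
rewrite -[f (t, w t)]/(phi t) -dFt derive1E /derive.
have hc : (k.+1%:R^-1 : R) @[k --> \oo] --> (0 : R)^'.
  move=> A /nbhs_ballP[e /= e0 hA].
  have [N _ hN] := near_infty_natSinv_lt (PosNum e0).
  exists N => // k /= Nk; apply: hA.
    by rewrite /ball/= sub0r normrN ger0_norm//; exact: hN.
  by rewrite invr_eq0 pnatr_eq0.
have cv := cvg_comp _ _ hc dF.
apply: cvg_trans cv; apply: near_eq_cvg; apply: nearW => k /=.
rewrite /mean_path /= invrK /GRing.scale/= mulr1; congr (_ * _).
have k0 : 0 < (k.+1%:R : R)^-1 by rewrite invr_gt0.
have := @Rintegral_itvB R phi -oo%O (BRight (k.+1%:R^-1 + t)) t (iT _).
rewrite !bnd_simp lerDr => /(_ isT (ltW k0)).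
rewrite Rintegral_itv_obnd_cbnd; last first.
  by apply: integrableS ii => //; exact: measurable_itv.
by rewrite /path_occ (addrC t) => ->.
Qed.

Lemma measurable_mean_path k : measurable_fun setT (mean_path k).
Proof.
have [mf f0 _ _] := fC.
have mfE : measurable_fun setT (EFin \o f) by exact/measurable_EFinP.
apply: measurable_funM; first exact: measurable_cst.
have mid : measurable_fun setT (fun t : measurableTypeR R => t : R) by exact: measurable_id.
have mD : measurable_fun setT (fun t : measurableTypeR R => (t : R) + k.+1%:R^-1).
  by apply: measurable_funD.
have := @measurable_path_integral_joint R X _ (measurableTypeR R) id
  (fun t => t + k.+1%:R^-1) (EFin \o f) mid mD mfE (fun z => f0 z).
move=> mj; by apply: measurableT_comp.
Qed.

Lemma mean_path_le k (z : measurableTypeR R * cadlag R X) : 0 <= mean_path k z <= B.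
Proof.
have [mf f0 _ _] := fC.
have B0 : 0 <= B by exact: le_trans (fB (0, point)).
have k0 : 0 < (k.+1%:R : R)^-1 by rewrite invr_gt0.
have p0 : (0 <= path_occ f z.1 k.+1%:R^-1 z.2)%E by exact: (path_occ_ge0 _ _ _ fC).
rewrite /mean_path mulr_ge0 ?fine_ge0//= mulrC -ler_pdivlMr//.
have ple : (path_occ f z.1 k.+1%:R^-1 z.2 <= (B * k.+1%:R^-1)%:E)%E.
  apply: (@le_trans _ _ (\int[lambda]_(r in `[z.1, (z.1 + k.+1%:R^-1)%R]) B%:E)%E).
    apply: ge0_le_integral => //.
    - by move=> r _; rewrite lee_fin.
    - by apply: measurable_funTS; exact: (rate_path_measurable fC).
    - by move=> r _; rewrite lee_fin.
  rewrite integral_cst//= lebesgue_measure_itv/= lte_fin ltrDl k0.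
  by rewrite -EFinB -EFinM addrAC subrr add0r.
rewrite -[leRHS]/(fine (B * k.+1%:R^-1)%:E); apply: fine_le => //.
by rewrite ge0_fin_numE// (le_lt_trans ple)// ltry.
Qed.

Lemma mean_occ_cvg_bounded :
  {ae (lambda \x m)%E, forall z, mean_occ q k z @[k --> \oo] --> f z}.
Proof.
have [mf f0 fs fC'] := fC.
pose fp (z : measurableTypeR R * cadlag R X) := f (z.1, z.2 z.1).
have mfp : measurable_fun setT fp by exact: measurable_path_comp.
(* Differentiation holds for every path at almost every [t]; the quantifiers are exchanged on the
   measurable sets [recurrent_dev], one threshold at a time. *)
have h1 i : {ae lambda, forall t, P [set w | recurrent_dev mean_path fp i.+1%:R^-1 (t, w)] = 0%E}.
  have i0 : 0 < (i.+1%:R : R)^-1 by rewrite invr_gt0.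
  have mr := measurable_recurrent_dev i.+1%:R^-1 measurable_mean_path mfp.
  apply: (@ae_swap _ _ (measurableTypeR R) (cadlag R X) R lambda P
    (recurrent_dev mean_path fp i.+1%:R^-1) mr).
  move=> w; apply/eqP; rewrite -measure_le0.
  have [N [mN lN hN]] := path_differentiation w.
  rewrite -lN; apply: le_measure; rewrite ?inE//.
    rewrite (_ : [set _ | _] = ysection (recurrent_dev mean_path fp i.+1%:R^-1) w).
      exact: measurable_ysection.
    by apply/seteqP; split => t; rewrite /ysection/= inE.
  move=> t ht; apply: hN => /= cv.
  exact: (@cvg_recurrent_dev _ (measurableTypeR R * cadlag R X)%type R mean_path fp i.+1%:R^-1 (t, w)).
have h2 : {ae lambda, forall t, {ae P, forall w, mean_path k (t, w) @[k --> \oo] --> fp (t, w)}}.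
  have := ae_foralln h1; apply: filterS => t ht.
  have : {ae P, forall w, forall i, ~ recurrent_dev mean_path fp i.+1%:R^-1 (t, w)}.
    apply: ae_foralln => i; exists [set w | recurrent_dev mean_path fp i.+1%:R^-1 (t, w)].
    split; last 1 first.
    - by move=> w /= /contrapT.
    - have mr := measurable_recurrent_dev i.+1%:R^-1 measurable_mean_path mfp.
      rewrite (_ : [set _ | _] = xsection (recurrent_dev mean_path fp i.+1%:R^-1) t).
        exact: measurable_xsection.
      by apply/seteqP; split => w; rewrite /xsection/= inE.
    - exact: ht.
  by apply: filterS => w; exact: cvg_not_recurrent_dev.
(* At a fixed such [t], the means along the path lie in [[0, B]] and [f (t, X_t)] is its own
   conditional mean given [X_t], so conditional bounded convergence applies. *)
have h3 t : {ae P, forall w, mean_path k (t, w) @[k --> \oo] --> fp (t, w)} ->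
    {ae P, forall w, mean_occ q k (t, path_at t w) @[k --> \oo] --> fp (t, w)}.
  move=> cv; have sG := sigma_algebra_at X t; have GM := @sigma_at_sub_measurable R X t.
  have ik k : 0 <= (k.+1%:R : R)^-1 by rewrite invr_ge0.
  apply: (@cond_bounded_cvg _ _ R P (sigma_at t) (fun k w => mean_path k (t, w))
    (fun k w => mean_occ q k (t, path_at t w)) (fun w => fp (t, w)) B sG GM _ _ _ _ cv).
  - by move=> W iW; have [y [_ hy]] := cond_exp_at_exists X_polish P_stationary t iW; exists (y \o path_at t).
  - move=> k; apply: (is_cond_expZ sG GM).
    by have [[_ hy] _] := cond_exp_trans_occ P_stationary t fC fq (ik k).
  - have ir := rate_integrable P_stationary t fC.
    split => // A mA; exists ((fun x => f (t, x)) @^-1` A); last by rewrite setTI.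
    have mft : measurable_fun setT (fun x => f (t, x)).
      by apply: (measurableT_comp mf); exact: pair1_measurable.
    by rewrite -[X in measurable X]setTI; exact: mft.
  - move=> k w; have /andP[p0 pB] := mean_path_le k (t, w).
    rewrite ler_norml lerBlDr lerBrDl (le_trans pB) ?lerDl ?f0// andbT.
    by rewrite (le_trans _ p0)// subr_le0 fB.
suff h i : (lambda \x m)%E (recurrent_dev (mean_occ q) f i.+1%:R^-1) = 0%E.
  have : {ae (lambda \x m)%E, forall z, forall i, ~ recurrent_dev (mean_occ q) f i.+1%:R^-1 z}.
    apply: ae_foralln => i; exists (recurrent_dev (mean_occ q) f i.+1%:R^-1); split; last 1 first.
    - by move=> w /= /contrapT.
    - apply: measurable_recurrent_dev => // k; exact: (measurable_mean_occ fq).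
    - exact: h.
  by apply: filterS => w; exact: cvg_not_recurrent_dev.
have i0 : 0 < (i.+1%:R : R)^-1 by rewrite invr_gt0.
have mr : measurable (recurrent_dev (mean_occ q) f i.+1%:R^-1).
  by apply: measurable_recurrent_dev => // k; exact: (measurable_mean_occ fq).
rewrite /product_measure1 (@ae_eq_integral _ _ _ lambda setT (cst 0%E)) ?integral0//.
  exact: measurable_fun_xsection.
move: h2; apply: filterS; first exact: (ae_filter_ringOfSetsType lambda).
move=> t /h3[N [mN PN hN]] _ /=.
rewrite -(path_lawE P_stationary t); last exact: measurable_xsection.
apply/eqP; rewrite -measure_le0 -PN; apply: le_measure; rewrite ?inE//.
  rewrite -[X in measurable X]setTI.
  by apply: measurable_path_at_all => //; exact: measurable_xsection.
move=> w; rewrite /xsection/= inE => hw; apply: hN => /= cv.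
exact: (cvg_recurrent_dev i0 cv).
Qed.

End bounded_rates.

(** For [1 / (k + 2) <= h <= 1 / (k + 1)], monotonicity puts [G h / h] between
    [(k + 1) * G (1 / (k + 2))] and [(k + 2) * G (1 / (k + 1))]. These are [c k] and [b k], and they
    have the limit of the given sequence. *)
Lemma cvg_ratio_sandwich (R : realType) (G : R -> R) (L : R) :
  (forall h, 0 < h <= 1 -> 0 <= G h) ->
  (forall h h', 0 < h -> h <= h' -> h' <= 1 -> G h <= G h') ->
  k.+1%:R * G k.+1%:R^-1 @[k --> \oo] --> L ->
  h^-1 * G h @[h --> (0 : R)^'+] --> L.
Proof.
move=> G0 Gm cv.
pose a k := k.+1%:R * G k.+1%:R^-1.
pose b k := a k + a k * k.+1%:R^-1.
pose c k := a k.+1 - a k.+1 * k.+2%:R^-1.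
have cb : b k @[k --> \oo] --> L.
  rewrite -[L]addr0 -(mulr0 L); apply: cvgD => //; apply: cvgM => //.
  exact: cvg_harmonic.
have cc : c k @[k --> \oo] --> L.
  have : (a k - a k * k.+1%:R^-1) @[k --> \oo] --> L - L * 0.
    by apply: cvgB => //; apply: cvgM => //; exact: cvg_harmonic.
  by rewrite mulr0 subr0 -cvg_shiftS.
(* For [h <= 1], the index [k] with [k + 1 <= 1 / h < k + 2]. *)
pose n (h : R) := (Num.truncn h^-1).-1.
have cn : n h @[h --> (0 : R)^'+] --> \oo.
  move=> A [N _ hN].
  suff : \forall h \near (0 : R)^'+, (N <= n h)%N by apply: filterS => h; exact: hN.
  near=> h; have h0 : 0 < h by [].
  have hN1 : h <= N.+1%:R^-1 by near: h; apply: nbhs_right_le; rewrite invr_gt0.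
  have tN : (N < Num.truncn h^-1)%N.
    rewrite truncn_ge_nat ?invr_ge0 ?(ltW h0)//.
    by rewrite -[leLHS]invrK lef_pV2 ?posrE ?invr_gt0.
  by rewrite /n -ltnS prednK// (leq_trans _ tN).
apply: (@squeeze_cvgr _ _ _ _ (c \o n) (b \o n)); last 2 first.
- exact: cvg_comp cn cc.
- exact: cvg_comp cn cb.
near=> h.
have h0 : 0 < h by [].
have h1 : h < 1 by near: h; exact: nbhs_right_lt.
have hi1 : 1 <= h^-1 by rewrite invf_ge1// ltW.
have /andP[t1 t2] := truncn_itv (ltW (lt_le_trans ltr01 hi1)).
have tr1 : (1 <= Num.truncn h^-1)%N by rewrite truncn_ge_nat// (le_trans ler01).
have nE : (n h).+1 = Num.truncn h^-1 by rewrite /n prednK.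
rewrite /= /b /c; set k := n h.
have kh : k.+1%:R <= h^-1 by rewrite /k nE.
have hk : h^-1 <= k.+2%:R by rewrite /k nE ltW.
have k0 : 0 < (k.+1%:R : R) by [].
have kk0 : 0 < (k.+2%:R : R) by [].
have h_le : h <= k.+1%:R^-1 by rewrite -[leLHS]invrK lef_pV2// posrE invr_gt0.
have h_ge : k.+2%:R^-1 <= h by rewrite -[leRHS]invrK lef_pV2// posrE invr_gt0.
have k1 : (k.+1%:R : R)^-1 <= 1 by rewrite invf_le1// ler1n.
have g1 := Gm _ _ h0 h_le k1.
have g2 : G k.+2%:R^-1 <= G h by apply: Gm; rewrite ?invr_gt0// ltW.
have g0 : 0 <= G h by apply: G0; rewrite h0 ltW.
have g20 : 0 <= G k.+2%:R^-1 by apply: G0; rewrite invr_gt0 kk0 (le_trans h_ge)// ltW.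
apply/andP; split.
- have -> : a k.+1 - a k.+1 / k.+2%:R = k.+1%:R * G k.+2%:R^-1.
    rewrite /a mulrAC mulfV ?gt_eqF// mul1r.
    by rewrite -[k.+2%:R]natr1 mulrDl mul1r addrK.
  by apply: ler_pM => //; exact: ltW.
- have -> : a k + a k / k.+1%:R = k.+2%:R * G k.+1%:R^-1.
    rewrite /a [X in _ + X]mulrAC mulfV ?gt_eqF// mul1r.
    by rewrite -[k.+2%:R]natr1 mulrDl mul1r.
  by apply: ler_pM => //; rewrite invr_ge0 ltW.
Unshelve. all: by end_near. Qed.

Section local_ergodic.
Variables (R : realType) (X : completePseudoMetricType R).
Variables (P : probability (cadlag R X) R) (m : probability (borelType X) R).
Hypothesis X_polish : polish X.
Hypothesis P_markov : is_markov P.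
Hypothesis P_stationary : is_stationary P m.
Local Notation lambda := (@lebesgue_measure R).
Implicit Types (t r h l : R) (w : cadlag R X) (x : borelType X).
Implicit Types (z : measurableTypeR R * borelType X).

Lemma ae_product_sections (A : set (measurableTypeR R * borelType X)) :
  measurable A -> (forall t, {ae P, forall w, ~ A (t, path_at t w)}) ->
  (lambda \x m)%E A = 0%E.
Proof.
move=> mA h.
rewrite /product_measure1 integral0_eq// => t _ /=.
have [N [mN PN hN]] := h t.
have mAt : measurable (xsection A t) by exact: measurable_xsection.
rewrite -(path_lawE P_stationary t mAt).
apply/eqP; rewrite -measure_le0 -PN; apply: le_measure; rewrite ?inE//.
  by rewrite -[X in measurable X]setTI; exact: measurable_path_at_all.
by move=> w; rewrite /xsection/= inE => hw; apply: hN => /=; exact.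
Qed.

Variables (f : measurableTypeR R * borelType X -> R) (C : R).
Hypothesis fC : is_rate m f C.

Lemma mean_occ_split g u C' C'' q qg qr : is_rate m g C' -> is_rate m u C'' ->
  (forall z, f z = g z + u z) ->
  is_transition P f q -> is_transition P g qg -> is_transition P u qr ->
  {ae (lambda \x m)%E, forall z k, mean_occ q k z = mean_occ qg k z + mean_occ qr k z}.
Proof.
move=> gC rC fE fq gq rq; apply: ae_foralln => k.
pose A := [set z | mean_occ q k z <> mean_occ qg k z + mean_occ qr k z].
have mA : measurable A.
  have m1 := measurable_mean_occ fq k.
  have m2 : measurable_fun setT (fun z => mean_occ qg k z + mean_occ qr k z).
    by apply: measurable_funD; [exact: (measurable_mean_occ gq)|exact: (measurable_mean_occ rq)].
  rewrite (_ : A = [set z | mean_occ q k z < mean_occ qg k z + mean_occ qr k z] `|`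
                   [set z | mean_occ qg k z + mean_occ qr k z < mean_occ q k z]).
    by apply: measurableU; exact: measurable_ltr_set.
  apply/seteqP; split => z /=; rewrite /A/=.
    by move=> /eqP; rewrite neq_lt => /orP[]; [left|right].
  by move=> [|] h e; move: h; rewrite e ltxx.
exists A; split => //.
apply: ae_product_sections => // t.
have sG := sigma_algebra_at X t; have GM := @sigma_at_sub_measurable R X t.
have ik : 0 <= (k.+1%:R : R)^-1 by rewrite invr_ge0.
have [[_ cf] _] := cond_exp_trans_occ P_stationary t fC fq ik.
have [[_ cg] _] := cond_exp_trans_occ P_stationary t gC gq ik.
have [[_ cr] _] := cond_exp_trans_occ P_stationary t rC rq ik.
have [_ finf] := integrable_path_occ P_stationary t fC ik.
have cgr := is_cond_expD sG GM cg cr.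
have cgr' : is_cond_exp P (sigma_at t) (fun w => fine (path_occ f t k.+1%:R^-1 w))
   (fun w => fine (trans_occ qg t k.+1%:R^-1 (path_at t w)) +
             fine (trans_occ qr t k.+1%:R^-1 (path_at t w))).
  apply: (is_cond_exp_ae GM cgr).
    by apply: measurableT_comp => //; exact: (measurable_path_occ _ _ fC).
  apply: filterS finf => w fw.
  have [[_ g0 _ _] [_ r0 _ _]] := (gC, rC).
  have sE : path_occ f t k.+1%:R^-1 w = (path_occ g t k.+1%:R^-1 w + path_occ u t k.+1%:R^-1 w)%E.
    rewrite /path_occ -ge0_integralD//; last 4 first.
    - by move=> s _; rewrite lee_fin.
    - by apply: measurable_funTS; exact: (rate_path_measurable gC).
    - by move=> s _; rewrite lee_fin.
    - by apply: measurable_funTS; exact: (rate_path_measurable rC).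
    by apply: eq_integral => s _; rewrite fE EFinD.
  move: fw; rewrite sE fin_numD => /andP[fg fr].
  by rewrite [RHS]fineD.
have := is_cond_exp_unique sG GM cf cgr'.
apply: filterS => w e; apply.
exact: etrans (congr1 (fun y => k.+1%:R * y) e) (mulrDr _ _ _).
Qed.

Lemma rate_trunc B : 0 <= B -> exists g u : measurableTypeR R * borelType X -> R,
  [/\ is_rate m g C, is_rate m u C, forall z, f z = g z + u z, forall z, g z <= B &
      forall z, u z = Num.max (f z - B) 0].
Proof.
move=> B0; have [mf f0 fs fB] := fC.
exists (fun z => Num.min (f z) B), (fun z => Num.max (f z - B) 0).
split => //.
- apply: (rate_le fC); first by apply: measurable_minr => //; exact: measurable_cst.
  by move=> z; rewrite le_min f0 B0 ge_min lexx.
- apply: (rate_le fC).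
    apply: measurable_maxr; last exact: measurable_cst.
    by apply: measurable_funB => //; exact: measurable_cst.
  by move=> z; rewrite le_max lexx orbT ge_max f0 gerBl B0.
- move=> z; have [fz|fz] := leP (f z) B.
    by rewrite (max_idPr _) ?addr0// subr_le0.
  by rewrite (max_idPl _) ?subr_ge0 ?ltW// addrC subrK.
- by move=> z; rewrite ge_min lexx orbT.
Qed.

Lemma rate_integrable_product :
  (lambda \x m)%E.-integrable setT (EFin \o f).
Proof.
have [mf f0 fs fB] := fC.
have mfE : measurable_fun setT (EFin \o f) by exact/measurable_EFinP.
apply/integrableP; split => //.
under eq_integral do rewrite gee0_abs ?lee_fin//.
rewrite fubini_tonelli1//; exact: (integral_rate_mass_lt fC).
Qed.

Lemma integral_rate_excess_cvg :
  (\int[(lambda \x m)%E]_z (Num.max (f z - n%:R) 0)%:E @[n --> \oo] --> 0)%E.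
Proof.
have [mf f0 fs fB] := fC.
have -> : 0%E = (\int[(lambda \x m)%E]_z (cst 0%E z) :> \bar R)%E by rewrite integral0.
apply: (@dominated_cvg _ _ _ (lambda \x m)%E setT measurableT
  (fun n z => (Num.max (f z - n%:R) 0)%:E) (cst 0%E) (EFin \o f)) => //.
- move=> n; apply/measurable_EFinP; apply: measurable_maxr; last exact: measurable_cst.
  by apply: measurable_funB => //; exact: measurable_cst.
- move=> z _; apply: cvg_near_cst; near=> n.
  congr EFin; apply/max_idPr; rewrite subr_le0.
  by near: n; exact: nbhs_infty_ger.
- exact: rate_integrable_product.
- move=> n z _; rewrite gee0_abs ?lee_fin ?le_max ?lexx ?orbT//.
  by rewrite ge_max f0 gerBl ler0n.
Unshelve. all: by end_near. Qed.

Variable q : R -> R -> borelType X -> R.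
Hypothesis fq : is_transition P f q.

(** Write [f = g + u] with [u] the excess of [f] over [n]. As the means of the bounded part [g]
    converge, a recurrent deviation forces [u] or one of its means above [e]. By Markov's inequality
    and [maximal_inequality], each of these events has measure at most the integral of [u] divided
    by [e], which vanishes as [n] grows. *)
Lemma mean_occ_cvg :
  {ae (lambda \x m)%E, forall z, 0 <= z.1 <= 1 -> mean_occ q k z @[k --> \oo] --> f z}.
Proof.
have [mf f0 fs fB] := fC.
pose mu : {measure set (measurableTypeR R * borelType X) -> \bar R} := (lambda \x m)%E.
pose Bad i := @I01X R X `&` recurrent_dev (mean_occ q) f i.+1%:R^-1.
have mBad i : measurable (Bad i).
  apply: measurableI; first exact: measurable_I01X.
  by apply: measurable_recurrent_dev => // k; exact: (measurable_mean_occ fq).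
suff h i : mu (Bad i) = 0%E.
  have : {ae mu, forall z, forall i, ~ Bad i z}.
    apply: ae_foralln => i; exists (Bad i); split; last 1 first.
    - by move=> w /= /contrapT.
    - exact: mBad.
    - exact: h.
  apply: filterS => z hz z01; apply: cvg_not_recurrent_dev => i hi; apply: (hz i).
  by split => //; split.
pose e : R := i.+1%:R^-1 / 2.
have e0 : 0 < e by rewrite divr_gt0 ?invr_gt0.
have le_n n : (e%:E * mu (Bad i) <=
    2%:E * \int[mu]_z (Num.max (f z - n%:R) 0)%:E)%E.
  have [g [u [gC uC fE gB uE]]] := rate_trunc (ler0n R n).
  have [qg gq] := is_transition_exists X_polish P_stationary gC.
  have [qu uq] := is_transition_exists X_polish P_stationary uC.
  have [mu_ u0 us _] := uC.
  have [N1 [mN1 N10 hN1]] := mean_occ_split gC uC fE fq gq uq.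
  have [N2 [mN2 N20 hN2]] := mean_occ_cvg_bounded X_polish P_stationary gC gB gq.
  pose A1 := @I01X R X `&` [set z | exists k, e < mean_occ qu k z].
  pose A2 := [set z | e < u z].
  have mA1 : measurable A1.
    apply: measurableI; first exact: measurable_I01X.
    rewrite (_ : [set _ | _] = \bigcup_k [set z | e < mean_occ qu k z]).
      apply: bigcupT_measurable => k; apply: measurable_ltr_set; first exact: measurable_cst.
      exact: (measurable_mean_occ uq).
    by apply/seteqP; split => z [k]; [move=> hk; exists k|move=> _ hk; exists k].
  have mA2 : measurable A2 by apply: measurable_ltr_set => //; exact: measurable_cst.
  (* Outside the right-hand set, the bounded part deviates by at most [e] from some index on, and
     [mean_occ qu k z] and [u z] both lie in [[0, e]]: the total deviation is at most [2 * e], the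
     threshold of [Bad i]. *)
  have sub : Bad i `<=` (N1 `|` N2) `|` (A1 `|` A2).
    move=> z [Iz hz]; apply: contrapT => /not_orP[/not_orP[n1 n2] /not_orP[a1 a2]].
    have e1 : forall k, mean_occ q k z = mean_occ qg k z + mean_occ qu k z.
      by apply: contrapT => c; apply: n1; exact: hN1.
    have e2 : mean_occ qg k z @[k --> \oo] --> g z.
      by apply: contrapT => c; apply: n2; exact: hN2.
    have e3 k : mean_occ qu k z <= e.
      by rewrite leNgt; apply/negP => c; apply: a1; split => //; exists k.
    have e4 : u z <= e by rewrite leNgt; apply/negP.
    have /existsNP[K hK] := cvg_recurrent_dev e0 e2.
    have [k Kk] := hz K; rewrite e1 fE.
    have d1 : `|mean_occ qg k z - g z| <= e.
      by rewrite leNgt; apply/negP => c; apply: hK; exists k.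
    have d2 : `|mean_occ qu k z - u z| <= e.
      have p0 := mean_occ_ge0 uq k z; have u0z := u0 z; have p1 := e3 k.
      rewrite ler_norml lerBrDr lerBlDr (le_trans p1) ?lerDl// andbT.
      by rewrite (le_trans _ p0)// addrC subr_le0.
    rewrite opprD addrACA ltNge => /negP; apply.
    by rewrite (splitr i.+1%:R^-1) (le_trans (ler_normD _ _))// lerD.
  have I_u : (\int[mu]_z (Num.max (f z - n%:R) 0)%:E = \int[mu]_z (u z)%:E)%E.
    by apply: eq_integral => z _; rewrite uE.
  have muE : measurable_fun setT (EFin \o u) by exact/measurable_EFinP.
  have b1 : (e%:E * mu A1 <= \int[mu]_z (u z)%:E)%E.
    rewrite fubini_tonelli1//.
    exact: (maximal_inequality X_polish P_markov P_stationary uC uq e0).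
  have b2 : (e%:E * mu A2 <= \int[mu]_z (u z)%:E)%E.
    have -> : (e%:E * mu A2 = \int[mu]_z (e%:E * (\1_A2 z)%:E))%E.
      rewrite ge0_integralZl//; last 2 first.
      - by apply/measurable_EFinP; exact: measurable_indic.
      - by rewrite lee_fin ltW.
      by rewrite integral_indic// setIT.
    apply: ge0_le_integral => //.
    - by move=> z _; rewrite -EFinM lee_fin mulr_ge0// ltW.
    - apply: measurable_funeM; apply/measurable_EFinP; exact: measurable_indic.
    - move=> z _; rewrite -EFinM lee_fin indicE.
      by have [|_] := boolP (z \in A2); rewrite ?mulr0// inE mulr1 => /ltW.
  rewrite I_u.
  have : (mu (Bad i) <= mu A1 + mu A2)%E.
    apply: (@le_trans _ _ (mu ((N1 `|` N2) `|` (A1 `|` A2)))).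
      apply: le_measure; rewrite ?inE//; do ?apply: measurableU => //.
    rewrite setUC measureU0; last 3 first.
    - exact: measurableU.
    - exact: measurableU.
    - exact: (null_set_setU mN1 mN2 N10 N20).
    exact: measureU2.
  move=> /(lee_wpmul2l (_ : 0 <= e%:E)%E) => /(_ _)/le_trans; apply.
    by rewrite lee_fin ltW.
  rewrite ge0_muleDr// (_ : 2%:E = 1%:E + 1%:E)%E; last by rewrite -EFinD.
  by rewrite ge0_muleDl ?lee_fin// !mul1e leeD.
have : (e%:E * mu (Bad i) <= 0)%E.
  have cv : (2%:E * \int[mu]_z (Num.max (f z - n%:R) 0)%:E @[n --> \oo] --> 0)%E.
    by rewrite -[0%E](mule0 2%:E); apply: cvgeZl => //; exact: integral_rate_excess_cvg.
  by rewrite -(cvg_lim (@ereal_hausdorff R) cv); apply: lime_ge;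
    [apply/cvg_ex; eexists; exact: cv|exact: nearW].
by rewrite pmule_rle0 ?lte_fin// => h; apply/eqP; rewrite -measure_le0.
Qed.

Theorem local_ergodic :
  {ae (lambda \x m)%E, forall z, 0 <= z.1 <= 1 ->
    h^-1 * fine (trans_occ q z.1 h z.2) @[h --> (0 : R)^'+] --> f z}.
Proof.
(* [fine] sends [+oo] to [0] and would destroy monotonicity in [h]. Finiteness for all [h <= 1]
   follows from finiteness at [h = 1], which holds almost everywhere. *)
pose A := [set z : measurableTypeR R * borelType X | trans_occ q z.1 1 z.2 = +oo%E].
have mA : measurable A.
  have mt := measurable_trans_occ 1 fq.
  rewrite -[A]setTI (_ : A = (fun z : measurableTypeR R * borelType X => trans_occ q z.1 1 z.2) @^-1` [set +oo%E]) //.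
  exact: mt.
have A0 : (lambda \x m)%E A = 0%E.
  apply: ae_product_sections => // t.
  have [_] := cond_exp_trans_occ P_stationary t fC fq (ler01 : 0 <= 1 :> R).
  by apply: filterS => w fw; rewrite /A/= => e; rewrite e in fw.
have aeA : {ae (lambda \x m)%E, forall z, ~ A z}.
  by exists A; split => // z /= /contrapT.
apply: filterS2 mean_occ_cvg aeA => z cv nA z01.
have t0 h := trans_occ_ge0 z.1 h z.2 fq.
have fin h : h <= 1 -> trans_occ q z.1 h z.2 \is a fin_num.
  move=> h1; rewrite ge0_fin_numE//.
  apply: (le_lt_trans (trans_occ_mono fq z.1 z.2 h1)).
  by rewrite ltey; apply/eqP.
apply: (@cvg_ratio_sandwich R (fun h => fine (trans_occ q z.1 h z.2))).
- by move=> h _; exact: fine_ge0.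
- move=> h h' h0 hh' h'1; apply: fine_le; rewrite ?fin ?(le_trans hh')//.
  exact: (trans_occ_mono fq).
- exact: cv.
Qed.

End local_ergodic.

(** * The Feynman-Kac function *)

Section orlicz_bounds.
Context d (T : measurableType d) (R : realType).
Variable mu : probability T R.
Implicit Types (gamma : R -> \bar R) (u : T -> R).

Lemma uniformly_integrable_bounded (J : Type) (I : set J) (f : J -> T -> \bar R) :
  uniformly_integrable mu I f ->
  exists K : R, forall i, I i -> (\int[mu]_x `|f i x| <= K%:E)%E.
Proof.
move=> [mf /(_ 1 ltr01)[K hK]]; exists (1 + `|K|) => i Ii.
have mfi : measurable_fun setT (abse \o f i) by apply: measurableT_comp => //; exact: mf.
pose A := [set x | (K%:E < `|f i x|)%E].
have mA : measurable A.
  rewrite -[A]setTI; exact: (emeasurable_fun_o_infty measurableT mfi).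
have mAc : measurable (~` A) by exact: measurableC.
have dA : [disjoint A & ~` A] by apply/disj_setPS; rewrite setICr; exact: subset_refl.
rewrite -(setUv A) (ge0_integral_setU mu mA mAc _ _ dA)//; last by rewrite setUv.
rewrite EFinD leeD//; first exact: hK.
apply: (@le_trans _ _ (\int[mu]_(x in ~` A) `|K|%:E)%E).
  apply: ge0_le_integral => //.
  - exact: measurable_funTS.
  - move=> x /negP; rewrite -leNgt => /le_trans; apply.
    by rewrite lee_fin ler_norm.
by rewrite integral_cst// -[leRHS]mule1 lee_wpmul2l// probability_le1.
Qed.

Lemma uniformly_integrable_integrable (J : Type) (I : set J) (f : J -> T -> R) i :
  uniformly_integrable mu I (fun i x => (f i x)%:E) -> I i ->
  mu.-integrable setT (EFin \o f i).
Proof.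
move=> fi Ii; have [K hK] := uniformly_integrable_bounded fi; have [mf _] := fi.
apply/integrableP; split; first exact: mf.
exact: le_lt_trans (hK i Ii) (ltry _).
Qed.

Variables (g1 : T -> R) (gamma : R -> \bar R).
Hypothesis g1_admissible : admissible mu g1 gamma.
Hypothesis mg1 : measurable_fun setT g1.
Hypothesis g1_ge0 : forall x, 0 <= g1 x.

(** The constant [1] belongs to [L^p], hence to the Orlicz space; on a probability space this says
    that [gamma] is finite at some positive point. *)
Lemma admissible_young_finite : exists2 a : R, 0 < a & (gamma a < +oo)%E.
Proof.
have [yg _ _ [p p1 [Lp _]] _] := g1_admissible.
have p0 : 0 <= p by rewrite (le_trans ler01) ?ltW.
have c1 : (cst 1 : T -> R) \in Lfun mu p%:E by exact: Lfun_cst.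
have [_ [a a0 ha]] := Lp _ c1.
exists a => //; move: ha; under eq_integral do rewrite normr1 mulr1.
by rewrite integral_cst// [X in (_ * X)%E](@probability_setT _ _ _ mu) mule1.
Qed.

(** [g1 <= exp 1 + g1 * log_plus g1], since [log_plus] is at least [1] beyond [exp 1]. *)
Lemma admissible_integrable : mu.-integrable setT (EFin \o g1).
Proof.
have [yg gl _ _ _] := g1_admissible.
have mge : measurable_fun setT (EFin \o g1) by exact/measurable_EFinP.
have l0 x : 0 <= g1 x * log_plus (g1 x) by rewrite mulr_ge0// le_max lexx.
have ml : measurable_fun setT (fun x => g1 x * log_plus (g1 x)).
  apply: measurable_funM => //; apply: measurable_maxr; first exact: measurable_cst.
  exact: (measurableT_comp (@measurable_ln R)).
apply/integrableP; split => //.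
apply: (@le_lt_trans _ _ (\int[mu]_x (expR 1 + g1 x * log_plus (g1 x))%:E)%E).
  apply: ge0_le_integral => //.
  - exact: measurableT_comp.
  - by apply/measurable_EFinP; exact: measurable_funD.
  - move=> x _; rewrite /= lee_fin ger0_norm//.
    have [ge|ge] := leP (g1 x) (expR 1); first by rewrite (le_trans ge)// lerDl.
    rewrite (@le_trans _ _ (g1 x * log_plus (g1 x)))// ?lerDr ?expR_ge0//.
    rewrite ler_peMr// /log_plus le_max; apply/orP; right.
    by rewrite -[leLHS]expRK ler_ln ?posrE ?expR_gt0// ?ltW// (lt_trans _ ge)// expR_gt0.
under eq_integral do rewrite EFinD.
rewrite ge0_integralD//; last 2 first.
- by move=> x _; rewrite lee_fin.
- exact/measurable_EFinP.
by rewrite integral_cst// [X in (_ * X)%E](@probability_setT _ _ _ mu) mule1 lte_add_pinfty ?ltry.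
Qed.

End orlicz_bounds.

Section time_cut.
Variables (R : realType) (X : completePseudoMetricType R).
Local Notation lambda := (@lebesgue_measure R).
Implicit Types (u : R -> X -> R) (w : cadlag R X).

(* Extended by [0], so that time integrals may overrun [[0, 1]]. *)
Definition cut u : measurableTypeR R * borelType X -> R :=
  fun z => if 0 <= z.1 <= 1 then u z.1 z.2 else 0.

Definition cut_pos u z := Num.max (cut u z) 0.
Definition cut_neg u z := Num.max (- cut u z) 0.

Lemma cut_pos_ge0 u z : 0 <= cut_pos u z.
Proof. by rewrite le_max lexx orbT. Qed.

Lemma cut_neg_ge0 u z : 0 <= cut_neg u z.
Proof. by rewrite le_max lexx orbT. Qed.

Lemma cut_posB u z : cut_pos u z - cut_neg u z = cut u z.
Proof.
rewrite /cut_pos /cut_neg; have [c0|c0] := leP (cut u z) 0.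
  by rewrite (max_idPl _) ?oppr_ge0// sub0r opprK.
by rewrite (max_idPr _) ?subr0// oppr_le0 ltW.
Qed.

Lemma cut_pos_le u z : cut_pos u z <= `|cut u z|.
Proof. by rewrite ge_max ler_norm normr_ge0. Qed.

Lemma cut_neg_le u z : cut_neg u z <= `|cut u z|.
Proof. by rewrite ge_max -normrN ler_norm normr_ge0. Qed.

Lemma cut_out u z : ~ (0 <= z.1 <= 1) -> cut u z = 0.
Proof. by rewrite /cut => /negP/negbTE ->. Qed.

Lemma measurable_cut u : measurable01 u -> measurable_fun setT (cut u).
Proof.
move=> mu; have -> : cut u = time_space u \_ (@I01X R X).
  apply/funext => z; rewrite /cut patchE /time_space.
  rewrite (_ : (z \in @I01X R X) = (0 <= z.1 <= 1)) //.
  by apply/idP/idP; rewrite inE /I01X /= in_itv/=; [case|].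
exact/(measurable_restrictT _ (@measurable_I01X R X)).
Qed.

Lemma measurable_cut_pos u : measurable01 u -> measurable_fun setT (cut_pos u).
Proof. by move=> mu; apply: measurable_maxr; [exact: measurable_cut|exact: measurable_cst]. Qed.

Lemma measurable_cut_neg u : measurable01 u -> measurable_fun setT (cut_neg u).
Proof.
move=> mu; apply: measurable_maxr; last exact: measurable_cst.
by apply: measurableT_comp => //; exact: measurable_cut.
Qed.

Lemma measurable01_at u t : measurable01 u -> 0 <= t <= 1 ->
  measurable_fun setT (u t : borelType X -> R).
Proof.
move=> mu t01; have -> : u t = (fun x => cut u (t, x)) by apply/funext => x; rewrite /cut t01.
by apply: (measurableT_comp (measurable_cut mu)); exact: pair1_measurable.
Qed.

Lemma path_integral_cut u w a b : 0 <= a -> b <= 1 ->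
  (\int[lambda]_(s in `[a, b]) (u s (w s))%:E =
   \int[lambda]_(s in `[a, b]) (cut_pos u (s, w s))%:E -
   \int[lambda]_(s in `[a, b]) (cut_neg u (s, w s))%:E)%E.
Proof.
move=> a0 b1; rewrite integralE.
have cutE s : s \in (`[a, b]%classic : set R) -> cut u (s, w s) = u s (w s).
  rewrite inE/= in_itv/= => /andP[as_ sb].
  by rewrite /cut /= (le_trans a0 as_) (le_trans sb b1).
congr (_ - _)%E; apply: eq_integral => s /cutE sE.
  by rewrite /cut_pos sE funeposE EFin_max.
by rewrite /cut_neg sE funenegE EFin_max.
Qed.

Lemma measurable_path_cut_integral u a b : measurable01 u -> 0 <= a -> b <= 1 ->
  measurable_fun [set: between_type X a b]
    (fun w : cadlag R X => (\int[lambda]_(s in `[a, b]) (u s (w s))%:E)%E).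
Proof.
move=> mu a0 b1.
have mp : measurable_fun setT (EFin \o cut_pos u).
  by apply/measurable_EFinP; exact: measurable_cut_pos.
have mn : measurable_fun setT (EFin \o cut_neg u).
  by apply/measurable_EFinP; exact: measurable_cut_neg.
have mIp := @measurable_path_integral R X a b _ a0 mp (fun z => cut_pos_ge0 u z).
have mIn := @measurable_path_integral R X a b _ a0 mn (fun z => cut_neg_ge0 u z).
have := emeasurable_funB mIp mIn.
by congr measurable_fun; apply/funext => w /=; rewrite path_integral_cut.
Qed.

End time_cut.

Section functional.
Variables (R : realType) (X : completePseudoMetricType R).
Local Notation lambda := (@lebesgue_measure R).
Variables (V : R -> X -> R) (g1 : borelType X -> R) (c : R).
Hypothesis V_measurable : measurable01 V.
Hypothesis V_lower : forall t x, 0 <= t <= 1 -> c <= V t x.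
Hypothesis g1_measurable : measurable_fun setT g1.
Hypothesis g1_ge0 : forall x, 0 <= g1 x.
Implicit Types (r s t : R) (w : cadlag R X).

(* The exponential weight is [0] when the integral of [V] diverges. *)
Definition fk t w : R :=
  fine (expeR (- (\int[lambda]_(s in `[t, 1%R]) (cut_pos V (s, w s))%:E -
                  \int[lambda]_(s in `[t, 1%R]) (cut_neg V (s, w s))%:E)))%E * g1 (w 1).

Lemma feynman_kac_functionalE t w : 0 <= t <= 1 -> feynman_kac_functional V g1 t w = fk t w.
Proof. by move=> /andP[t0 _]; rewrite /feynman_kac_functional path_integral_cut. Qed.

Lemma fine_expeR_ge0 (x : \bar R) : 0 <= fine (expeR x).
Proof. by apply: fine_ge0; exact: expeR_ge0. Qed.

Lemma fk_ge0 t w : 0 <= fk t w.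
Proof. by rewrite mulr_ge0// fine_expeR_ge0. Qed.

Lemma cut_neg_lower z : cut_neg V z <= `|c|.
Proof.
rewrite ge_max normr_ge0 andbT /cut; case: ifPn => [z01|_]; last by rewrite oppr0.
by rewrite (@le_trans _ _ (- c)) ?lerN2 ?V_lower// -normrN ler_norm.
Qed.

Lemma cut_neg_integral_le t w :
  (\int[lambda]_(s in `[t, 1%R]) (cut_neg V (s, w s))%:E <= `|c|%:E)%E.
Proof.
have mfw u : measurable01 u -> measurable_fun setT (fun s : R => (cut_neg u (s, w s))%:E).
  move=> mu; apply/measurable_EFinP.
  have mp : measurable_fun setT (fun r : measurableTypeR R => (r, w) : measurableTypeR R * cadlag R X).
    exact: pair2_measurable.
  exact: (measurableT_comp (measurable_path_comp (measurable_cut_neg mu)) mp).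
apply: (@le_trans _ _ (\int[lambda]_(s in `[0%R, 1%R]) `|c|%:E)%E); last first.
  by rewrite integral_cst//= lebesgue_measure_itv/= lte_fin ltr01 oppr0 adde0 mule1.
rewrite integral_mkcond [leRHS]integral_mkcond; apply: ge0_le_integral => //.
- by move=> s _; rewrite patchE; case: ifP => // _; rewrite lee_fin cut_neg_ge0.
- by apply/(measurable_restrictT _ (measurable_itv _)); apply: measurable_funTS; exact: mfw.
- by apply/(measurable_restrictT _ (measurable_itv _)); exact: measurable_cst.
- move=> s _; rewrite !patchE !mem_setE !in_itv/=.
  case: ifPn => [/andP[_ s1]|_]; last by case: ifP => // _; rewrite lee_fin.
  case: ifPn => [_|]; first by rewrite lee_fin cut_neg_lower.
  move=> s0; rewrite /cut_neg cut_out/= ?oppr0 ?maxxx//; exact/negP.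
Qed.

(** The negative part of [V] is at most [|c|] and is cut off outside [[0, 1]], so its integral is at
    most [|c|]; a divergent positive part gives the weight [0]. *)
Lemma fk_le t w : fk t w <= expR `|c| * g1 (w 1).
Proof.
rewrite ler_wpM2r//.
set Ip := (\int[lambda]_(s in _) (cut_pos V _)%:E)%E.
set In := (\int[lambda]_(s in _) (cut_neg V _)%:E)%E.
have Ip0 : (0 <= Ip)%E by apply: integral_ge0 => s _; rewrite lee_fin cut_pos_ge0.
have In0 : (0 <= In)%E by apply: integral_ge0 => s _; rewrite lee_fin cut_neg_ge0.
have Inc : (In <= `|c|%:E)%E := cut_neg_integral_le t w.
have le : (- (Ip - In) <= `|c|%:E)%E.
  have Infin : In \is a fin_num by rewrite ge0_fin_numE// (le_lt_trans Inc)// ltry.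
  rewrite fin_num_oppeB// (le_trans _ Inc)//.
  by rewrite -[leRHS]add0e leeD2r// leeNl oppe0.
have : (expeR (- (Ip - In)) <= (expR `|c|)%:E)%E by rewrite -[leRHS]/(expeR `|c|%:E) lee_expeR.
have := expeR_ge0 (- (Ip - In)).
by case: (expeR _) => [a|//|//]; rewrite !lee_fin.
Qed.

Lemma measurable_fine_expeR : measurable_fun setT (fun x : \bar R => fine (expeR x)).
Proof.
have -> : (fun x : \bar R => fine (expeR x)) =
    (fun x => expR (fine x) * \1_[set x : \bar R | x \is a fin_num] x).
  apply/funext => -[r| |] /=; rewrite indicE.
  - by rewrite mem_set ?mulr1.
  - by rewrite memNset ?mulr0.
  - by rewrite memNset ?mulr0.
apply: measurable_funM.
  by apply: (measurableT_comp (@measurable_expR R)).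
apply: measurable_indic; rewrite -[X in measurable X]setTI.
exact: (emeasurable_fin_num measurableT (@measurable_id _ _ _)).
Qed.

Let mVp : measurable_fun setT (EFin \o cut_pos V).
Proof. by apply/measurable_EFinP; exact: measurable_cut_pos. Qed.

Let mVn : measurable_fun setT (EFin \o cut_neg V).
Proof. by apply/measurable_EFinP; exact: measurable_cut_neg. Qed.

Lemma measurable_fk : measurable_fun setT (fun z : measurableTypeR R * cadlag R X => fk z.1 z.2).
Proof.
apply: measurable_funM; last first.
  apply: (measurableT_comp g1_measurable).
  exact: (measurableT_comp (@measurable_path_at_all R X 1) measurable_snd).
apply: (measurableT_comp measurable_fine_expeR); apply: measurableT_comp => //.
have mid : measurable_fun setT (fun t : measurableTypeR R => t : R) by exact: measurable_id.
have mc1 : measurable_fun setT (fun t : measurableTypeR R => 1 : R) by exact: measurable_cst.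
apply: emeasurable_funB.
  exact: (@measurable_path_integral_joint R X _ (measurableTypeR R) id (cst 1) _ mid mc1 mVp
    (fun z => cut_pos_ge0 V z)).
exact: (@measurable_path_integral_joint R X _ (measurableTypeR R) id (cst 1) _ mid mc1 mVn
    (fun z => cut_neg_ge0 V z)).
Qed.

Lemma fk_between t : 0 <= t <= 1 -> forall B : set R, measurable B ->
  sigma_between t 1 (fk t @^-1` B).
Proof.
move=> /andP[t0 t1].
have mf : measurable_fun [set: between_type X t 1] (fk t).
  apply: measurable_funM; last first.
    apply: (measurableT_comp g1_measurable).
    by apply: measurable_path_between; rewrite t1 lexx.
  apply: (measurableT_comp measurable_fine_expeR); apply: measurableT_comp => //.
  apply: emeasurable_funB.
    exact: (@measurable_path_integral R X t 1 _ t0 mVp (fun z => cut_pos_ge0 V z)).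
  exact: (@measurable_path_integral R X t 1 _ t0 mVn (fun z => cut_neg_ge0 V z)).
by move=> B mB; have := mf measurableT B mB; rewrite setTI; exact.
Qed.

Section increments.
Variable w : cadlag R X.
Hypothesis Vw : (\int[lambda]_(s in `[0%R, 1%R]) `|cut V (s, w s)|%:E < +oo)%E.

Let phi r := cut V (r, w r).

Let mphi : measurable_fun setT phi.
Proof.
have mp : measurable_fun setT (fun r : measurableTypeR R => (r, w) : measurableTypeR R * cadlag R X).
  exact: pair2_measurable.
exact: (measurableT_comp (measurable_path_comp (measurable_cut V_measurable)) mp).
Qed.

Let iphi : lambda.-integrable `[0, 1] (EFin \o phi).
Proof.
apply/integrableP; split => //.
by apply: measurable_funTS; exact/measurable_EFinP.
Qed.

Let J r := \int[lambda]_(x in `[0, r]) phi x.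

(** The weight on [[r, 1]] is the exponential of the primitive from [0] times a factor depending on
    the path only, which is the form required by [expR_Rintegral]. *)
Lemma fk_expR r : 0 <= r <= 1 -> fk r w = expR (J r) * (expR (- J 1) * g1 (w 1)).
Proof.
move=> /andP[r0 r1]; rewrite /fk mulrA -expRD; congr (_ * _).
have ir : lambda.-integrable `[r, 1] (EFin \o phi).
  by apply: integrableS iphi => //; apply: subset_itv; rewrite bnd_simp.
have VE : (\int[lambda]_(s in `[r, 1%R]) (cut_pos V (s, w s))%:E -
           \int[lambda]_(s in `[r, 1%R]) (cut_neg V (s, w s))%:E =
           \int[lambda]_(s in `[r, 1%R]) (phi s)%:E)%E.
  rewrite [RHS]integralE; congr (_ - _)%E; apply: eq_integral => s _.
    by rewrite /cut_pos funeposE EFin_max.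
  by rewrite /cut_neg funenegE EFin_max.
rewrite VE -[X in expeR (- X)]fineK; last exact: integrable_fin_num ir.
rewrite -EFinN /=; congr expR.
rewrite /J (@Rintegral_itv_cat _ phi 0 r 1)//.
by rewrite opprD addrA subrr add0r.
Qed.

(** This is [expR_Rintegral] times a constant of the path. Positive and negative parts of [V] are
    kept apart so that Tonelli's theorem can be applied to each. *)
Lemma fk_increment s t : 0 <= s -> s <= t -> t <= 1 ->
  ((fk t w - fk s w)%:E =
   \int[lambda]_(r in `[s, t]) (cut_pos V (r, w r) * fk r w)%:E -
   \int[lambda]_(r in `[s, t]) (cut_neg V (r, w r) * fk r w)%:E)%E.
Proof.
move=> s0 st t1.
have s01 : 0 <= s <= 1 by rewrite s0 (le_trans st).
have t01 : 0 <= t <= 1 by rewrite t1 (le_trans s0).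
pose k := expR (- J 1) * g1 (w 1).
have k0 : 0 <= k by rewrite mulr_ge0// expR_ge0.
have fkr r : r \in (`[s, t]%classic : set R) -> fk r w = expR (J r) * k.
  rewrite inE/= in_itv/= => /andP[sr rt]; apply: fk_expR.
  by rewrite (le_trans s0 sr) (le_trans rt t1).
have iJ : lambda.-integrable `[s, t] (EFin \o (fun r => phi r * fk r w)).
  have ist : lambda.-integrable `[s, t] (EFin \o phi).
    by apply: integrableS iphi => //; apply: subset_itv; rewrite bnd_simp.
  have mfkw : measurable_fun setT (fun r : R => fk r w).
    have mp : measurable_fun setT (fun r : measurableTypeR R => (r, w) : measurableTypeR R * cadlag R X).
      exact: pair2_measurable.
    exact: (measurableT_comp measurable_fk mp).
  have iK := @integrableZl _ _ R lambda `[s, t] (measurable_itv _) (expR `|c| * g1 (w 1)) _ ist.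
  apply: le_integrable iK => //.
  - by apply: measurable_funTS; apply/measurable_EFinP; exact: measurable_funM.
  - move=> r _; rewrite /= lee_fin normrM [leRHS]normrM mulrC ler_wpM2r//.
    by rewrite (ger0_norm (fk_ge0 r w)) (le_trans (fk_le r w))// ler_norm.
have -> : (fk t w - fk s w)%:E = (\int[lambda]_(r in `[s, t]) (phi r * fk r w)%:E)%E.
  rewrite !fk_expR// -/k -mulrBl (expR_Rintegral iphi s0 st t1).
  rewrite -[RHS]fineK; last exact: integrable_fin_num iJ.
  congr EFin; rewrite -/(Rintegral _ _ _).
  (* For [k = 0] both sides vanish; otherwise division by [k] deduces the integrability of
     [phi r * expR (J r)] from that of [phi r * fk r w]. *)
  have [kE0|kN0] := eqVneq k 0.
    rewrite -/k kE0.
    rewrite mulr0 /Rintegral integral0_eq// => r rst.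
    by rewrite fkr ?inE// kE0 mulr0 mulr0.
  have iE : lambda.-integrable `[s, t] (EFin \o (fun r => phi r * expR (J r))).
    have := @integrableZl _ _ R lambda `[s, t] (measurable_itv _) k^-1 _ iJ.
    apply: eq_integrable => // r rst /=; rewrite fkr// -EFinM; congr EFin.
    by rewrite (mulrA (phi r)) mulrCA mulVf// mulr1.
  rewrite -RintegralZr//; apply: eq_Rintegral => r rst.
  by rewrite fkr// mulrA.
rewrite [LHS]integralE; congr (_ - _)%E; apply: eq_integral => r _.
  rewrite funeposE -EFin_max /cut_pos; congr EFin.
  by rewrite maxr_pMl ?fk_ge0// mul0r.
rewrite funenegE -EFin_max /cut_neg; congr EFin.
by rewrite maxr_pMl ?fk_ge0// mul0r mulNr.
Qed.

End increments.
End functional.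

Lemma sube_sub (R : numDomainType) (x y : \bar R) :
  x \is a fin_num -> y \is a fin_num -> (x - (x - y) = y)%E.
Proof. by move=> /fineK <- /fineK <-; rewrite -!EFinB opprB addrC subrK. Qed.

Lemma fine_sub_cat (R : realType) (a b c d : \bar R) :
  (a + b)%E \is a fin_num -> (c + d)%E \is a fin_num ->
  fine (a + b - (c + d))%E = fine (a - c)%E + (fine b - fine d).
Proof.
move: a b c d => [a| |] [b| |] [c| |] [d| |] //= _ _.
by rewrite opprD addrACA.
Qed.

Lemma uniformly_integrable_eq d (T : measurableType d) (R : realType)
    (mu : {measure set T -> \bar R}) (J : Type) (I : set J) (f f' : J -> T -> \bar R) :
  (forall i, I i -> f i = f' i) -> uniformly_integrable mu I f -> uniformly_integrable mu I f'.
Proof.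
move=> ff' [mf hf]; split; first by move=> i Ii; rewrite -ff'//; exact: mf.
by move=> e /hf[K hK]; exists K => i Ii; rewrite -ff'//; exact: hK.
Qed.

Section feynman_kac_bounds.
Variables (R : realType) (X : completePseudoMetricType R).
Variables (P : probability (cadlag R X) R) (m : probability (borelType X) R).
Variables (gamma : R -> \bar R) (V : R -> X -> R) (g1 : borelType X -> R) (c : R).
Hypothesis X_polish : polish X.
Hypothesis P_markov : is_markov P.
Hypothesis P_stationary : is_stationary P m.
Hypothesis gamma_admissible : admissible m g1 gamma.
Hypothesis V_measurable : measurable01 V.
Hypothesis V_lower : forall t x, 0 <= t <= 1 -> c <= V t x.
Hypothesis V_ui : uniformly_integrable m [set` `[(0:R), 1]]
  (fun t x => young_conj gamma (V t x)).
Hypothesis g1_ge0 : forall x, 0 <= g1 x.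
Hypothesis g1_measurable : measurable_fun setT g1.
Local Notation lambda := (@lebesgue_measure R).
Implicit Types (r s t : R) (w : cadlag R X) (x : borelType X).

Let young : young_function gamma.
Proof. by have [] := gamma_admissible. Qed.

Lemma terminal_integrable : P.-integrable setT (fun w => (g1 (w 1))%:E).
Proof.
have /integrableP[_ ig] := admissible_integrable gamma_admissible g1_measurable g1_ge0.
apply/integrableP; split.
  by apply/measurable_EFinP; apply: (measurableT_comp g1_measurable); exact: measurable_path_at_all.
apply: le_lt_trans ig.
rewrite -(ge0_integral_pathT P_stationary 1 (f := fun x => `|(g1 x)%:E|%E))//.
by apply: measurableT_comp => //; exact/measurable_EFinP.
Qed.

Let K0 := expR `|c|.

Lemma fk_integrable t : P.-integrable setT (EFin \o fk V g1 t).
Proof.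
have := @integrableZl _ _ R P setT measurableT K0 _ terminal_integrable.
apply: le_integrable => //.
  apply/measurable_EFinP.
  have mp : measurable_fun setT (fun w : cadlag R X => (t, w) : measurableTypeR R * cadlag R X).
    exact: pair1_measurable.
  exact: (measurableT_comp (measurable_fk V_measurable g1_measurable) mp).
move=> w _; rewrite -EFinM /= lee_fin (ger0_norm (fk_ge0 V g1_ge0 t w)).
by rewrite (le_trans (fk_le V_measurable V_lower g1_ge0 t w))// ler_norm.
Qed.

Lemma young_conj_bound : exists2 K : R, 0 <= K &
  forall t, 0 <= t <= 1 -> (\int[m]_x young_conj gamma (V t x) <= K%:E)%E.
Proof.
have [K hK] := uniformly_integrable_bounded V_ui.
have h t : 0 <= t <= 1 -> (\int[m]_x young_conj gamma (V t x) <= K%:E)%E.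
  move=> t01; apply: le_trans (hK t _); last by rewrite /= in_itv/=.
  by under [leRHS]eq_integral do rewrite gee0_abs ?young_conj_ge0//.
exists K => //; rewrite -lee_fin (le_trans _ (h 0 _)) ?lexx ?ler01//.
by apply: integral_ge0 => x _; exact: young_conj_ge0.
Qed.

(** Young's inequality for [V] and [a * |u|]; the bound is [(K + L) / a], with [K] from the uniform
    integrability of the conjugate function of [V]. It is used with [u = 1], for the integrability
    of [V] along paths, and with [u] the function [g]. *)
Lemma young_rate (u : measurableTypeR R * borelType X -> R) (a L : R) : 0 < a -> 0 <= L ->
  measurable_fun setT u ->
  (forall t, 0 <= t <= 1 -> (\int[m]_x gamma (a * `|u (t, x)|)%R <= L%:E)%E) ->
  exists C, is_rate m (fun z => `|cut V z| * `|u z|) C.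
Proof.
move=> a0 L0 mu hu; have [K Kp hK] := young_conj_bound.
have mV := measurable_cut V_measurable.
exists ((K + L) / a); split.
- by apply: measurable_funM; exact: measurableT_comp.
- by move=> z; rewrite mulr_ge0.
- by move=> z z01; rewrite cut_out// normr0 mul0r.
move=> t; have [t01|t01] := boolP (0 <= t <= 1); last first.
  rewrite integral0_eq; first by rewrite lee_fin divr_ge0 ?addr_ge0 ?(ltW a0).
  by move=> x _; rewrite cut_out ?normr0 ?mul0r//=; exact/negP.
have mut : measurable_fun setT (fun x => u (t, x)).
  by apply: (measurableT_comp mu); exact: pair1_measurable.
have mVt := measurable01_at V_measurable t01.
have mg : measurable_fun setT (fun x => gamma (a * `|u (t, x)|)%R).
  apply: (measurableT_comp (measurable_young young)).
  by apply: measurable_funM => //; exact: measurableT_comp.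
have mc : measurable_fun setT (fun x => young_conj gamma (V t x)).
  by have [h _] := V_ui; apply: h; rewrite /= in_itv.
rewrite EFinM lee_pdivlMr// -ge0_integralZr//; last 2 first.
- apply/measurable_EFinP; apply: measurable_funM; apply: measurableT_comp => //.
  by apply: (measurableT_comp mV); exact: pair1_measurable.
- by rewrite lee_fin ltW.
apply: (@le_trans _ _ (\int[m]_x (young_conj gamma (V t x) + gamma (a * `|u (t, x)|)%R))%E).
  apply: ge0_le_integral => //.
  - by move=> x _; rewrite -EFinM lee_fin mulr_ge0 ?mulr_ge0// ltW.
  - apply/measurable_EFinP; apply: measurable_funM => //.
    apply: measurable_funM; apply: measurableT_comp => //.
    by apply: (measurableT_comp mV); exact: pair1_measurable.
  - exact: emeasurable_funD.
  - move=> x _; rewrite -EFinM.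
    have au : 0 <= a * `|u (t, x)| by rewrite mulr_ge0// ltW.
    have := young_inequality young (V t x) au.
    suff -> : a * `|u (t, x)| * `|V t x| = `|cut V (t, x)| * `|u (t, x)| * a by [].
    by rewrite /cut /= t01; ring.
rewrite ge0_integralD//; last 2 first.
- by move=> x _; exact: young_conj_ge0.
- by move=> x _; exact: young_ge0.
by rewrite EFinD leeD ?hK ?hu.
Qed.

Lemma potential_rate : exists C, is_rate m (fun z => `|cut V z|) C.
Proof.
have [a a0 ga] := admissible_young_finite gamma_admissible.
have gfin : gamma a \is a fin_num by rewrite ge0_fin_numE// young_ge0.
have [|t01|C] := @young_rate (cst 1) a (fine (gamma a)) a0 _ (measurable_cst _).
- by apply: fine_ge0; exact: young_ge0.
- move=> _; under eq_integral do rewrite normr1 mulr1.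
  by rewrite integral_cst// [X in (_ * X)%E](@probability_setT _ _ _ m) mule1 fineK.
move=> h; exists C; move: h; congr is_rate; apply/funext => z; by rewrite normr1 mulr1.
Qed.

Lemma path_potential_integrable : {ae P, forall w,
  (\int[lambda]_(s in `[0%R, 1%R]) `|cut V (s, w s)|%:E < +oo)%E}.
Proof.
have [C hC] := potential_rate.
have [_] := integrable_path_occ P_stationary 0 hC (ler01 : 0 <= 1 :> R).
apply: filterS => w; rewrite /path_occ add0r => fw.
by rewrite -ge0_fin_numE//; apply: integral_ge0.
Qed.

(** [joint_cond_exp] gives a conditional mean given [X_t], nonnegative and measurable in [(t, x)];
    since the functional depends on [X_[t, 1]], the Markov property makes it a conditional mean
    given [X_[0, t]]. *)
Lemma feynman_kac_exists : exists2 g : R -> X -> R, feynman_kac P V g1 g &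
  forall t x, 0 <= t <= 1 -> 0 <= g t x.
Proof.
have mid : measurable_fun setT (fun t : measurableTypeR R => t : R) by exact: measurable_id.
have [y [my y0 hy]] := @joint_cond_exp R X P m X_polish P_stationary _ (measurableTypeR R) id
  (fk V g1) mid (measurable_fk V_measurable g1_measurable) (fk_ge0 V g1_ge0) fk_integrable.
exists y; last by move=> t x _; exact: y0.
split; first exact: measurable_funTS.
move=> t t01.
rewrite (_ : feynman_kac_functional V g1 t = fk V g1 t); last first.
  by apply/funext => w; exact: feynman_kac_functionalE.
apply: (markov_cond_exp P_markov t01 (fk_ge0 V g1_ge0 t) _ (hy t)).
exact: (fk_between V_measurable g1_measurable).
Qed.

(** * Properties of an arbitrary version [g] of the Feynman-Kac function *)

Section solution.
Variable g : R -> X -> R.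
Hypothesis g_fk : feynman_kac P V g1 g.

Lemma feynman_kac_cond_exp t : 0 <= t <= 1 ->
  is_cond_exp P (sigma_between 0 t) (fk V g1 t) (fun w => g t (w t)).
Proof.
move=> t01; have [_ /(_ t t01)] := g_fk.
rewrite (_ : feynman_kac_functional V g1 t = fk V g1 t)//.
by apply/funext => w; exact: feynman_kac_functionalE.
Qed.

Let sG t := @sigma_algebra_between R X 0 t.
Let GM t : t <= 1 -> @sigma_between R X 0 t `<=` measurable.
Proof. exact: sigma_between_measurable. Qed.

Lemma feynman_kac_path_ge0 t : 0 <= t <= 1 -> {ae P, forall w, 0 <= g t (w t)}.
Proof.
move=> t01; apply: (is_cond_exp_ge0 (sG t) (GM (andP t01).2) _ (feynman_kac_cond_exp t01)).
exact: fk_ge0.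
Qed.

Lemma feynman_kac_ge0 t : 0 <= t <= 1 -> {ae m, forall x, 0 <= g t x}.
Proof.
move=> t01; have mgt := measurable01_at g_fk.1 t01.
have mA : measurable [set x : borelType X | g t x < 0].
  by apply: measurable_ltr_set => //; exact: measurable_cst.
exists [set x | g t x < 0]; split => //; last first.
  by move=> x /= /negP; rewrite -ltNge.
rewrite -(path_lawE P_stationary t mA); have [N [mN PN hN]] := feynman_kac_path_ge0 t01.
apply/eqP; rewrite -measure_le0 -PN; apply: le_measure; rewrite ?inE//.
  by rewrite -[X in measurable X]setTI; exact: measurable_path_at_all.
by move=> w /= gw; apply: hN => /=; rewrite leNgt => /negP; exact.
Qed.

(** [K0 = exp |c|] bounds the exponential weight and [2] is the loss in [cond_jensen]: with this
    constant, the bound for [g t] is the integral of [gamma (g1)], the same for all [t]. *)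
Let a := (2 * K0)^-1.
Let a0 : 0 < a. Proof. by rewrite invr_gt0 mulr_gt0// expR_gt0. Qed.
Let Kg := fine (\int[m]_x gamma (g1 x)).

Lemma feynman_kac_young t : 0 <= t <= 1 ->
  (\int[m]_x gamma (a * `|g t x|)%R <= Kg%:E)%E.
Proof.
move=> t01; have [_ _ gfin _ _] := gamma_admissible.
have g0 : (0 <= \int[m]_x gamma (g1 x))%E by apply: integral_ge0 => x _; exact: young_ge0.
rewrite /Kg fineK ?ge0_fin_numE//.
have K00 : 0 < K0 by exact: expR_gt0.
have mgt := measurable01_at g_fk.1 t01.
have my := measurable_young young.
have ce := is_cond_expZ (sG t) (GM (andP t01).2) K0^-1 (feynman_kac_cond_exp t01).
have mY : measurable_fun setT (fk V g1 t).
  by have := measurable_int _ (fk_integrable t) => /measurable_EFinP.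
have le : (\int[P]_w gamma (K0^-1 * fk V g1 t w)%R <= \int[m]_x gamma (g1 x))%E.
  rewrite -(ge0_integral_pathT P_stationary 1 (f := fun x => gamma (g1 x))); last 2 first.
  - exact: (measurableT_comp my).
  - by move=> x; exact: young_ge0.
  apply: ge0_le_integral => //.
  - by move=> w _; exact: young_ge0.
  - by apply: (measurableT_comp my); exact: measurable_funM.
  - apply: (measurableT_comp my); apply: (measurableT_comp g1_measurable).
    exact: measurable_path_at_all.
  - move=> w _; apply: young_mono => //; first by rewrite mulr_ge0 ?fk_ge0// invr_ge0 ltW.
    by rewrite ler_pdivrMl// (fk_le V_measurable V_lower g1_ge0).
have := cond_jensen young (sG t) (GM (andP t01).2) ce.
have Ki : 0 <= K0^-1 by rewrite invr_ge0 ltW.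
move=> /(_ (fun w => mulr_ge0 Ki (fk_ge0 V g1_ge0 t w))).
move=> /(_ (le_lt_trans le gfin)) h.
apply: le_trans (le_trans h le).
rewrite -(ge0_integral_pathT P_stationary t (f := fun x => gamma (a * `|g t x|)%R)); last 2 first.
- apply: (measurableT_comp my); apply: measurable_funM => //; exact: measurableT_comp.
- by move=> x; exact: young_ge0.
rewrite le_eqVlt; apply/orP; left; apply/eqP; apply: eq_integral => w _.
rewrite -[RHS](young_norm young) !normrM ger0_norm ?invr_ge0 ?(ltW K00)//.
have h2 : `|2^-1| = 2^-1 :> R by rewrite ger0_norm// invr_ge0.
rewrite h2; congr gamma; rewrite /a invfM; ring.
Qed.

Lemma feynman_kac_rate : exists C, is_rate m (fun z => `|cut V z| * `|cut g z|) C.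
Proof.
apply: (young_rate a0 (L := Kg)).
- by apply: fine_ge0; apply: integral_ge0 => x _; exact: young_ge0.
- exact: measurable_cut g_fk.1.
- by move=> t t01; rewrite /cut/= t01; exact: feynman_kac_young.
Qed.

Definition Vg t (x : X) : R := V t x * g t x.

Lemma cut_Vg z : cut Vg z = cut V z * cut g z.
Proof. by rewrite /cut; case: ifP => // _; rewrite mulr0. Qed.

Lemma measurable_Vg : measurable01 Vg.
Proof.
apply: (@measurable_funM _ _ _ _ (time_space V) (time_space g)); first exact: V_measurable.
exact: g_fk.1.
Qed.

Lemma Vg_rates : exists C, is_rate m (cut_pos Vg) C /\ is_rate m (cut_neg Vg) C.
Proof.
have [C hC] := feynman_kac_rate.
exists C; split; apply: (rate_le hC).
- by apply: measurable_cut_pos; exact: measurable_Vg.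
- by move=> z; rewrite cut_pos_ge0 -normrM -cut_Vg cut_pos_le.
- by apply: measurable_cut_neg; exact: measurable_Vg.
- by move=> z; rewrite cut_neg_ge0 -normrM -cut_Vg cut_neg_le.
Qed.

Definition compensator s t w : R :=
  fine (path_occ (cut_pos Vg) s (t - s) w) - fine (path_occ (cut_neg Vg) s (t - s) w).

(** [W (r, X_r)] is known at time [r], so it can be pulled out and [fk] at time [r] replaced by its
    conditional mean. [Wg] is compared with [W * g] only where [g >= 0]: this holds almost surely,
    and there the parts of [V * g] are those of [V] times [g]. *)
Lemma weight_pull (W Wg : measurableTypeR R * borelType X -> R) s r A : 0 <= s -> s <= r -> r <= 1 ->
  measurable_fun setT W -> (forall z, 0 <= W z) ->
  measurable_fun setT Wg ->
  (forall x, 0 <= g r x -> Wg (r, x) = W (r, x) * g r x) ->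
  sigma_between 0 s A ->
  (\int[P]_(w in A) (W (r, w r) * fk V g1 r w)%:E = \int[P]_(w in A) (Wg (r, w r))%:E)%E.
Proof.
move=> s0 sr r1 mW W0 mWg WgE As.
have r01 : 0 <= r <= 1 by rewrite r1 (le_trans s0).
have Ar : sigma_between 0 r A by exact: (sigma_between_mono (lexx 0) sr).
have mA : measurable A := GM r1 Ar.
have mWr : measurable_fun setT (fun x => W (r, x)).
  by apply: (measurableT_comp mW); exact: pair1_measurable.
have mWgr : measurable_fun setT (fun x => Wg (r, x)).
  by apply: (measurableT_comp mWg); exact: pair1_measurable.
have mpr : measurable_fun [set: between_type X 0 r] (path_at r).
  by apply: measurable_path_between; have /andP[-> _] := r01; exact: lexx.
pose w' w := \1_A w * W (r, w r).
have w'0 w : 0 <= w' w.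
  by rewrite mulr_ge0//; have /andP[] := indic_ge0_le1 R A w.
have mw' : forall B : set R, measurable B -> sigma_between 0 r (w' @^-1` B).
  have mm : measurable_fun [set: between_type X 0 r] w'.
    apply: measurable_funM; first exact: (@measurable_indic _ (between_type X 0 r) R setT A Ar).
    exact: (measurableT_comp mWr mpr).
  by move=> B mB; have := mm measurableT B mB; rewrite setTI.
have := is_cond_exp_pull (sG r) (GM r1) (feynman_kac_cond_exp r01) (fk_ge0 V g1_ge0 r) (feynman_kac_path_ge0 r01) w'0 mw'.
have E u : (\int[P]_w (w' w * u w)%:E = \int[P]_(w in A) (W (r, w r) * u w)%:E)%E.
  rewrite [RHS]integral_mkcond; apply: eq_integral => w _.
  rewrite patchE /w' indicE; case: ifP => _; rewrite ?mul1r// !mul0r//.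
rewrite !E => ->.
have mpT : measurable_fun setT (fun w : cadlag R X => w r : borelType X).
  exact: measurable_path_at_all.
apply: ae_eq_integral => //.
- apply: measurable_funTS; apply/measurable_EFinP; apply: measurable_funM.
    exact: (measurableT_comp mWr mpT).
  exact: (measurableT_comp (measurable01_at g_fk.1 r01) mpT).
- by apply: measurable_funTS; apply/measurable_EFinP; exact: (measurableT_comp mWgr mpT).
- by apply: filterS (feynman_kac_path_ge0 r01) => w gw _; rewrite WgE.
Qed.

Lemma weight_occ (W Wg : measurableTypeR R * borelType X -> R) s t A : 0 <= s -> s <= t -> t <= 1 ->
  measurable_fun setT W -> (forall z, 0 <= W z) ->
  measurable_fun setT Wg -> (forall z, 0 <= Wg z) ->
  (forall r x, 0 <= r <= 1 -> 0 <= g r x -> Wg (r, x) = W (r, x) * g r x) ->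
  sigma_between 0 s A ->
  (\int[P]_(w in A) \int[lambda]_(r in `[s, t]) (W (r, w r) * fk V g1 r w)%:E =
   \int[P]_(w in A) path_occ Wg s (t - s) w)%E.
Proof.
move=> s0 st t1 mW W0 mWg Wg0 WgE As.
have mA : measurable A by exact: (GM (le_trans st t1)).
have msw := @measurable_swap _ _ (cadlag R X) (measurableTypeR R).
have mF1 : measurable_fun setT
    (fun z : cadlag R X * measurableTypeR R => (W (z.2, z.1 z.2) * fk V g1 z.2 z.1)%:E).
  apply/measurable_EFinP; apply: measurable_funM.
    exact: (measurableT_comp (measurable_path_comp mW) msw).
  exact: (measurableT_comp (measurable_fk V_measurable g1_measurable) msw).
have mF2 : measurable_fun setT
    (fun z : cadlag R X * measurableTypeR R => (Wg (z.2, z.1 z.2))%:E).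
  by apply/measurable_EFinP; exact: (measurableT_comp (measurable_path_comp mWg) msw).
have F10 z : (0 <= (fun z : cadlag R X * measurableTypeR R => (W (z.2, z.1 z.2) * fk V g1 z.2 z.1)%:E) z)%E.
  by rewrite lee_fin mulr_ge0// fk_ge0.
have F20 z : (0 <= (fun z : cadlag R X * measurableTypeR R => (Wg (z.2, z.1 z.2))%:E) z)%E.
  by rewrite lee_fin.
rewrite (@tonelli_in _ _ _ _ R P lambda A `[s, t] _ mA (measurable_itv _) mF1 F10).
rewrite /path_occ subrKC.
rewrite (@tonelli_in _ _ _ _ R P lambda A `[s, t] _ mA (measurable_itv _) mF2 F20).
apply: eq_integral => r; rewrite inE/= in_itv/= => /andP[sr rt].
have r1 := le_trans rt t1.
apply: (weight_pull s0) => // x gx; apply: WgE => //.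
by rewrite r1 (le_trans s0).
Qed.

Let Vg_pos r x : 0 <= r <= 1 -> 0 <= g r x -> cut_pos Vg (r, x) = cut_pos V (r, x) * g r x.
Proof. by move=> r01 gx; rewrite /cut_pos /cut /= r01 maxr_pMl// mul0r. Qed.

Let Vg_neg r x : 0 <= r <= 1 -> 0 <= g r x -> cut_neg Vg (r, x) = cut_neg V (r, x) * g r x.
Proof. by move=> r01 gx; rewrite /cut_neg /cut /= r01 maxr_pMl// mul0r mulNr. Qed.

Lemma compensator_integrable s t : s <= t -> P.-integrable setT (EFin \o compensator s t).
Proof.
move=> st; have [C [Cp Cn]] := Vg_rates; have ts0 : 0 <= t - s by rewrite subr_ge0.
have [ip _] := integrable_path_occ P_stationary s Cp ts0.
have [in_ _] := integrable_path_occ P_stationary s Cn ts0.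
have := integrableB measurableT ip in_.
by congr (P.-integrable _ _); apply/funext => w /=; rewrite EFinB.
Qed.

(** Integrate the pathwise identity [fk_increment] over an event of the past of [s]. The left side
    gives the conditional means [g t] and [g s]; on the right, [weight_occ] replaces [V * fk] by
    [V * g]. All integrals are finite, so the terms can be rearranged. *)
Lemma feynman_kac_increment s t : 0 <= s -> s <= t -> t <= 1 ->
  is_cond_exp P (sigma_between 0 s) (fun w => g t (w t) - compensator s t w)
    (fun w => g s (w s)).
Proof.
move=> s0 st t1.
have s01 : 0 <= s <= 1 by rewrite s0 (le_trans st).
have t01 : 0 <= t <= 1 by rewrite t1 (le_trans s0).
have ts0 : 0 <= t - s by rewrite subr_ge0.
have [C [Cp Cn]] := Vg_rates.
have [ip finp] := integrable_path_occ P_stationary s Cp ts0.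
have [in_ finn] := integrable_path_occ P_stationary s Cn ts0.
have ic := compensator_integrable st.
have [ift igt _ egt] := feynman_kac_cond_exp t01; have [ifs igs mgs egs] := feynman_kac_cond_exp s01.
have igc : P.-integrable setT (EFin \o (fun w => g t (w t) - compensator s t w)).
  have := integrableB measurableT igt ic.
  by congr (P.-integrable _ _); apply/funext => w /=; rewrite EFinB.
split => // A As.
have mA : measurable A := GM (le_trans st t1) As.
have At : sigma_between 0 t A by exact: (sigma_between_mono (lexx 0) st).
have iA f : P.-integrable setT f -> P.-integrable A f by exact: integrableS.
rewrite (egs A As).
under [RHS]eq_integral do rewrite EFinB.
rewrite integralB_EFin//; [|exact: iA..].
rewrite (egt A At).
have mVp := measurable_cut_pos V_measurable; have mVn := measurable_cut_neg V_measurable.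
have mvp := measurable_cut_pos measurable_Vg; have mvn := measurable_cut_neg measurable_Vg.
have Ep := weight_occ s0 st t1 mVp (cut_pos_ge0 V) mvp (cut_pos_ge0 Vg) Vg_pos.
have En := weight_occ s0 st t1 mVn (cut_neg_ge0 V) mvn (cut_neg_ge0 Vg) Vg_neg.
pose Hp w := (\int[lambda]_(r in `[s, t]) (cut_pos V (r, w r) * fk V g1 r w)%:E)%E.
pose Hn w := (\int[lambda]_(r in `[s, t]) (cut_neg V (r, w r) * fk V g1 r w)%:E)%E.
have mH (W : measurableTypeR R * borelType X -> R) : measurable_fun setT W ->
    (forall z, 0 <= W z) -> measurable_fun setT
    (fun w : cadlag R X => \int[lambda]_(r in `[s, t]) (W (r, w r) * fk V g1 r w)%:E)%E.
  move=> mW W0.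
  have msw := @measurable_swap _ _ (cadlag R X) (measurableTypeR R).
  have mF : measurable_fun setT
      (fun z : cadlag R X * measurableTypeR R => (W (z.2, z.1 z.2) * fk V g1 z.2 z.1)%:E).
    apply/measurable_EFinP; apply: measurable_funM.
      exact: (measurableT_comp (measurable_path_comp mW) msw).
    exact: (measurableT_comp (measurable_fk V_measurable g1_measurable) msw).
  apply: (@measurable_integral_in _ _ _ _ R lambda `[s, t] _ (measurable_itv _) mF) => z.
  by rewrite lee_fin mulr_ge0// fk_ge0.
have iH (W Wg : measurableTypeR R * borelType X -> R) C' : (forall z, 0 <= W z) -> measurable_fun setT W -> is_rate m Wg C' ->
    (forall A, sigma_between 0 s A ->
     \int[P]_(w in A) \int[lambda]_(r in `[s, t]) (W (r, w r) * fk V g1 r w)%:E =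
     \int[P]_(w in A) path_occ Wg s (t - s) w)%E ->
    P.-integrable setT (fun w => \int[lambda]_(r in `[s, t]) (W (r, w r) * fk V g1 r w)%:E)%E.
  move=> W0 mW rW E; apply/integrableP; split; first exact: mH.
  have H0 w : (0 <= \int[lambda]_(r in `[s, t]) (W (r, w r) * fk V g1 r w)%:E)%E.
    by apply: integral_ge0 => r _; rewrite lee_fin mulr_ge0// fk_ge0.
  under eq_integral do rewrite gee0_abs//.
  have sT : sigma_between 0 s [set: cadlag R X].
    by have [u0 uD _] := sG s; rewrite -[setT]setD0; exact: uD.
  rewrite E//; apply: (@le_lt_trans _ _ (C' * (t - s))%:E); last exact: ltry.
  exact: (integral_path_occ_le P_stationary s rW).
have iHp : P.-integrable setT Hp := iH _ _ C (cut_pos_ge0 V) mVp Cp (fun A => @Ep A).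
have iHn : P.-integrable setT Hn := iH _ _ C (cut_neg_ge0 V) mVn Cn (fun A => @En A).
have EF : (\int[P]_(w in A) (fk V g1 t w)%:E - \int[P]_(w in A) (fk V g1 s w)%:E =
    \int[P]_(w in A) Hp w - \int[P]_(w in A) Hn w)%E.
  rewrite -integralB_EFin//; [|exact: iA..].
  rewrite -integralB//; [|exact: iA..].
  apply: ae_eq_integral => //.
  - by have := iA _ (integrableB measurableT ift ifs); exact: measurable_int.
  - by have := iA _ (integrableB measurableT iHp iHn); exact: measurable_int.
  - have := path_potential_integrable.
    apply: filterS => w Vw _.
    exact: (fk_increment V_measurable V_lower g1_measurable g1_ge0 Vw s0 st t1).
have EC : (\int[P]_(w in A) (compensator s t w)%:E =
    \int[P]_(w in A) Hp w - \int[P]_(w in A) Hn w)%E.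
  under eq_integral do rewrite EFinB.
  rewrite integralB_EFin//; [|exact: iA..].
  have fineE (W : measurableTypeR R * borelType X -> R) : is_rate m W C ->
      P.-integrable setT (EFin \o (fun w => fine (path_occ W s (t - s) w))) ->
      {ae P, forall w, path_occ W s (t - s) w \is a fin_num} ->
      (\int[P]_(w in A) (fine (path_occ W s (t - s) w))%:E =
       \int[P]_(w in A) path_occ W s (t - s) w)%E.
    move=> WC iW finW; apply: ae_eq_integral => //.
    - by apply: measurable_int; exact: iA iW.
    - by apply: measurable_funTS; exact: (measurable_path_occ _ _ WC).
    - by apply: filterS finW => w fw _; rewrite fineK.
  rewrite /Hp (Ep A As) /Hn (En A As).
  by congr (_ - _)%E; [exact: fineE Cp ip finp|exact: fineE Cn in_ finn].
rewrite EC -EF.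
have fint := integrable_fin_num mA (iA _ ift); have fins := integrable_fin_num mA (iA _ ifs).
exact: (esym (sube_sub fint fins)).
Qed.

(** * The martingale of the extended generator *)

Definition drift t w : R := \int[lambda]_(s in `[0, t]) Vg s (w s).

Definition fk_martingale t w : R := g t (w t) - g 0 (w 0) - drift t w.

Lemma drift_between t : t <= 1 -> forall B : set R, measurable B ->
  sigma_between 0 t (drift t @^-1` B).
Proof.
move=> t1; have mI := measurable_path_cut_integral measurable_Vg (lexx 0) t1.
have mD : measurable_fun [set: between_type X 0 t] (drift t).
  by apply: (measurableT_comp _ mI).
by move=> B mB; have := mD measurableT B mB; rewrite setTI; exact.
Qed.

Lemma measurable_drift t : t <= 1 -> measurable_fun setT (drift t).
Proof. by move=> t1; exact: (sub_measurable_fun (GM t1) (drift_between t1)). Qed.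

Lemma drift_occ t w : t <= 1 ->
  drift t w = fine (path_occ (cut_pos Vg) 0 t w - path_occ (cut_neg Vg) 0 t w)%E.
Proof. by move=> t1; rewrite /drift /Rintegral path_integral_cut// /path_occ add0r. Qed.

(** Additivity of the integral, on the paths for which the positive and negative parts have finite
    integrals; on the others, the default values of [fine] could break it. *)
Lemma drift_compensator s t : 0 <= s -> s <= t -> t <= 1 ->
  {ae P, forall w, drift t w = drift s w + compensator s t w}.
Proof.
move=> s0 st t1; have [C [Cp Cn]] := Vg_rates.
have t0 := le_trans s0 st; have ts0 : 0 <= t - s by rewrite subr_ge0.
have [_ finp] := integrable_path_occ P_stationary 0 Cp t0.
have [_ finn] := integrable_path_occ P_stationary 0 Cn t0.
have catE W w : is_rate m W C ->
    path_occ W 0 t w = (path_occ W 0 s w + path_occ W s (t - s) w)%E.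
  by move=> WC; have := path_occ_cat WC 0 w s0 ts0; rewrite subrKC add0r.
apply: filterS2 finp finn => w; rewrite !drift_occ ?(le_trans st)//.
rewrite (catE _ w Cp) (catE _ w Cn) => fp fn.
exact: (fine_sub_cat fp fn).
Qed.

Lemma drift0 w : drift 0 w = 0.
Proof. by rewrite /drift /Rintegral set_itv1 integral_set1. Qed.

Lemma drift_integrable t : 0 <= t <= 1 -> P.-integrable setT (EFin \o drift t).
Proof.
move=> /andP[t0 t1].
have ic := compensator_integrable t0.
apply: (integrable_ae_eq ic); first exact: measurable_drift.
by apply: filterS (drift_compensator (lexx 0) t0 t1) => w ->; rewrite drift0 add0r.
Qed.

Let initial_between s : 0 <= s -> forall B : set R, measurable B ->
  sigma_between 0 s ((fun w : cadlag R X => g 0 (w 0)) @^-1` B).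
Proof.
move=> s0 B mB; have z01 : 0 <= (0 : R) <= 1 by rewrite lexx ler01.
have [_ _ h _] := feynman_kac_cond_exp z01.
exact: (sigma_between_mono (lexx 0) s0 (h B mB)).
Qed.

Lemma fk_martingale_integrable t : 0 <= t <= 1 -> P.-integrable setT (EFin \o fk_martingale t).
Proof.
move=> t01; have z01 : 0 <= (0 : R) <= 1 by rewrite lexx ler01.
have [_ it _ _] := feynman_kac_cond_exp t01; have [_ i0 _ _] := feynman_kac_cond_exp z01.
have := integrableB measurableT (integrableB measurableT it i0) (drift_integrable t01).
by congr (P.-integrable _ _); apply/funext => w /=; rewrite /fk_martingale !EFinB.
Qed.

(** Subtract from [feynman_kac_increment] the variable [Q = g 0 (X_0) + drift s], known at time
    [s]. *)
Lemma fk_martingaleP : martingale P fk_martingale.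
Proof.
move=> s t s0 st t1.
have s01 : 0 <= s <= 1 by rewrite s0 (le_trans st).
have t01 : 0 <= t <= 1 by rewrite t1 (le_trans s0).
have s1 := le_trans st t1.
have z01 : 0 <= (0 : R) <= 1 by rewrite lexx ler01.
have core := feynman_kac_increment s0 st t1.
pose Q w := g 0 (w 0) + drift s w.
have [_ i0 _ _] := feynman_kac_cond_exp z01.
have iQ : P.-integrable setT (EFin \o Q).
  by have := integrableD measurableT i0 (drift_integrable s01); congr (P.-integrable _ _).
have QQ : is_cond_exp P (sigma_between 0 s) Q Q.
  by split => //; exact: (sub_measurable_funD (sG s) (initial_between s0) (drift_between s1)).
have := is_cond_expB (sG s) (GM s1) core QQ.
have -> : (fun w => g s (w s) - Q w) = fk_martingale s.
  by apply/funext => w; rewrite /Q /fk_martingale opprD addrA.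
move=> /(is_cond_exp_ae (GM s1)); apply.
  by have /measurable_int/measurable_EFinP := fk_martingale_integrable t01.
apply: filterS (drift_compensator s0 st t1) => w.
by rewrite /fk_martingale /Q => ->; ring.
Qed.

(** The martingale is closed by its value at time [1]: all its values are conditional means of one
    integrable variable. *)
Lemma ui_martingale_fk : ui_martingale P fk_martingale.
Proof.
split; first exact: fk_martingaleP.
have o01 : 0 <= (1 : R) <= 1 by rewrite lexx ler01.
have i1 := fk_martingale_integrable o01.
apply: (@cond_exp_uniformly_integrable _ _ R P R [set` `[(0:R), 1]]
  (fun t => sigma_between 0 t) (fun=> fk_martingale 1) fk_martingale
  (fun w => `|fk_martingale 1 w|)).
- by move=> t _; exact: sG.
- by move=> t /=; rewrite in_itv/= => /andP[_ t1]; exact: GM.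
- by move=> t /=; rewrite in_itv/= => /andP[t0 t1]; exact: fk_martingaleP.
- exact: (integrable_norm i1).
- by [].
Qed.

(** All the functionals are dominated by [exp |c| * g1 (X_1)], so their conditional means are
    uniformly integrable. Hence the constant times [1] and [+oo] are integration times of [g]. *)
Lemma uniformly_integrable_solution :
  uniformly_integrable P [set` `[(0:R), 1]] (fun t w => (g t (w t))%:E).
Proof.
apply: (@cond_exp_uniformly_integrable _ _ R P R [set` `[(0:R), 1]]
  (fun t => sigma_between 0 t) (fk V g1) (fun t w => g t (w t))
  (fun w => expR `|c| * g1 (w 1))).
- by move=> t _; exact: sG.
- by move=> t /=; rewrite in_itv/= => /andP[_ t1]; exact: GM.
- by move=> t /=; rewrite in_itv/=; exact: feynman_kac_cond_exp.
- have := terminal_integrable.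
  move=> /(@integrableZl _ _ R P setT measurableT (expR `|c|)).
  by congr (P.-integrable _ _).
- move=> t w _; rewrite ger0_norm ?fk_ge0//.
  exact: (fk_le V_measurable V_lower).
Qed.

Lemma stop_time_infty t w : stop (fun=> +oo%E) t w = t.
Proof. by rewrite /stop (min_idPl _)// leey. Qed.

Lemma stopping_time_infty : @stopping_time R X (fun=> +oo%E).
Proof.
split; first by move=> w; right.
move=> t _; rewrite (_ : [set _ | _] = set0); first by have [] := sG t.
by apply/seteqP; split => w.
Qed.

(** The compensated process is a uniformly integrable martingale without any stopping, so the
    constant sequence [+oo] localizes it. *)
Lemma extended_generator_fk : is_extended_generator P g Vg.
Proof.
split.
- exact: g_fk.1.
- exact: measurable_Vg.
- have [C hC] := feynman_kac_rate.
  have [_] := integrable_path_occ P_stationary 0 hC (ler01 : 0 <= 1 :> R).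
  apply: filterS => w; rewrite /path_occ add0r => fw.
  rewrite (_ : integral _ _ _ = \int[lambda]_(r in `[0%R, 1%R]) (`|cut V (r, w r)| * `|cut g (r, w r)|)%:E)%E.
    rewrite -ge0_fin_numE//; apply: integral_ge0 => r _; rewrite lee_fin mulr_ge0//.
  apply: eq_integral => r; rewrite inE/= in_itv/= => r01.
  by rewrite -normrM /cut/= r01.
- exists (fun _ _ => +oo%E); split => [k| |k].
  + exact: stopping_time_infty.
  + by apply: aeW => w; exact: cvg_cst.
  + rewrite (_ : (fun t w => _) = fk_martingale); first exact: ui_martingale_fk.
    by apply/funext => t; apply/funext => w; rewrite stop_time_infty.
Qed.

(** * The stochastic derivative *)

Let g_ui := uniformly_integrable_solution.

(** [occupation] integrates the law of [X_t], which is [m], over [[0, 1]] only; the other times can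
    be added to the null set. *)
Lemma occupation_ae (Q : measurableTypeR R * borelType X -> Prop) :
  {ae (lambda \x m)%E, forall z, 0 <= z.1 <= 1 -> Q z} -> {ae occupation P, forall z, Q z}.
Proof.
move=> [N [mN N0 hN]].
exists (N `|` ~` @I01X R X); split; last 1 first.
- move=> z /= nQ; have [z01|z01] := boolP (0 <= z.1 <= 1).
    by left; apply: hN => /= /(_ z01).
  by right => -[]; rewrite /= in_itv/= (negbTE z01).
- by apply: measurableU => //; apply: measurableC; exact: measurable_I01X.
- apply/eqP; rewrite eq_le; apply/andP; split; last first.
    by apply: integral_ge0 => t _; exact: measure_ge0.
  rewrite -N0 /product_measure1 /occupation.
  apply: (@le_trans _ _ (\int[lambda]_(t in `[0%R, 1%R]) m (xsection N t))%E); last first.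
    apply: ge0_subset_integral => //; exact: measurable_fun_xsection.
  rewrite le_eqVlt; apply/orP; left; apply/eqP; apply: eq_integral => t.
  rewrite inE/= in_itv/= => t01.
  rewrite -(path_lawE P_stationary t); last exact: measurable_xsection.
  congr (P _); apply/seteqP; split => w /=; rewrite /xsection/= inE.
    by case=> // h; exfalso; apply: h; split => //=; rewrite in_itv/= t01.
  by left.
Qed.

Lemma stop_time_one t w : t <= 1 -> stop (fun=> 1%:E) t w = t.
Proof. by move=> t1; rewrite /stop (min_idPl _)// lee_fin. Qed.

Lemma integration_time_infty : integration_time P g (fun=> +oo%E).
Proof.
split; first exact: stopping_time_infty.
by apply: uniformly_integrable_eq g_ui => t _; apply/funext => w; rewrite stop_time_infty.
Qed.

Lemma integration_time_one : integration_time P g (fun=> 1%:E).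
Proof.
split.
  split; first by move=> w; left; rewrite !lee_fin lexx ler01.
  move=> t t01; rewrite lee_fin; have [h0 hC _] := @sigma_algebra_between R X 0 t.
  case: (1 <= t); last by rewrite (_ : [set _ | _] = set0) ?h0//; apply/seteqP; split.
  rewrite (_ : [set _ | _] = setT); last by apply/seteqP; split.
  by rewrite -[setT]setD0; exact: hC.
apply: uniformly_integrable_eq g_ui => t /=; rewrite in_itv/= => /andP[_ t1].
by apply/funext => w; rewrite stop_time_one.
Qed.

Lemma integrable_increment_rate tau t h : 0 <= t -> 0 < h -> t + h <= 1 ->
  integration_time P g tau -> P.-integrable setT (EFin \o increment_rate g tau t h).
Proof.
move=> t0 h0 th [_ ui].
have t1 : t <= 1 by rewrite (le_trans _ th)// lerDl ltW.
have i1 := uniformly_integrable_integrable (i := t + h) ui.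
have i2 := uniformly_integrable_integrable (i := t) g_ui.
rewrite /= !in_itv/= in i1 i2.
have {}i1 := i1 (introT andP (conj (addr_ge0 t0 (ltW h0)) th)).
have {}i2 := i2 (introT andP (conj t0 t1)).
have := @integrableZl _ _ R P setT measurableT h^-1 _ (integrableB measurableT i1 i2).
by congr (P.-integrable _ _).
Qed.

(** A stopping time takes its values in [[0, 1]] or equals [+oo], so [tau > 1] means that the
    increment is not stopped. Its conditional mean is that of the compensator, by
    [feynman_kac_increment] restricted from the past [X_[0, t]] to [X_t]. *)
Lemma cond_exp_increment_rate q q' tau t h : is_transition P (cut_pos Vg) q ->
  is_transition P (cut_neg Vg) q' -> 0 <= t -> 0 < h -> t + h <= 1 ->
  integration_time P g tau -> {ae P, forall w, (1%:E < tau w)%E} ->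
  cond_exp_at P t (increment_rate g tau t h)
    (fun x => h^-1 * (fine (trans_occ q t h x) - fine (trans_occ q' t h x))).
Proof.
move=> pq nq t0 h0 th it tau1; have [C [Cp Cn]] := Vg_rates; have hh := ltW h0.
have t1 : t <= 1 by rewrite (le_trans _ th)// lerDl.
have t01 : 0 <= t <= 1 by rewrite t0.
have sA := sigma_algebra_at X t; have AM := @sigma_at_sub_measurable R X t.
have tth : t <= t + h by rewrite lerDl.
have core := feynman_kac_increment t0 tth th.
have [[mp cp] _] := cond_exp_trans_occ P_stationary t Cp pq hh.
have [[mn cn] _] := cond_exp_trans_occ P_stationary t Cn nq hh.
split; first by apply: measurable_funM => //; exact: measurable_funB.
have mgt := measurable01_at g_fk.1 t01.
have gt_at : forall B : set R, measurable B -> sigma_at t ((fun w : cadlag R X => g t (w t)) @^-1` B).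
  move=> B mB; exists (g t @^-1` B); last by rewrite setTI.
  by rewrite -[X in measurable X]setTI; exact: mgt.
have sub : @sigma_at R X t `<=` sigma_between 0 t.
  by apply: sigma_at_between; rewrite t0 lexx.
have [ic ig _ eg] := core.
have core_at : is_cond_exp P (sigma_at t) (fun w => g (t + h) (w (t + h)) - compensator t (t + h) w)
    (fun w => g t (w t)).
  by split => // A At; apply: eg; exact: sub.
have gg : is_cond_exp P (sigma_at t) (fun w => g t (w t)) (fun w => g t (w t)) by split.
have cc := is_cond_expB sA AM cp cn.
have := is_cond_expZ sA AM h^-1 (is_cond_expB sA AM (is_cond_expD sA AM core_at cc) gg).
have -> : (fun w : cadlag R X => h^-1 * (g t (w t) + (fine (trans_occ q t h (path_at t w)) -
    fine (trans_occ q' t h (path_at t w))) - g t (w t))) =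
    (fun w => h^-1 * (fine (trans_occ q t h (path_at t w)) - fine (trans_occ q' t h (path_at t w)))).
  by apply/funext => w; rewrite addrAC subrr add0r.
move=> /(is_cond_exp_ae AM); apply.
  by have /measurable_int/measurable_EFinP := integrable_increment_rate t0 h0 th it.
apply: filterS tau1 => w tw; have tau_oo : tau w = +oo%E.
  have [[tau01 _] _] := it; have [/andP[_]|//] := tau01 w.
  by rewrite leNgt tw.
rewrite /increment_rate; congr (_ * _).
have -> : stop tau (t + h) w = t + h by rewrite /stop tau_oo (min_idPl _)// leey.
have -> : compensator t (t + h) w =
    fine (path_occ (cut_pos Vg) t h w) - fine (path_occ (cut_neg Vg) t h w).
  have hE : t + h - t = h by rewrite addrAC subrr add0r.
  by rewrite -[in RHS]hE.
by rewrite subrK.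
Qed.

Lemma stochastic_derivative_fk : is_stochastic_derivative P g Vg.
Proof.
have [C [Cp Cn]] := Vg_rates.
have [q pq] := is_transition_exists X_polish P_stationary Cp.
have [q' nq] := is_transition_exists X_polish P_stationary Cn.
split; first exact: g_fk.1.
(* A version must be supplied for every integration time [tau >= t], including those that are not
   almost surely beyond [1]; for these any version will do, since with [sigma = 1] they never enter
   the limit. *)
pose version t (Y : cadlag R X -> R) : borelType X -> R :=
  if pselect (exists y, cond_exp_at P t Y y) is left e then projT1 (cid e) else cst 0.
have versionP t Y : P.-integrable setT (EFin \o Y) -> cond_exp_at P t Y (version t Y).
  move=> /(cond_exp_at_exists X_polish P_stationary t) ex.
  by rewrite /version; case: pselect => // e; exact: projT2 (cid e).
exists (fun t tau h => if `[< {ae P, forall w, (1%:E < tau w)%E} >] then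
    (fun x => h^-1 * (fine (trans_occ q t h x) - fine (trans_occ q' t h x)))
  else version t (increment_rate g tau t h)); split.
  move=> t tau h t0 h0 th it _; case: asboolP => tau1; first exact: cond_exp_increment_rate.
  by apply: versionP; exact: integrable_increment_rate.
have dp := local_ergodic X_polish P_markov P_stationary Cp pq.
have dn := local_ergodic X_polish P_markov P_stationary Cn nq.
apply: occupation_ae; apply: filterS2 dp dn => z dpz dnz z01.
have /andP[z0 z1] := z01.
exists (fun=> 1%:E); split.
- exact: integration_time_one.
- by apply: aeW => w; rewrite lee_fin.
- exists (fun=> +oo%E); first exact: integration_time_infty.
  by apply: aeW => w; rewrite ltry.
- move=> tau it tau1; rewrite asboolT//.
  have -> : Vg z.1 z.2 = cut_pos Vg z - cut_neg Vg z by rewrite cut_posB /cut z01.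
  rewrite [X in X @ _ --> _](_ : _ = fun h => h^-1 * fine (trans_occ q z.1 h z.2) -
      h^-1 * fine (trans_occ q' z.1 h z.2)).
    exact: cvgB (dpz z01) (dnz z01).
  by apply/funext => h; rewrite mulrBr.
Qed.

End solution.
End feynman_kac_bounds.

(** The bound is uniform over a time interval of length [1], so Tonelli's theorem transfers it to
    the product measure. *)
Lemma feynman_kac_orlicz (R : realType) (X : completePseudoMetricType R)
    (m : probability (borelType X) R) (gamma : R -> \bar R) (g : R -> X -> R) (a K : R) :
  young_function gamma -> 0 < a -> measurable01 g ->
  (forall t, 0 <= t <= 1 -> (\int[m]_x gamma (a * `|g t x|)%R <= K%:E)%E) ->
  orlicz (lebesgue_measure \x m)%E (@I01X R X) gamma (time_space g).
Proof.
move=> yg a0 mg hK; split => //; exists a => //.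
pose F (z : measurableTypeR R * borelType X) := gamma (a * `|cut g z|).
have mF : measurable_fun setT F.
  apply: (measurableT_comp (measurable_young yg)); apply: measurable_funM => //.
  by apply: measurableT_comp => //; exact: measurable_cut.
have F0 z : (0 <= F z)%E by exact: young_ge0.
have Fout z : ~ (0 <= z.1 <= 1) -> F z = 0%E.
  by move=> z01; rewrite /F cut_out// normr0 mulr0 young0.
rewrite (_ : (\int[_]_(z in _) _)%E = (\int[(lebesgue_measure \x m)%E]_z F z)%E); last first.
  rewrite [LHS]integral_mkcond; apply: eq_integral => -[t x] _; rewrite patchE.
  case: ifPn => [|/negP]; rewrite inE /I01X /= in_itv/=.
    by move=> [t01 _]; rewrite /F /cut/= t01.
  by move=> tx; rewrite Fout// => t01; apply: tx.
rewrite fubini_tonelli1// /fubini_F.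
have K0 : (0 <= K%:E)%E.
  apply: le_trans (hK 0 _); last by rewrite lexx ler01.
  by apply: integral_ge0 => x _; exact: young_ge0.
apply: (@le_lt_trans _ _ (\int[lebesgue_measure]_(t in `[0%R, 1%R]) K%:E)%E); last first.
  by rewrite integral_cst//= lebesgue_measure_itv/= lte_fin ltr01 oppr0 adde0 mule1 ltry.
rewrite [leRHS]integral_mkcond; apply: ge0_le_integral => //.
- by move=> t _; exact: integral_ge0.
- exact: (@measurable_fun_fubini_tonelli_F _ _ _ _ _ m F mF F0).
- by apply/(measurable_restrictT _ (measurable_itv _)); exact: measurable_cst.
- move=> t _; rewrite patchE mem_setE in_itv/=; case: ifPn => [t01|/negP t01].
    by rewrite /F /cut/= t01; exact: hK.
  by rewrite integral0_eq// => x _; exact: Fout.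
Qed.

Lemma feynman_kac_potential_integrable (R : realType) (X : completePseudoMetricType R)
    (m : probability (borelType X) R) (V g : R -> X -> R) (C : R) :
  measurable01 V -> measurable01 g ->
  is_rate m (fun z => `|cut V z| * `|cut g z|) C ->
  (\int[(lebesgue_measure \x m)%E]_(z in @I01X R X)
     (`|V z.1 z.2| * g z.1 z.2)%:E < +oo)%E.
Proof.
move=> mV mg hC.
have mf : measurable_fun (@I01X R X) (fun z => (`|V z.1 z.2| * g z.1 z.2)%:E).
  apply/measurable_EFinP; apply: measurable_funM; last exact: mg.
  by apply: measurableT_comp => //; exact: mV.
apply: le_lt_trans (lee_abs _) _.
apply: le_lt_trans (le_abse_integral _ (@measurable_I01X R X) mf) _.
have /integrableP[_] := rate_integrable_product hC.
move=> h; rewrite integral_mkcond; apply: le_lt_trans h.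
rewrite le_eqVlt; apply/orP; left; apply/eqP; apply: eq_integral => -[t x] _; rewrite patchE.
case: ifPn => [|/negP]; rewrite inE /I01X /= in_itv/=.
  by move=> [t01 _]; rewrite /cut/= t01 !normrM !normr_id.
move=> tx; rewrite cut_out ?normr0 ?mul0r ?normr0// => t01.
by apply: tx.
Qed.

Theorem theorem3p3 (R : realType) (X : completePseudoMetricType R)
  (P : probability (cadlag R X) R) (m : probability (borelType X) R)
  (gamma : R -> \bar R) (V : R -> X -> R) (g1 : borelType X -> R)
  (X_polish : polish X)
  (P_markov : is_markov P)
  (P_stationary : is_stationary P m)
  (gamma_admissible : admissible m g1 gamma)
  (V_measurable : measurable01 V)
  (V_lower : exists c : R, forall t x, 0 <= t <= 1 -> c <= V t x)
  (V_ui : uniformly_integrable m [set` `[(0:R), 1]]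
            (fun t x => young_conj gamma (V t x)))
  (g1_ge0 : forall x, 0 <= g1 x)
  (g1_orlicz : orlicz m setT gamma g1) :
  (exists2 g : R -> X -> R, feynman_kac P V g1 g &
     forall t x, 0 <= t <= 1 -> 0 <= g t x) /\
  forall g : R -> X -> R, feynman_kac P V g1 g ->
    [/\ forall t, 0 <= t <= 1 -> {ae m, forall x, 0 <= g t x},
        orlicz (lebesgue_measure \x m)%E (@I01X R X) gamma (time_space g),
        exists l v : R -> X -> R,
          [/\ is_stochastic_derivative P g l,
              is_extended_generator P g v
            & {ae (lebesgue_measure \x m)%E, forall z, 0 <= z.1 <= 1 ->
                 l z.1 z.2 = v z.1 z.2 /\
                 v z.1 z.2 = V z.1 z.2 * g z.1 z.2}]
      & (\int[(lebesgue_measure \x m)%E]_(z in @I01X R X)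
           (`|V z.1 z.2| * g z.1 z.2)%:E < +oo)%E].

Proof.
have [c V_ge] := V_lower; have [g1_measurable _] := g1_orlicz.
split.
  exact: (feynman_kac_exists X_polish P_markov P_stationary gamma_admissible V_measurable V_ge
    g1_ge0 g1_measurable).
move=> g g_fk; split.
- by move=> t; exact: (feynman_kac_ge0 P_stationary g1_ge0 g_fk).
- have [yg _ _ _ _] := gamma_admissible.
  apply: (feynman_kac_orlicz yg _ g_fk.1 (feynman_kac_young P_stationary gamma_admissible
    V_measurable V_ge g1_ge0 g1_measurable g_fk)).
  by rewrite invr_gt0 mulr_gt0// expR_gt0.
- exists (Vg V g), (Vg V g); split.
  + exact: (stochastic_derivative_fk X_polish P_markov P_stationary gamma_admissible V_measurable
      V_ge V_ui g1_ge0 g1_measurable g_fk).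
  + exact: (extended_generator_fk P_stationary gamma_admissible V_measurable
      V_ge V_ui g1_ge0 g1_measurable g_fk).
  + by apply: aeW.
- have [C hC] := feynman_kac_rate P_stationary gamma_admissible V_measurable V_ge V_ui g1_ge0
    g1_measurable g_fk.
  exact: (feynman_kac_potential_integrable V_measurable g_fk.1 hC).
Qed.
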